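(* Let $n\ge3$ and $V\equiv 1$ on $\mathbb{R}^n$, and let $T_3=\nabla(-\Delta+1)^{-1/2}$. There exists a function $b\in L^1_{loc}(\mathbb{R}^n)$ with $b\notin \mathrm{BMO}(\mathbb{R}^n)$ such that $[b,T_3]$ is bounded on $L^2(\mathbb{R}^n)$.
   Context: $T_3$ is understood componentwise, i.e. as the family $\partial_j(-\Delta+1)^{-1/2}$, $1\le j\le n$; each component is bounded on $L^2(\mathbb{R}^n)$. $\mathrm{BMO}(\mathbb{R}^n)$ is the space of $b\in L^1_{loc}(\mathbb{R}^n)$ with $\sup_B\frac1{|B|}\int_B|b-b_B|\,dy<\infty$, the supremum over all balls $B$, where $b_B=\frac1{|B|}\int_B b$. The commutator is $[b,T]f=bTf-T(bf)$. For an operator $T$ bounded on $L^2$ and a function $b\in L^1_{loc}$, ''$[b,T]$ is bounded on $L^2$'' means that there is $C$ such that $\|bTf-T(bf)\|_2\le C\|f\|_2$ for all $f\in L^2$ with $bf\in L^2$ (a dense subspace of $L^2$). *)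

(* Defs.v *)
From HB Require Import structures.
From mathcomp Require Import all_boot all_order all_algebra.
From mathcomp Require Import all_classical all_reals all_analysis.
From mathcomp Require Import complex.

Set Implicit Arguments.
Unset Strict Implicit.
Unset Printing Implicit Defensive.

Import Order.TTheory GRing.Theory Num.Theory numFieldNormedType.Exports.

Local Open Scope classical_set_scope.
Local Open Scope ring_scope.
Local Open Scope complex_scope.

(* R^n is 'rV[R]_n, with the sigma-algebra generated by the coordinates (the
   Borel sets).  The library norm on 'rV[R]_n is the sup norm; it is used only
   through the topology, and lengths and balls go through [enorm]. *)
Section measurable_rV.
Context {R : realType} (n : nat).

Let coord (i : 'I_n) (v : 'rV[R]_n) : measurableTypeR R := v ord0 i.

Let rV_set0 : g_sigma_preimage coord set0.
Proof. exact: sigma_algebra0. Qed.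

Let rV_setC A : g_sigma_preimage coord A -> g_sigma_preimage coord (~` A).
Proof. exact: sigma_algebraC. Qed.

Let rV_bigcup (F : (set _)^nat) : (forall i, g_sigma_preimage coord (F i)) ->
  g_sigma_preimage coord (\bigcup_i (F i)).
Proof. exact: sigma_algebra_bigcup. Qed.

HB.instance Definition _ := @isMeasurable.Build default_measure_display
  'rV[R]_n (g_sigma_preimage coord) rV_set0 rV_setC rV_bigcup.

End measurable_rV.

Section lebesgue_rV.
Context {R : realType}.

Lemma measurable_coord n (i : 'I_n) :
  measurable_fun setT (fun v : 'rV[R]_n => v ord0 i : measurableTypeR R).
Proof.
move=> _ Y mY; rewrite setTI; apply: sub_sigma_algebra => /=.
rewrite -bigcup_seq/=; exists i => /=; first by rewrite mem_index_enum.
by exists Y => //; rewrite setTI.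
Qed.

Lemma measurable_fun_rV d (T : measurableType d) n (f : T -> 'rV[R]_n) :
  (forall i, measurable_fun setT (fun t => f t ord0 i : measurableTypeR R)) ->
  measurable_fun setT f.
Proof.
move=> mf _ Y mY; rewrite setTI.
move: Y mY; apply: smallest_sub.
  split.
  - by rewrite /= preimage_set0; exact: measurable0.
  - by move=> A mA; rewrite /= setTD -preimage_setC; exact: measurableC.
  - by move=> F mF; rewrite /= preimage_bigcup; exact: bigcup_measurable.
rewrite -bigcup_seq => A [i _] [B mB <-] /=.
by rewrite setTI -[X in measurable X]setTI; exact: (mf i _ B mB).
Qed.

Definition rV_cons n (p : measurableTypeR R * 'rV[R]_n) : 'rV[R]_n.+1 :=
  row_mx (const_mx p.1) p.2 : 'rV[R]_(1 + n).

Definition rV_uncons n (v : 'rV[R]_n.+1) : measurableTypeR R * 'rV[R]_n :=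
  (v ord0 ord0, rsubmx (v : 'rV[R]_(1 + n))).

Lemma rV_consK n : cancel (@rV_cons n) (@rV_uncons n).
Proof.
case=> x v; congr pair; last exact: row_mxKr.
transitivity ((row_mx (const_mx x : 'rV_1) v) ord0 (lshift n ord0)).
  by congr (_ _ _); exact: val_inj.
by rewrite row_mxEl mxE.
Qed.

Lemma rV_unconsK n : cancel (@rV_uncons n) (@rV_cons n).
Proof.
move=> v; rewrite -[RHS](@hsubmxK _ _ 1 n v) /rV_cons.
suff -> : const_mx (rV_uncons v).1 = lsubmx (v : 'rV_(1 + n)) by [].
by apply/rowP => i; rewrite !mxE ord1; congr (v _ _); exact: val_inj.
Qed.

Lemma measurable_rV_cons n : measurable_fun setT (@rV_cons n).
Proof.
apply: measurable_fun_rV => i; case: (@split_ordP 1 n i) => j ->.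
  apply: (eq_measurable_fun fst) => // p _.
  by rewrite [RHS](@row_mxEl _ 1 1 n) mxE.
apply: (eq_measurable_fun (fun p : _ * 'rV[R]_n => p.2 ord0 j)) => [p _|].
  by rewrite [RHS](@row_mxEr _ 1 1 n).
by apply: (measurableT_comp (measurable_coord j)); exact: measurable_snd.
Qed.

Lemma measurable_rV_uncons n : measurable_fun setT (@rV_uncons n).
Proof.
apply: measurable_fun_pair; first exact: measurable_coord.
apply: measurable_fun_rV => i; apply: (eq_measurable_fun (fun v : 'rV[R]_n.+1 =>
    v ord0 (rshift 1 i))) => [v _|]; first by rewrite /= mxE.
exact: measurable_coord.
Qed.

End lebesgue_rV.

Definition lebesgue_cons {R : realType} n
    (mu : {sigma_finite_measure set 'rV[R]_n -> \bar R})
    : set 'rV[R]_n.+1 -> \bar R :=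
  pushforward (lebesgue_measure \x mu)%E (@rV_cons R n).

Section lebesgue_cons_measure.
Context {R : realType} (n : nat).
Variable mu : {sigma_finite_measure set 'rV[R]_n -> \bar R}.
Local Notation nu := (lebesgue_cons mu).

Let prod := (@lebesgue_measure R \x mu)%E.

Let nu0 : nu set0 = 0%E.
Proof. by rewrite /lebesgue_cons /pushforward preimage_set0 measure0. Qed.

Let nu_ge0 A : (0 <= nu A)%E.
Proof. exact: (measure_ge0 prod). Qed.

Let nu_sigma_additive : semi_sigma_additive nu.
Proof.
move=> F mF tF mUF.
rewrite /lebesgue_cons /pushforward preimage_bigcup.
apply: (@measure_semi_sigma_additive _ _ _ prod).
- by move=> k; rewrite -[X in measurable X]setTI; exact: measurable_rV_cons.
- apply/trivIsetP => /= i j _ _ ij; rewrite -preimage_setI.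
  by move/trivIsetP : tF => /(_ _ _ _ _ ij) ->//; rewrite preimage_set0.
- by rewrite -preimage_bigcup -[X in measurable X]setTI;
    exact: measurable_rV_cons.
Qed.

HB.instance Definition _ :=
  isMeasure.Build _ _ _ nu nu0 nu_ge0 nu_sigma_additive.

Let nu_sigma_finite : sigma_finite setT nu.
Proof.
have /sigma_finiteP[F [TF ndF Foo]] := sigma_finiteT (@lebesgue_measure R).
have /sigma_finiteP[G [TG ndG Goo]] := sigma_finiteT mu.
exists (fun k => @rV_uncons R n @^-1` (F k `*` G k)).
  rewrite -preimage_bigcup -[LHS](preimage_setT (@rV_uncons R n)).
  congr (_ @^-1` _); rewrite -setXTT TF TG predeqE => -[x y]; split.
    move=> [/= [k _ Fkx] [l _ Gly]]; exists (maxn k l) => //; split.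
    - by move: x Fkx; exact/subsetPset/ndF/leq_maxl.
    - by move: y Gly; exact/subsetPset/ndG/leq_maxr.
  by move=> [k _ []/= ? ?]; split; exists k.
move=> k; have [mF Fk] := Foo k; have [mG Gk] := Goo k; split.
  rewrite -[X in measurable X]setTI; apply: measurable_rV_uncons => //.
  exact: measurableX.
rewrite /lebesgue_cons /pushforward -comp_preimage.
rewrite (_ : _ \o _ = id) ?preimage_id; last exact/funext/rV_consK.
by rewrite product_measure1E// lte_mul_pinfty// ge0_fin_numE.
Qed.

HB.instance Definition _ := Measure_isSigmaFinite.Build _ _ _ nu nu_sigma_finite.

End lebesgue_cons_measure.

Fixpoint lebesgue_rV (R : realType) (n : nat)
    : {sigma_finite_measure set 'rV[R]_n -> \bar R} :=
  match n with
  | 0 => \d_(0 : 'rV[R]_0)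
  | m.+1 => lebesgue_cons (lebesgue_rV R m)
  end.

Lemma lebesgue_rV_box (R : realType) (n : nat)
    (A : 'I_n -> set (measurableTypeR R)) :
  (forall i, measurable (A i)) ->
  lebesgue_rV R n [set v : 'rV[R]_n | forall i, A i (v ord0 i)] =
  (\prod_(i < n) (lebesgue_measure (A i) : \bar R))%E.
Proof.
elim: n A => [|n IH] A mA /=.
  by rewrite big_ord0 diracE mem_set// => -[].
rewrite big_ord_recl -(IH (fun i => A (lift ord0 i)))//.
rewrite /lebesgue_cons /pushforward -product_measure1E//; last first.
  rewrite (_ : mkset _ = \bigcap_(i in [set: 'I_n])
    ((fun v : 'rV[R]_n => v ord0 i) @^-1` A (lift ord0 i))); last first.
    by apply/seteqP; split => [v vA i _|v vA i]; [exact: vA|exact: (vA i)].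
  apply: fin_bigcap_measurable => // i _.
  by rewrite -[X in measurable X]setTI; exact: measurable_coord.
congr (_ _); apply/seteqP; split => -[x v] /=.
- move=> xvA; split=> [|i].
  + by have := xvA ord0; rewrite -[rV_cons _ _ _]/((rV_uncons (rV_cons (x, v))).1) rV_consK.
  + have := xvA (lift ord0 i).
    have -> : lift ord0 i = rshift 1 i by exact: val_inj.
    by rewrite [rV_cons _ _ _](@row_mxEr _ 1 1 n).
- move=> [xA vA] i; case: (unliftP ord0 i) => [j ->|->].
  + have e : lift ord0 j = rshift 1 j by exact: val_inj.
    by have := vA j; rewrite e [rV_cons _ _ _](@row_mxEr _ 1 1 n).
  + by rewrite -[rV_cons _ _ _]/((rV_uncons (rV_cons (x, v))).1) rV_consK.
Qed.

Section analysis_rV.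
Context {R : realType} (n : nat).
Local Notation V := 'rV[R]_n.
Local Notation C := R[i].
Local Notation mu := (lebesgue_rV R n).
Local Notation Re := complex.Re.
Local Notation Im := complex.Im.
Local Notation normc := (@ComplexField.Normc.normc R).

Definition dot (x y : V) : R := \sum_i x ord0 i * y ord0 i.

Definition enorm (x : V) : R := Num.sqrt (dot x x).

Definition eball (x : V) (r : R) : set V := [set y | enorm (y - x) < r].

Definition locally_integrable_rV (b : V -> R) : Prop :=
  measurable_fun setT b /\
  forall K : set V, compact K -> (\int[mu]_(x in K) `|b x|%:E < +oo)%E.

Definition mean (b : V -> R) (B : set V) : R :=
  (fine (mu B))^-1 * \int[mu]_(y in B) b y.

Definition mean_oscillation (b : V -> R) (B : set V) : \bar R :=
  ((fine (mu B))^-1%:E * \int[mu]_(y in B) `|b y - mean b B|%:E)%E.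

Definition BMO (b : V -> R) : Prop :=
  locally_integrable_rV b /\
  exists M : R, forall (x : V) (r : R), 0 < r ->
    (mean_oscillation b (eball x r) <= M%:E)%E.

Definition L2norm (f : V -> C) : \bar R :=
  'N[mu]_2%:E[EFin \o normc \o f].

Definition L2 (f : V -> C) : Prop :=
  [/\ measurable_fun setT (fun x => Re (f x)),
      measurable_fun setT (fun x => Im (f x)) &
      (L2norm f < +oo)%E].

Definition Cintegral (D : set V) (f : V -> C) : C :=
  (\int[mu]_(x in D) Re (f x)) +i* (\int[mu]_(x in D) Im (f x)).

Definition fourier_integral (D : set V) (f : V -> C) (xi : V) : C :=
  Cintegral D (fun x => (cos (dot x xi) -i* sin (dot x xi)) * f x).

(* The Fourier-Plancherel transform on L^2, with kernel exp(- i x.xi): F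
   represents the limit in L^2 of the Fourier integrals of f over the balls
   |x| < N.  Elements of L^2 are classes modulo equality a.e., so operators on
   L^2 are given here by their graphs on representatives. *)
Definition fourier (f F : V -> C) : Prop :=
  [/\ L2 f, L2 F &
      L2norm (fun xi => fourier_integral (eball 0 N%:R) f xi - F xi)
        @[N --> \oo] --> 0%E].

Definition symbol_schrodinger (xi : V) : R := enorm xi ^+ 2 + 1.

(* u = (-Delta + 1)^(-1/2) f, by the functional calculus of the Fourier
   transform, in which -Delta + 1 is multiplication by |xi|^2 + 1. *)
Definition inv_sqrt_schrodinger (f u : V -> C) : Prop :=
  exists2 F : V -> C, fourier f F &
    fourier u (fun xi => (symbol_schrodinger xi `^ (- 2^-1))%:C * F xi).

Definition basis_vector (j : 'I_n) : V := delta_mx ord0 j.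

Definition test_function (phi : V -> R) : Prop :=
  [/\ compact (closure [set x | phi x != 0]),
      forall j x, derivable phi x (basis_vector j) &
      forall j, continuous ('D_(basis_vector j) phi : V -> R)].

(* g is the weak derivative of u in the direction of the j-th coordinate. *)
Definition weak_partial (j : 'I_n) (u g : V -> C) : Prop :=
  forall phi, test_function phi ->
    Cintegral setT (fun x => ('D_(basis_vector j) phi x)%:C * u x) =
    - Cintegral setT (fun x => (phi x)%:C * g x).

(* The graph of the j-th component of nabla (-Delta + 1)^(-1/2) on L^2.  By
   Plancherel's theorem it is defined on all of L^2 and single-valued up to
   equality a.e.: g has Fourier transform i xi_j (|xi|^2 + 1)^(-1/2) F. *)
Definition T3 (j : 'I_n) (f g : V -> C) : Prop :=
  [/\ L2 f, L2 g & exists2 u : V -> C, inv_sqrt_schrodinger f u & weak_partial j u g].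

Definition pointwise_mul (b : V -> R) (f : V -> C) : V -> C :=
  fun x => (b x)%:C * f x.

(* [Tf] and [Tbf] stand for T f and T (b f). *)
Definition commutator_bounded (b : V -> R)
    (T : (V -> C) -> (V -> C) -> Prop) : Prop :=
  exists K : R, forall f Tf Tbf : V -> C,
    L2 f -> L2 (pointwise_mul b f) -> T f Tf -> T (pointwise_mul b f) Tbf ->
    (L2norm (fun x => (pointwise_mul b Tf x - Tbf x)%R) <= K%:E * L2norm f)%E.

End analysis_rV.

(* Main.v *)
(* The witness is a coordinate, b(x) = x_i.  Its mean oscillation on a ball is
   proportional to the radius, so it is not in BMO.  On the Fourier side
   multiplication by x_i is the derivative in xi_i, so [b, T_3] multiplies by the
   derivative of the symbol xi_j (|xi|^2 + 1)^(-1/2) in xi_i, which is bounded.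
   To avoid differentiating Fourier transforms, b is replaced by the bounded
   function sin(s x_i)/s, which acts as a difference quotient with step s: the
   Lipschitz bound for the symbol yields an estimate uniform in s, and Fatou's
   lemma passes to the limit s -> 0.  The Plancherel identity comes from an
   explicit computation for indicators of boxes and their density in L^2. *)

Require Import Defs.
From mathcomp Require Import all_boot all_order all_algebra.
From mathcomp Require Import all_classical all_reals all_analysis measurable_realfun.
From mathcomp Require Import complex ring lra.

Set Implicit Arguments.
Unset Strict Implicit.
Unset Printing Implicit Defensive.

Import Order.TTheory GRing.Theory Num.Theory numFieldNormedType.Exports.

Local Open Scope classical_set_scope.
Local Open Scope ring_scope.
Local Open Scope complex_scope.

Local Notation Re := complex.Re.
Local Notation Im := complex.Im.

(** * Complex-valued square-integrable functions *)

(** The definitions give operators only as graphs: [T3 j f g] says that g is a weak derivative of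
    some u whose transform is a multiple of that of f. The proof therefore never produces a value of
    T3 and never identifies the transform of g; it bounds the norm of a weak derivative by duality
    ([weakT_bound]). In the same spirit T3 (a f), with a = sin(s x_i)/s, does not occur: the
    estimate compares T3 (b f) with a T3 f directly and carries the norm of b f - a f as an error,
    which vanishes as s -> 0. The derivative stays outside the multiplier m = (|xi|^2 + 1)^(-1/2):
    the quantity estimated is xi_j (m(xi) - m(eta)), with xi_j taken at one point, and the Leibniz
    rule for a u supplies the remaining term, a bounded multiple of u. Complex L^2 is treated as a
    real Hilbert space, and Young's inequality with a free weight replaces Cauchy-Schwarz. This
    loses constants, which is harmless because only some bound is claimed; the Plancherel constant
    cancels from the final estimate without being evaluated. *)

Section complex_numbers.
Context {R : realType}.
Implicit Types z w : R[i].

Lemma cReD z w : Re (z + w) = Re z + Re w. Proof. by case: z w => [? ?] []. Qed.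
Lemma cImD z w : Im (z + w) = Im z + Im w. Proof. by case: z w => [? ?] []. Qed.
Lemma cReN z : Re (- z) = - Re z. Proof. by case: z. Qed.
Lemma cImN z : Im (- z) = - Im z. Proof. by case: z. Qed.
Lemma cReM z w : Re (z * w) = Re z * Re w - Im z * Im w.
Proof. by case: z w => [? ?] []. Qed.
Lemma cImM z w : Im (z * w) = Re z * Im w + Im z * Re w.
Proof. by case: z w => [? ?] []. Qed.
Definition ReImE := (cReD, cImD, cReN, cImN, cReM, cImM).

Lemma complex_ext z w : Re z = Re w -> Im z = Im w -> z = w.
Proof. by case: z w => [? ?] [? ?] /= -> ->. Qed.

(** The Euclidean inner product of C = R^2, that is, the real part of z times the conjugate of w. It
    turns complex L^2 into a real Hilbert space with the same norm. *)
Definition rdot z w := Re z * Re w + Im z * Im w.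
Definition sq z := rdot z z.

Lemma rdotC z w : rdot z w = rdot w z.
Proof. by rewrite /rdot [Re z * _]mulrC [Im z * _]mulrC. Qed.

Lemma sqE z : sq z = Re z ^+ 2 + Im z ^+ 2.
Proof. by rewrite /sq /rdot !expr2. Qed.

Lemma sq_ge0 z : 0 <= sq z.
Proof. by rewrite sqE addr_ge0// sqr_ge0. Qed.

Lemma sqM z w : sq (z * w) = sq z * sq w.
Proof. by rewrite !sqE !ReImE; ring. Qed.

Lemma sq_real (a : R) : sq a%:C = a ^+ 2.
Proof. by rewrite sqE /= expr0n addr0. Qed.

Lemma sqN z : sq (- z) = sq z.
Proof. by rewrite !sqE !ReImE !sqrrN. Qed.

Lemma sqD z w : sq (z + w) = sq z + rdot z w *+ 2 + sq w.
Proof. by rewrite /sq /rdot !ReImE; ring. Qed.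

Lemma sqD_le z w : sq (z + w) <= 2 * sq z + 2 * sq w.
Proof.
rewrite !sqE !ReImE -subr_ge0.
rewrite (_ : _ - _ = (Re z - Re w) ^+ 2 + (Im z - Im w) ^+ 2); last by ring.
by rewrite addr_ge0 ?sqr_ge0.
Qed.

Lemma sqB_le z w : sq (z - w) <= 2 * sq z + 2 * sq w.
Proof. by rewrite -(sqN w) sqD_le. Qed.

(** Young's inequality, from a square with a free weight e. Choosing e does the work of
    Cauchy-Schwarz in the estimates below. *)
Lemma rdot_le_eta (e : R) z w : 0 < e -> rdot z w *+ 2 <= e * sq z + e^-1 * sq w.
Proof.
move=> e0; have ee : e * e^-1 = 1 by rewrite divff// gt_eqF.
rewrite !sqE /rdot -subr_ge0 (_ : _ - _ =
  e^-1 * (e * Re z - Re w) ^+ 2 + e^-1 * (e * Im z - Im w) ^+ 2).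
  by rewrite addr_ge0// mulr_ge0 ?sqr_ge0 ?invr_ge0 ?ltW.
by field; rewrite gt_eqF.
Qed.

Lemma normr_rdot_le z w : `|rdot z w| <= sq z + sq w.
Proof.
rewrite ler_norml !sqE /rdot.
have := (sqr_ge0 (Re z + Re w), sqr_ge0 (Re z - Re w), sqr_ge0 (Im z + Im w),
  sqr_ge0 (Im z - Im w)).
have := (sqr_ge0 (Re z), sqr_ge0 (Re w), sqr_ge0 (Im z), sqr_ge0 (Im w)).
by move=> -[[[? ?] ?] ?] [[[? ?] ?] ?]; apply/andP; split; lra.
Qed.

(** The constant 1 is integrable over sets of finite measure, so this dominates an L^2 function
    there by an integrable one. *)
Lemma normr_Re_le z : `|Re z| <= 1 + sq z.
Proof.
rewrite sqE ler_norml; have := sqr_ge0 (Im z); have := sqr_ge0 (Re z - 1).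
have := sqr_ge0 (Re z + 1) => ? ? ?; apply/andP; split; nra.
Qed.

Lemma normr_Im_le z : `|Im z| <= 1 + sq z.
Proof.
rewrite sqE ler_norml; have := sqr_ge0 (Re z); have := sqr_ge0 (Im z - 1).
have := sqr_ge0 (Im z + 1) => ? ? ?; apply/andP; split; nra.
Qed.

Lemma normc_sq z : ComplexField.Normc.normc z ^+ 2 = sq z.
Proof. by case: z => a b /=; rewrite sqr_sqrtr ?sqE// addr_ge0 ?sqr_ge0. Qed.

End complex_numbers.

Section complex_integral.
Context d (T : measurableType d) {R : realType}.
Variable mu : {measure set T -> \bar R}.
Implicit Types f g : T -> R[i].

Definition cmeas f := measurable_fun setT (fun x => Re (f x)) /\
  measurable_fun setT (fun x => Im (f x)).

Definition cint f : R[i] := (\int[mu]_x Re (f x)) +i* (\int[mu]_x Im (f x)).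

Definition cintegrable f :=
  mu.-integrable setT (EFin \o (fun x => Re (f x))) /\
  mu.-integrable setT (EFin \o (fun x => Im (f x))).

(** The squared norm lives in the extended reals, where it makes sense before square-integrability
    is known; [ip] is real, and [nsq_ip] links the two on [sqint] functions. *)
Definition nsq f : \bar R := (\int[mu]_x (sq (f x))%:E)%E.

Definition ip f g : R := \int[mu]_x rdot (f x) (g x).

Definition sqint f := cmeas f /\ (nsq f < +oo)%E.

Lemma cintegrable_meas f : cintegrable f -> cmeas f.
Proof.
by move=> [/measurable_int/measurable_EFinP ? /measurable_int/measurable_EFinP].
Qed.

Lemma cmeas_real (h : T -> R) : measurable_fun setT h -> cmeas (fun x => (h x)%:C).
Proof. by move=> mh; split => //=; exact: measurable_cst. Qed.

Lemma cmeasD f g : cmeas f -> cmeas g -> cmeas (fun x => f x + g x).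
Proof.
move=> [f1 f2] [g1 g2]; split.
  by under eq_fun do rewrite cReD; exact: measurable_funD.
by under eq_fun do rewrite cImD; exact: measurable_funD.
Qed.

Lemma cmeasN f : cmeas f -> cmeas (fun x => - f x).
Proof.
move=> [f1 f2]; split.
  by under eq_fun do rewrite cReN; exact: measurable_funN.
by under eq_fun do rewrite cImN; exact: measurable_funN.
Qed.

Lemma cmeasB f g : cmeas f -> cmeas g -> cmeas (fun x => f x - g x).
Proof. by move=> mf mg; apply: cmeasD => //; exact: cmeasN. Qed.

Lemma cmeasM f g : cmeas f -> cmeas g -> cmeas (fun x => f x * g x).
Proof.
move=> [f1 f2] [g1 g2]; split.
  under eq_fun do rewrite cReM.
  by apply: measurable_funB; exact: measurable_funM.
under eq_fun do rewrite cImM.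
by apply: measurable_funD; exact: measurable_funM.
Qed.

Lemma cmeas_cst c : cmeas (fun=> c).
Proof. by split; exact: measurable_cst. Qed.

Lemma measurable_rdot f g : cmeas f -> cmeas g ->
  measurable_fun setT (fun x => rdot (f x) (g x)).
Proof.
by move=> [f1 f2] [g1 g2]; apply: measurable_funD; exact: measurable_funM.
Qed.

Lemma measurable_sq f : cmeas f -> measurable_fun setT (fun x => sq (f x)).
Proof. by move=> mf; exact: measurable_rdot. Qed.

Lemma measurable_sqE f : cmeas f -> measurable_fun setT (fun x => (sq (f x))%:E).
Proof. by move=> mf; apply/measurable_EFinP; exact: measurable_sq. Qed.

Lemma nsq_ge0 f : (0 <= nsq f)%E.
Proof. by apply: integral_ge0 => x _; rewrite lee_fin sq_ge0. Qed.

Lemma eq_nsq f g : f =1 g -> nsq f = nsq g.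
Proof. by move=> fg; apply: eq_integral => x _; rewrite fg. Qed.

Lemma nsqN f : nsq (fun x => - f x) = nsq f.
Proof. by apply: eq_integral => x _; rewrite sqN. Qed.

Lemma nsqZ (c : R[i]) f : cmeas f -> nsq (fun x => c * f x) = ((sq c)%:E * nsq f)%E.
Proof.
move=> mf; rewrite /nsq; under eq_integral do rewrite sqM EFinM.
rewrite ge0_integralZl//; first exact: measurable_sqE.
  by move=> x _; rewrite lee_fin sq_ge0.
by rewrite lee_fin sq_ge0.
Qed.

Lemma le_nsq (a : R) f g : cmeas f -> cmeas g -> 0 <= a ->
  (forall x, sq (f x) <= a * sq (g x)) -> (nsq f <= a%:E * nsq g)%E.
Proof.
move=> mf mg a0 fg; rewrite /nsq -ge0_integralZl//; last 2 first.
- exact: measurable_sqE.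
- by move=> x _; rewrite lee_fin sq_ge0.
apply: ge0_le_integral => //.
- by move=> x _; rewrite lee_fin sq_ge0.
- exact: measurable_sqE.
- by apply: measurable_funeM; exact: measurable_sqE.
by move=> x _; rewrite -EFinM lee_fin.
Qed.

Lemma le_nsq1 f g : cmeas f -> cmeas g ->
  (forall x, sq (f x) <= sq (g x)) -> (nsq f <= nsq g)%E.
Proof.
move=> mf mg fg; rewrite -[leRHS]mul1e; apply: le_nsq => // x.
by rewrite mul1r.
Qed.

Lemma nsqD_le_eta (e : R) f g : cmeas f -> cmeas g -> 0 < e ->
  (nsq (fun x => f x + g x)%R <= (1 + e)%:E * nsq f + (1 + e^-1)%:E * nsq g)%E.
Proof.
move=> mf mg e0.
have e1 : 0 <= 1 + e by rewrite addr_ge0 ?ltW.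
have e2 : 0 <= 1 + e^-1 by rewrite addr_ge0 ?invr_ge0 ?ltW.
rewrite /nsq -!ge0_integralZl//; try exact: measurable_sqE;
  try by move=> x _; rewrite lee_fin sq_ge0.
rewrite -ge0_integralD//; last 4 first.
- by move=> x _; apply: mule_ge0; rewrite ?lee_fin// sq_ge0.
- by apply: measurable_funeM; exact: measurable_sqE.
- by move=> x _; apply: mule_ge0; rewrite ?lee_fin// sq_ge0.
- by apply: measurable_funeM; exact: measurable_sqE.
apply: ge0_le_integral => //.
- by move=> x _; rewrite lee_fin sq_ge0.
- by apply: measurable_sqE; exact: cmeasD.
- by apply: emeasurable_funD; apply: measurable_funeM; exact: measurable_sqE.
move=> x _; rewrite -!EFinM -EFinD lee_fin sqD !mulrDl !mul1r.
have := rdot_le_eta (f x) (g x) e0; lra.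
Qed.

Lemma nsqD_le f g : cmeas f -> cmeas g ->
  (nsq (fun x => f x + g x)%R <= 2%:E * nsq f + 2%:E * nsq g)%E.
Proof. by move=> mf mg; have := nsqD_le_eta mf mg ltr01; rewrite invr1. Qed.

Lemma nsqB_le f g : cmeas f -> cmeas g ->
  (nsq (fun x => f x - g x)%R <= 2%:E * nsq f + 2%:E * nsq g)%E.
Proof.
by move=> mf mg; rewrite -(nsqN g); apply: nsqD_le => //; exact: cmeasN.
Qed.

Lemma sqintD f g : sqint f -> sqint g -> sqint (fun x => f x + g x).
Proof.
move=> [mf f2] [mg g2]; split; first exact: cmeasD.
apply: le_lt_trans (nsqD_le mf mg) _.
by rewrite lte_add_pinfty// lte_mul_pinfty.
Qed.

Lemma sqint_le (a : R) f g : cmeas f -> sqint g -> 0 <= a ->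
  (forall x, sq (f x) <= a * sq (g x)) -> sqint f.
Proof.
move=> mf [mg g2] a0 fg; split => //.
by apply: le_lt_trans (le_nsq mf mg a0 fg) _; rewrite lte_mul_pinfty.
Qed.

Lemma sqintZ (c : R[i]) f : sqint f -> sqint (fun x => c * f x).
Proof.
move=> f2; apply: (@sqint_le (sq c) _ f) => //; last by move=> x; rewrite sqM.
  by apply: cmeasM; [exact: cmeas_cst|case: f2].
exact: sq_ge0.
Qed.

Lemma sqintN f : sqint f -> sqint (fun x => - f x).
Proof. by move=> [mf f2]; split; [exact: cmeasN|rewrite nsqN]. Qed.

Lemma sqintB f g : sqint f -> sqint g -> sqint (fun x => f x - g x).
Proof. by move=> f2 g2; apply: sqintD => //; exact: sqintN. Qed.

Lemma sqint0 : sqint (fun=> 0).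
Proof.
split; first exact: cmeas_cst.
rewrite /nsq; under eq_integral do rewrite sqE /= !expr0n addr0.
by rewrite integral0.
Qed.

Lemma integrable_rdot f g : sqint f -> sqint g ->
  mu.-integrable setT (EFin \o (fun x => rdot (f x) (g x))).
Proof.
move=> [mf f2] [mg g2]; apply/integrableP; split.
  by apply/measurable_EFinP; exact: measurable_rdot.
apply: (@le_lt_trans _ _ (nsq f + nsq g)%E); last exact: lte_add_pinfty.
rewrite /nsq -ge0_integralD//; last 4 first.
- by move=> x _; rewrite lee_fin sq_ge0.
- exact: measurable_sqE.
- by move=> x _; rewrite lee_fin sq_ge0.
- exact: measurable_sqE.
apply: ge0_le_integral => //.
- by apply/measurableT_comp => //; apply/measurable_EFinP; exact: measurable_rdot.
- by apply: emeasurable_funD; exact: measurable_sqE.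
by move=> x _; rewrite /= lee_fin normr_rdot_le.
Qed.

Lemma integrableRZl (c : R) (h : T -> R) : mu.-integrable setT (EFin \o h) ->
  mu.-integrable setT (EFin \o (fun x => c * h x)).
Proof.
move=> ih; rewrite (_ : _ \o _ = (fun x => c%:E * (EFin \o h) x))%E.
  exact: integrableZl.
by apply/funext => x /=; rewrite EFinM.
Qed.

Lemma integrableRD (h k : T -> R) : mu.-integrable setT (EFin \o h) ->
  mu.-integrable setT (EFin \o k) ->
  mu.-integrable setT (EFin \o (fun x => h x + k x)).
Proof.
move=> ih ik; rewrite (_ : _ \o _ = ((EFin \o h) \+ (EFin \o k)))%E.
  exact: integrableD.
by apply/funext => x /=; rewrite EFinD.
Qed.

Lemma integrableRB (h k : T -> R) : mu.-integrable setT (EFin \o h) ->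
  mu.-integrable setT (EFin \o k) ->
  mu.-integrable setT (EFin \o (fun x => h x - k x)).
Proof.
move=> ih ik; rewrite (_ : _ \o _ = ((EFin \o h) \- (EFin \o k)))%E.
  exact: integrableB.
by apply/funext => x /=; rewrite EFinB.
Qed.

Lemma ipC f g : ip f g = ip g f.
Proof. by apply: eq_Rintegral => x _; rewrite rdotC. Qed.

Lemma ipDl f g h : sqint f -> sqint g -> sqint h ->
  ip (fun x => f x + g x) h = ip f h + ip g h.
Proof.
move=> f2 g2 h2; rewrite /ip -RintegralD//; try exact: integrable_rdot.
by apply: eq_Rintegral => x _; rewrite /rdot !ReImE; ring.
Qed.

Lemma ipZl (a : R) f h : sqint f -> sqint h ->
  ip (fun x => a%:C * f x) h = a * ip f h.
Proof.
move=> f2 h2; rewrite /ip -RintegralZl//; last exact: integrable_rdot.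
by apply: eq_Rintegral => x _; rewrite /rdot !ReImE /=; ring.
Qed.

Lemma ipDr f g h : sqint f -> sqint g -> sqint h ->
  ip h (fun x => f x + g x) = ip h f + ip h g.
Proof. by move=> f2 g2 h2; rewrite ipC ipDl// ipC [ip g h]ipC. Qed.

Lemma ipZr (a : R) f h : sqint f -> sqint h ->
  ip h (fun x => a%:C * f x) = a * ip h f.
Proof. by move=> f2 h2; rewrite ipC ipZl// ipC. Qed.

Lemma nsq_ip f : sqint f -> nsq f = (ip f f)%:E.
Proof.
move=> f2; rewrite /ip /Rintegral fineK//.
by have /integrable_fin_num := integrable_rdot f2 f2; exact.
Qed.

Lemma ip_le_eta (e : R) f g : sqint f -> sqint g -> 0 < e ->
  ip f g *+ 2 <= e * ip f f + e^-1 * ip g g.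
Proof.
move=> f2 g2 e0; rewrite -mulr_natl /ip -!RintegralZl//; try exact: integrable_rdot.
rewrite -RintegralD//; last 2 first.
- by apply: integrableRZl; exact: integrable_rdot.
- by apply: integrableRZl; exact: integrable_rdot.
apply: le_Rintegral => //.
- by apply: integrableRZl; exact: integrable_rdot.
- apply: integrableRD => //.
  + by apply: integrableRZl; exact: integrable_rdot.
  + by apply: integrableRZl; exact: integrable_rdot.
by move=> x _; rewrite mulr_natl rdot_le_eta.
Qed.

Lemma eq_cintegrable f g : f =1 g -> cintegrable f -> cintegrable g.
Proof. by move=> /funext ->. Qed.

Lemma eq_cint f g : f =1 g -> cint f = cint g.
Proof. by move=> /funext ->. Qed.

Lemma cintegrableD f g : cintegrable f -> cintegrable g ->
  cintegrable (fun x => f x + g x).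
Proof.
move=> [f1 f2] [g1 g2]; split.
- rewrite (_ : _ \o _ = (EFin \o (fun x => Re (f x))) \+ (EFin \o (fun x => Re (g x))))%E.
    exact: integrableD.
  by apply/funext => x /=; rewrite cReD EFinD.
- rewrite (_ : _ \o _ = (EFin \o (fun x => Im (f x))) \+ (EFin \o (fun x => Im (g x))))%E.
    exact: integrableD.
  by apply/funext => x /=; rewrite cImD EFinD.
Qed.

Lemma cintegrableZ (c : R[i]) f : cintegrable f -> cintegrable (fun x => c * f x).
Proof.
move=> [f1 f2]; split.
  under [X in EFin \o X]eq_fun do rewrite cReM.
  by apply: integrableRB; exact: integrableRZl.
under [X in EFin \o X]eq_fun do rewrite cImM.
by apply: integrableRD; exact: integrableRZl.
Qed.

Lemma cintD f g : cintegrable f -> cintegrable g ->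
  cint (fun x => f x + g x) = cint f + cint g.
Proof.
move=> [f1 f2] [g1 g2]; rewrite /cint.
under eq_Rintegral do rewrite cReD.
under [X in _ +i* X]eq_Rintegral do rewrite cImD.
by rewrite !RintegralD.
Qed.

Lemma cintZ (c : R[i]) f : cintegrable f -> cint (fun x => c * f x) = c * cint f.
Proof.
move=> [f1 f2]; apply: complex_ext; rewrite !ReImE /=.
  under eq_Rintegral do rewrite cReM.
  by rewrite RintegralB ?RintegralZl//; exact: integrableRZl.
under eq_Rintegral do rewrite cImM.
by rewrite RintegralD ?RintegralZl//; exact: integrableRZl.
Qed.

End complex_integral.

(** * Product functions and Fubini's theorem *)

Section complex_fubini.
Context d1 d2 (T1 : measurableType d1) (T2 : measurableType d2) (R : realType).
Variable m1 : {sigma_finite_measure set T1 -> \bar R}.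
Variable m2 : {sigma_finite_measure set T2 -> \bar R}.
Local Notation m := (m1 \x m2)%E.

Lemma integrable_tensor (p : T1 -> R) (q : T2 -> R) :
  m1.-integrable setT (EFin \o p) -> m2.-integrable setT (EFin \o q) ->
  m.-integrable setT (EFin \o (fun z => p z.1 * q z.2)).
Proof.
move=> ip iq.
have mp : measurable_fun setT p by apply/measurable_EFinP; exact: measurable_int ip.
have mq : measurable_fun setT q by apply/measurable_EFinP; exact: measurable_int iq.
apply/integrable12ltyP.
  apply/measurable_EFinP; apply: measurable_funM.
    by apply: measurableT_comp => //.
  by apply: measurableT_comp => //.
move/integrableP : iq => [_ iq]; move/integrableP : ip => [_ ip].
under eq_integral => x _.
  under eq_integral => y _ do rewrite /= normrM EFinM.
  rewrite ge0_integralZl//; last first.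
    by apply/measurable_EFinP; exact: measurableT_comp.
  over.
rewrite /= ge0_integralZr//.
- by rewrite lte_mul_pinfty// ?integral_ge0// ge0_fin_numE// integral_ge0.
- by apply/measurable_EFinP; exact: measurableT_comp.
- by rewrite integral_ge0.
Qed.

Lemma Rintegral_tensor (p : T1 -> R) (q : T2 -> R) :
  m1.-integrable setT (EFin \o p) -> m2.-integrable setT (EFin \o q) ->
  \int[m]_z (p z.1 * q z.2) = (\int[m1]_x p x) * (\int[m2]_y q y).
Proof.
move=> ip iq; have ipq := integrable_tensor ip iq.
rewrite /Rintegral -integral12_prod_meas1//.
have iqf : (\int[m2]_y (q y)%:E)%E \is a fin_num by exact: integrable_fin_num iq.
have ipf : (\int[m1]_y (p y)%:E)%E \is a fin_num by exact: integrable_fin_num ip.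
rewrite /fubini_F /=; under eq_integral => x _.
  under eq_integral => y _ do rewrite EFinM.
  rewrite integralZl//; over.
rewrite /= -(fineK iqf).
by rewrite integralZr// -(fineK ipf).
Qed.

Lemma cintegrable_tensor (p : T1 -> R[i]) (q : T2 -> R[i]) :
  cintegrable m1 p -> cintegrable m2 q ->
  cintegrable m (fun z => p z.1 * q z.2).
Proof.
move=> [p1 p2] [q1 q2]; split.
  under [X in EFin \o X]eq_fun do rewrite cReM.
  by apply: integrableRB;
   [exact: (integrable_tensor p1 q1)|exact: (integrable_tensor p2 q2)].
under [X in EFin \o X]eq_fun do rewrite cImM.
by apply: integrableRD;
 [exact: (integrable_tensor p1 q2)|exact: (integrable_tensor p2 q1)].
Qed.

Lemma cint_tensor (p : T1 -> R[i]) (q : T2 -> R[i]) :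
  cintegrable m1 p -> cintegrable m2 q ->
  cint m (fun z => p z.1 * q z.2) = cint m1 p * cint m2 q.
Proof.
move=> [p1 p2] [q1 q2]; apply: complex_ext; rewrite !ReImE /=.
  rewrite (_ : (fun x => Re _) = (fun x => Re (p x.1) * Re (q x.2) -
    Im (p x.1) * Im (q x.2))); last by apply/funext => x; rewrite cReM.
  rewrite RintegralB// ?(Rintegral_tensor p1 q1) ?(Rintegral_tensor p2 q2)//.
    exact: (integrable_tensor p1 q1).
  exact: (integrable_tensor p2 q2).
rewrite (_ : (fun x => Im _) = (fun x => Re (p x.1) * Im (q x.2) +
  Im (p x.1) * Re (q x.2))); last by apply/funext => x; rewrite cImM.
rewrite RintegralD// ?(Rintegral_tensor p1 q2) ?(Rintegral_tensor p2 q1)//.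
  exact: (integrable_tensor p1 q2).
exact: (integrable_tensor p2 q1).
Qed.

End complex_fubini.

Section product_functions.
Context {R : realType}.

Lemma rV_cons0 n (p : measurableTypeR R * 'rV[R]_n) : rV_cons p ord0 ord0 = p.1.
Proof.
by rewrite -[LHS]/((rV_uncons (rV_cons p)).1) rV_consK.
Qed.

Lemma rV_consS n (p : measurableTypeR R * 'rV[R]_n) i :
  rV_cons p ord0 (lift ord0 i) = p.2 ord0 i.
Proof.
have -> : lift ord0 i = rshift 1 i by exact: val_inj.
by rewrite [LHS](@row_mxEr _ 1 1 n).
Qed.

Lemma cmeas_comp d1 d2 (T1 : measurableType d1) (T2 : measurableType d2)
    (f : T2 -> R[i]) (g : T1 -> T2) : measurable_fun setT g -> cmeas f ->
  cmeas (fun x => f (g x)).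
Proof.
by move=> mg [f1 f2]; split; [apply: (measurableT_comp f1)|apply: (measurableT_comp f2)].
Qed.

Lemma cmeas_prod d (T : measurableType d) (I : Type) (s : seq I)
    (f : I -> T -> R[i]) :
  (forall i, cmeas (f i)) -> cmeas (fun x => \prod_(i <- s) f i x).
Proof.
move=> mf; elim: s => [|i s IH].
  by under eq_fun do rewrite big_nil; exact: cmeas_cst.
under eq_fun do rewrite big_cons.
by apply: cmeasM.
Qed.

Lemma cmeas_prod_coord n (f : 'I_n -> measurableTypeR R -> R[i]) :
  (forall i, cmeas (f i)) -> cmeas (fun v : 'rV[R]_n => \prod_(i < n) f i (v ord0 i)).
Proof.
move=> mf; apply: (@cmeas_prod _ _ _ _ (fun i (v : 'rV[R]_n) => f i (v ord0 i))) => i.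
by apply: (cmeas_comp (@measurable_coord R n i)).
Qed.

(** Integrability is proved together with the value because Fubini's theorem for one more coordinate
    needs it of the remaining product. *)
Lemma cint_prod_coord n (f : 'I_n -> measurableTypeR R -> R[i]) :
  (forall i, cintegrable lebesgue_measure (f i)) ->
  cintegrable (lebesgue_rV R n) (fun v => \prod_(i < n) f i (v ord0 i)) /\
  cint (lebesgue_rV R n) (fun v => \prod_(i < n) f i (v ord0 i)) =
    \prod_(i < n) cint lebesgue_measure (f i).
Proof.
elim: n f => [|n IH] f intf.
  (* In dimension 0 the measure is a Dirac mass and the product is empty, so both sides are 1. *)
  under [X in cintegrable _ X]eq_fun do rewrite big_ord0.
  under [X in cint _ X]eq_fun do rewrite big_ord0.
  rewrite big_ord0 /=; split.
    split; apply/integrableP; (split; first by exact/measurable_EFinP/measurable_cst).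
      by rewrite integral_dirac//= diracT mul1e normr1 ltry.
    by rewrite integral_dirac//= diracT mul1e normr0 ltry.
  apply: complex_ext; rewrite /= /Rintegral integral_dirac//=.
    by rewrite indicT mul1r.
  by rewrite indicT mul1r.
have [IH1 IH2] := IH (fun i => f (lift ord0 i)) (fun i => intf _).
pose F := fun v : 'rV[R]_n.+1 => \prod_(i < n.+1) f i (v ord0 i).
have mF : cmeas F.
  by apply: cmeas_prod_coord => i; exact: cintegrable_meas (intf i).
have FE : F \o @rV_cons R n = fun p => f ord0 p.1 *
    \prod_(i < n) f (lift ord0 i) (p.2 ord0 i).
  apply/funext => p; rewrite /F /= big_ord_recl rV_cons0.
  by congr (_ * _); apply: eq_bigr => i _; rewrite rV_consS.
have iF : cintegrable (lebesgue_measure \x lebesgue_rV R n)%E (F \o @rV_cons R n).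
  rewrite FE; exact: (cintegrable_tensor (intf ord0) IH1).
have [mF1 mF2] := mF; have [iF1 iF2] := iF.
split.
  by split; apply: (integrable_pushforward (@measurable_rV_cons R n)) => //;
    exact/measurable_EFinP.
transitivity (cint (lebesgue_measure \x lebesgue_rV R n)%E (F \o @rV_cons R n)).
  apply: complex_ext; rewrite /= /Rintegral; congr fine;
    apply: (integral_pushforward (@measurable_rV_cons R n)) => //;
    exact/measurable_EFinP.
by rewrite FE (cint_tensor (intf ord0) IH1) big_ord_recl IH2.
Qed.

End product_functions.

(** * Changes of variables *)

Section affine_change.
Context {R : realType}.
Local Notation mu := (@lebesgue_measure R).
Local Notation T1 := (measurableTypeR R).

Definition affine (a b x : R) : R := a * x + b.

Lemma measurable_affine a b : measurable_fun setT (affine a b : T1 -> T1).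
Proof.
by apply: measurable_funD => //; apply: measurable_funM.
Qed.

Lemma affine_itvoc a b (u v : R) : 0 < a -> affine a b @^-1` `]u, v] =
  `](u - b) / a, (v - b) / a]%classic.
Proof.
move=> a0; apply/seteqP; split => x /=; rewrite !in_itv /= /affine.
  by move=> /andP[ux xv]; rewrite ltr_pdivrMr// ler_pdivlMr// mulrC; apply/andP; split; lra.
by rewrite ltr_pdivrMr// ler_pdivlMr// mulrC => /andP[ux xv]; apply/andP; split; lra.
Qed.

(** By uniqueness of Lebesgue measure it suffices to compare it on half-open intervals with the
    push-forward scaled by a. *)
Lemma lebesgue_measure_affine a b (A : set T1) : 0 < a -> measurable A ->
  (a%:E * mu (affine a b @^-1` A))%E = mu A.
Proof.
move=> a0 mA.
have ma := measurable_affine a b.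
have a0' : 0 <= a by rewrite ltW.
pose nu : {measure set T1 -> \bar R} :=
  mscale (NngNum a0') (pushforward mu (affine a b : T1 -> T1)).
transitivity (nu ma A); first by rewrite /nu /mscale /=.
apply/esym/lebesgue_measure_unique => // _ [[u v]] _ <-.
change (mu `]u, v]%classic = (a%:E * mu (affine a b @^-1` `]u, v]%classic))%E).
rewrite affine_itvoc// !lebesgue_measure_itv /= !lte_fin.
rewrite ltr_pM2r ?invr_gt0// ltrD2r; case: ifPn => uv; last by rewrite mule0.
by rewrite -!EFinD -EFinM; congr EFin; field; rewrite gt_eqF.
Qed.

Lemma ge0_integral_affine a b (f : T1 -> \bar R) : 0 < a ->
  measurable_fun setT f -> (forall x, 0 <= f x)%E ->
  (a%:E * \int[mu]_x f (a * x + b)%R)%E = (\int[mu]_x f x)%E.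
Proof.
move=> a0 mf f0.
have ma := measurable_affine a b.
have a0' : 0 <= a by rewrite ltW.
pose nu : {measure set T1 -> \bar R} :=
  mscale (NngNum a0') (pushforward mu (affine a b : T1 -> T1)).
transitivity (\int[nu ma]_x f x)%E; last first.
  by apply: eq_measure_integral => A mA _; exact: lebesgue_measure_affine.
rewrite /nu ge0_integral_mscale//; congr (_ * _)%E.
by rewrite ge0_integral_pushforward// preimage_setT.
Qed.

Lemma ge0_integral_oppr (f : T1 -> \bar R) :
  measurable_fun setT f -> (forall x, 0 <= f x)%E ->
  (\int[mu]_x f (- x)%R)%E = (\int[mu]_x f x)%E.
Proof.
move=> mf f0.
have ma : measurable_fun setT (-%R : T1 -> T1) by exact: measurable_funN.
transitivity (\int[pushforward mu (-%R : T1 -> T1)]_x f x)%E; last first.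
  by apply: eq_measure_integral => A mA _; exact: lebesgue_measureN.
by rewrite ge0_integral_pushforward// preimage_setT.
Qed.

Lemma Rintegral_odd (f : R -> R) : measurable_fun setT (f : T1 -> T1) ->
  (forall x, f (- x) = - f x) -> \int[mu]_x f x = 0.
Proof.
move=> mf of_; rewrite /Rintegral integralE.
suff -> : (\int[mu]_x (fun x => (f x)%:E)^\- x = \int[mu]_x (fun x => (f x)%:E)^\+ x)%E.
  (* If both parts have infinite integral, their difference is infinite and [fine] sends it to 0. *)
  by case: (\int[mu]_x _)%E => [r| |] //=; rewrite ?subrr.
rewrite -ge0_integral_oppr//; last exact/measurable_funeneg/measurable_EFinP.
by apply: eq_integral => x _; rewrite funenegE funeposE of_ EFinN oppeK.
Qed.

End affine_change.

Section translation.
Context {R : realType}.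

Lemma ge0_integral_cons n (f : 'rV[R]_n.+1 -> \bar R) :
  measurable_fun setT f -> (forall x, 0 <= f x)%E ->
  (\int[lebesgue_rV R n.+1]_x f x =
   \int[lebesgue_measure]_x \int[lebesgue_rV R n]_v f (rV_cons (x, v)))%E.
Proof.
move=> mf f0.
have -> : (\int[lebesgue_rV R n.+1]_x f x =
    \int[lebesgue_measure \x lebesgue_rV R n]_x (f \o @rV_cons R n) x)%E.
  by apply: (ge0_integral_pushforward (@measurable_rV_cons R n)).
rewrite fubini_tonelli1//; last by move=> x; exact: f0.
by apply: (measurableT_comp mf); exact: measurable_rV_cons.
Qed.

Lemma measurable_translation n (t : 'rV[R]_n) :
  measurable_fun setT (fun v : 'rV[R]_n => v + t).
Proof.
apply: measurable_fun_rV => i; under eq_fun do rewrite mxE.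
by apply: measurable_funD; [exact: measurable_coord|exact: measurable_cst].
Qed.

(** Induction on the dimension: the tail is shifted by the induction hypothesis, the head by the
    affine substitution with slope 1. *)
Lemma ge0_integral_translation n (t : 'rV[R]_n) (f : 'rV[R]_n -> \bar R) :
  measurable_fun setT f -> (forall x, 0 <= f x)%E ->
  (\int[lebesgue_rV R n]_x f (x + t)%R = \int[lebesgue_rV R n]_x f x)%E.
Proof.
elim: n t f => [|n IH] t f mf f0.
  by apply: eq_integral => x _; congr f; apply/rowP => -[].
rewrite !ge0_integral_cons//; last first.
  by apply: (measurableT_comp mf); exact: measurable_translation.
pose t' : 'rV[R]_n := \row_i t ord0 (lift ord0 i).
have E x (v : 'rV[R]_n) : rV_cons (x, v) + t = rV_cons (x + t ord0 ord0, v + t').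
  apply/rowP => i; rewrite mxE; case: (unliftP ord0 i) => [j ->|->].
    by rewrite !rV_consS /= !mxE.
  by rewrite !rV_cons0.
have mfc : measurable_fun setT (f \o @rV_cons R n).
  by apply: (measurableT_comp mf); exact: measurable_rV_cons.
under eq_integral => x _.
  under eq_integral do rewrite E.
  rewrite (IH t' (fun v => f (rV_cons (x + t ord0 ord0, v)))); [over| |by []].
  exact: (measurableT_comp mfc (measurable_pair1 _)).
rewrite /=.
have := @ge0_integral_affine R 1 (t ord0 ord0)
  (fun x => \int[lebesgue_rV R n]_v f (rV_cons (x, v)))%E ltr01.
rewrite mul1e => <-; last 2 first.
- by apply: (measurable_fun_fubini_tonelli_F (f \o @rV_cons R n)) => // x; exact: f0.
- by move=> x; exact: integral_ge0.
by apply: eq_integral => x _; rewrite mul1r.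
Qed.

Lemma nsq_translation n (t : 'rV[R]_n) (f : 'rV[R]_n -> R[i]) : cmeas f ->
  nsq (lebesgue_rV R n) (fun x => f (x + t)) = nsq (lebesgue_rV R n) f.
Proof.
move=> mf; rewrite /nsq.
apply: (@ge0_integral_translation n t (fun x => (sq (f x))%:E)).
  exact: measurable_sqE.
by move=> x; rewrite lee_fin sq_ge0.
Qed.

End translation.

(** * Fourier transforms of indicators of intervals *)

Section trigonometric_bounds.
Context {R : realType}.
Implicit Types x t : R.

Lemma sin_le_id x : 0 <= x -> `|sin x| <= x.
Proof.
rewrite le_eqVlt => /predU1P[<-|x0]; first by rewrite sin0 normr0.
have [|c _] := @MVT R sin cos 0 x x0 (fun x _ => is_derive_sin x).
  by apply: continuous_subspaceT; exact: continuous_sin.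
rewrite sin0 !subr0 => ->; rewrite normrM (gtr0_norm x0).
exact: ler_piMl (ltW x0) (cos_max c).
Qed.

Lemma normr_sin_le x : `|sin x| <= `|x|.
Proof.
have [x0|x0] := leP 0 x; first by rewrite (ger0_norm x0) sin_le_id.
by rewrite (ltr0_norm x0) -[X in X <= _]normrN -sinN sin_le_id// oppr_ge0 ltW.
Qed.

Lemma oneBcosE x : 1 - cos x = 2 * sin (x / 2) ^+ 2.
Proof.
have -> : cos x = cos (x / 2 *+ 2) by congr cos; rewrite mulr2n; field.
by rewrite cos_mulr2n sin2cos2; ring.
Qed.

Lemma oneBcos_le x : 1 - cos x <= x ^+ 2 / 2.
Proof.
rewrite oneBcosE; have := normr_sin_le (x / 2).
move=> h; suff : sin (x / 2) ^+ 2 <= (x / 2) ^+ 2 by nra.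
rewrite -[leLHS]real_normK ?num_real// -[leRHS]real_normK ?num_real//.
by rewrite lerXn2r ?nnegrE.
Qed.

End trigonometric_bounds.

Section gram.
Context {R : realType}.
Local Notation mu := (@lebesgue_measure R).
Local Notation T1 := (measurableTypeR R).

(* The Gram integrals of the transforms of indicators of intervals are
   combinations of the integrals of [kfun p], which scale like |p|; the value of
   [kconst] (which is pi) is never needed. *)
Definition kfun (p x : R) : R := (1 - cos (p * x)) / x ^+ 2.

Lemma kfun_ge0 p x : 0 <= kfun p x.
Proof. by rewrite /kfun divr_ge0 ?sqr_ge0// subr_ge0 cos_le1. Qed.

Lemma kfunN p x : kfun (- p) x = kfun p x.
Proof. by rewrite /kfun mulNr cosN. Qed.

(** Two bounds for 1 - cos (p x) combine: p^2 x^2 / 2 controls the origin and 2 controls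
    infinity. *)
Lemma kfun_le p x : kfun p x <= (p ^+ 2 + 4) * (oneDsqr x)^-1.
Proof.
have D0 : 0 < oneDsqr x by rewrite (lt_le_trans _ (oneDsqr_ge1 x)).
(* At the origin the inverse of 0 is 0, so [kfun p 0] is 0. *)
have [->|x0] := eqVneq x 0.
  by rewrite /kfun expr0n invr0 mulr0 mulr_ge0 ?invr_ge0 ?(ltW D0)// addr_ge0 ?sqr_ge0.
have x2 : 0 < x ^+ 2 by rewrite exprn_even_gt0.
rewrite /kfun ler_pdivrMr// mulrAC ler_pdivlMr// /oneDsqr.
have := oneBcos_le (p * x); rewrite exprMn.
have := cos_geN1 (p * x).
move: (cos (p * x)) => c c1 c2.
have : (1 - c) * x ^+ 2 <= 2 * x ^+ 2 by rewrite ler_pM2r//; lra.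
have : 0 <= p ^+ 2 * x ^+ 2 by rewrite mulr_ge0 ?sqr_ge0.
nra.
Qed.

Lemma measurable_cosM (p : R) : measurable_fun setT (fun x : T1 => cos (p * x) : T1).
Proof.
apply: (measurableT_comp (continuous_measurable_fun (@continuous_cos R))).
exact: measurable_funM.
Qed.

Lemma measurable_sinM (p : R) : measurable_fun setT (fun x : T1 => sin (p * x) : T1).
Proof.
apply: (measurableT_comp (continuous_measurable_fun (@continuous_sin R))).
exact: measurable_funM.
Qed.

Lemma measurable_invr : measurable_fun setT (fun x : T1 => x^-1 : T1).
Proof.
have m0 : measurable ([set 0] : set T1) by exact: measurable_set1.
rewrite -(setUv ([set 0] : set T1)); apply/measurable_funU => //.
  exact: measurableC.
split; first exact: measurable_fun_set1.
apply: open_continuous_measurable_fun.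
  by apply: closed_openC; exact: (accessible_closed_set1 (hausdorff_accessible (@Rhausdorff R))).
by move=> x; rewrite inE => /eqP x0; exact: inv_continuous.
Qed.

Lemma measurable_kfun p : measurable_fun setT (kfun p : T1 -> T1).
Proof.
apply: measurable_funM.
  by apply: measurable_funB => //; exact: measurable_cosM.
by apply: (measurableT_comp measurable_invr); exact: measurable_funX.
Qed.

Lemma integrable_oneDsqrV : mu.-integrable setT (EFin \o (fun x => (oneDsqr x)^-1)).
Proof.
apply/integrableP; split.
  have m1 : measurable_fun setT (fun x : T1 => (oneDsqr x)^-1 : T1).
    by apply: continuous_measurable_fun; exact: (@continuous_oneDsqrV R).
  exact/measurable_EFinP.
under eq_integral => x _.
  rewrite /= ger0_norm; last by rewrite invr_ge0 (le_trans ler01)// oneDsqr_ge1.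
  over.
rewrite ge0_symfun_integralT//.
- rewrite -set_itvcy integral0y_oneDsqr.
  by rewrite -EFinM ltry.
- exact: (@continuous_oneDsqrV R).
- by move=> x; rewrite /= /oneDsqr sqrrN.
Qed.

Lemma integrable_kfun p : mu.-integrable setT (EFin \o kfun p).
Proof.
apply: (le_integrable measurableT _ _
  (@integrableRZl _ _ _ mu (p ^+ 2 + 4) _ integrable_oneDsqrV)).
  by apply/measurable_EFinP; exact: measurable_kfun.
move=> x _ /=; rewrite lee_fin !ger0_norm ?kfun_ge0 ?kfun_le//.
exact: le_trans (kfun_ge0 p x) (kfun_le p x).
Qed.

Definition kconst : R := \int[mu]_x kfun 1 x.

(** [kfun] is even in p, and for p > 0 the substitution of p x for x applies, since kfun 1 (p x) =
    p^-2 kfun p x. *)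
Lemma Rintegral_kfun p : \int[mu]_x kfun p x = `|p| * kconst.
Proof.
wlog p0 : p / 0 < p => [H|].
  have [p0|p0|->] := ltgtP p 0; [|exact: H|].
    rewrite -(opprK p) normrN -H ?oppr_gt0//.
    by apply: eq_Rintegral => x _; rewrite opprK kfunN.
  rewrite normr0 mul0r -[RHS](@Rintegral_set0 _ _ _ mu (kfun 0)) /Rintegral integral_set0.
  by rewrite integral0_eq// => x _; rewrite /kfun mul0r cos0 subrr mul0r.
have k0 x : (0 <= (kfun 1 x)%:E)%E by rewrite lee_fin kfun_ge0.
have mk : measurable_fun setT (fun x : T1 => (kfun 1 x)%:E).
  by apply/measurable_EFinP; exact: measurable_kfun.
have := ge0_integral_affine 0 p0 mk k0.
have -> : (\int[mu]_x (kfun 1 (p * x + 0))%:E = (p ^- 2)%:E * \int[mu]_x (kfun p x)%:E)%E.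
  rewrite -ge0_integralZl//.
  - apply: eq_integral => x _; rewrite addr0 /kfun mul1r -EFinM; congr EFin.
    by rewrite exprMn invfM; ring.
  - by apply/measurable_EFinP; exact: measurable_kfun.
  - by move=> x _; rewrite lee_fin kfun_ge0.
  - by rewrite lee_fin invr_ge0 sqr_ge0.
rewrite /kconst /Rintegral gtr0_norm//.
have /fineK <- : (\int[mu]_x (kfun p x)%:E)%E \is a fin_num.
  exact: integrable_fin_num (integrable_kfun p).
have /fineK <- : (\int[mu]_x (kfun 1 x)%:E)%E \is a fin_num.
  exact: integrable_fin_num (integrable_kfun 1).
move=> [] /= <-; field; rewrite gt_eqF//.
Qed.

Lemma kconst_gt0 : 0 < kconst.
Proof.
(* On [1, 2] the cosine is at most cos 1, as 2 <= pi, and x^2 <= 4; hence [kfun 1] is at least e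
   there. *)
pose e : R := (1 - cos 1) / 4.
have e0 : 0 < e.
  rewrite divr_gt0// subr_gt0 -[ltRHS]cos0 ltr_cos ?in_itv/= ?lexx ?pi_ge0//.
  by rewrite ler01 (le_trans _ (@pi_ge2 R))// ler1n.
have mI : measurable (`[1, 2]%classic : set T1) by exact: measurable_itv.
have iI : mu.-integrable setT (EFin \o (fun x => e * \1_(`[1, 2]%classic : set T1) x)).
  by apply: integrableRZl; exact: integrable_indic_itv.
apply: (@lt_le_trans _ _ (\int[mu]_x (e * \1_(`[1, 2]%classic : set T1) x))).
  rewrite RintegralZl//; last exact: integrable_indic_itv.
  rewrite mulr_gt0// /Rintegral integral_indic// setIT.
  rewrite [X in fine X](_ : _ = 1%:E) ?ltr01//; transitivity (mu (`[1, 2]%classic : set T1)) => //.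
    by rewrite lebesgue_measure_itv /= lte_fin ltr1n -EFinB; congr EFin; lra.
apply: le_Rintegral => //; first exact: integrable_kfun.
move=> x _; rewrite indicE; have [|_] := boolP (x \in _); last first.
  by rewrite mulr0 kfun_ge0.
rewrite inE /= in_itv /= mulr1 => /andP[x1 x2].
have c1 : cos x <= cos 1.
  have [->//|x11] := eqVneq x 1.
  rewrite ltW// ltr_cos ?in_itv/=.
  - by rewrite lt_neqAle eq_sym x11.
  - by rewrite ler01 (le_trans _ (@pi_ge2 R))// ler1n.
  - by rewrite (le_trans ler01)//= (le_trans x2)// pi_ge2.
have x0 : 0 < x ^+ 2 by rewrite exprn_gt0// (lt_le_trans ltr01).
rewrite /kfun mul1r ler_pdivlMr// /e.
have : cos 1 <= 1 :> R by exact: cos_le1.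
have : x ^+ 2 <= 4 by rewrite expr2; nra.
nra.
Qed.

(** The closed form [ehat] of a transform is valid only off the origin; this removes the exceptional
    point from the Gram integrals. *)
Lemma cint_off0 (f g : T1 -> R[i]) : (forall x, x != 0 -> f x = g x) ->
  cintegrable mu g -> cintegrable mu f /\ cint mu f = cint mu g.
Proof.
move=> fg ig; pose c := f 0 - g 0.
have m0 : measurable ([set 0] : set T1) by exact: measurable_set1.
have i0 : mu.-integrable setT (EFin \o (\1_([set 0] : set T1) : T1 -> R)).
  by rewrite -(set_itv1 (0 : R)); exact: integrable_indic_itv.
have ih : cintegrable mu (fun x => (\1_([set 0] : set T1) x : R)%:C).
  by split => //=; exact: (integrable0 mu).
have ch : cint mu (fun x => (\1_([set 0] : set T1) x : R)%:C) = 0.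
  apply: complex_ext => /=; rewrite /Rintegral; last by rewrite integral0.
  by rewrite integral_indic// setIT [X in fine X](lebesgue_measure_set1 (0 : R)).
have -> : f = fun x => g x + c * (\1_([set 0] : set T1) x : R)%:C.
  apply/funext => x; rewrite indicE; have [->|x0] := eqVneq x 0.
    by rewrite mem_set// mulr1 /c addrC subrK.
  by rewrite memNset ?mulr0 ?addr0 ?fg//=; exact/eqP.
split; first by apply: cintegrableD => //; exact: cintegrableZ.
by rewrite cintD ?cintZ ?ch ?mulr0 ?addr0//; exact: cintegrableZ.
Qed.

Definition cker (t : R) : R[i] := cos t -i* sin t.

Definition fourier1 (f : T1 -> R[i]) (xi : R) : R[i] :=
  cint mu (fun x => cker (x * xi) * f x).

Definition cindic (a b : R) : T1 -> R[i] :=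
  fun x => (\1_(`]a, b]%classic : set T1) x : R)%:C.

(** This is (e^(-i a xi) - e^(-i b xi)) / (i xi), the transform of the indicator of ]a, b] for xi
    different from 0. At xi = 0 the convention for division makes it 0 and not b - a. *)
Definition ehat (a b xi : R) : R[i] :=
  ((sin (b * xi) - sin (a * xi)) / xi) -i* ((cos (a * xi) - cos (b * xi)) / xi).

Lemma Rintegral_itvoc (F f : R -> R) (a b : R) : a < b -> continuous f ->
  (forall x : R, is_derive x (1 : R) F (f x)) ->
  \int[mu]_x (f x * \1_(`]a, b]%classic : set T1) x) = F b - F a.
Proof.
move=> ab cf dF.
have -> : \int[mu]_x (f x * \1_(`]a, b]%classic : set T1) x) = \int[mu]_(x in `]a, b]) f x.
  rewrite [RHS]Rintegral_mkcond; apply: eq_Rintegral => x _.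
  by rewrite patchE indicE; case: ifP => _; rewrite ?mulr1 ?mulr0.
have ccf : mu.-integrable `[a, b] (EFin \o f).
  apply: continuous_compact_integrable; first exact: segment_compact.
  exact: continuous_subspaceT.
rewrite Rintegral_itv_obnd_cbnd//; last first.
  apply: (integrableS _ _ _ ccf) => //.
  by apply: subset_itvr; rewrite bnd_simp.
have cF : continuous F.
  by move=> x; apply: differentiable_continuous; apply/derivable1_diffP; exact: ex_derive.
rewrite /Rintegral (@continuous_FTC2 _ f F a b)//.
- exact: continuous_subspaceT.
- split.
  + by move=> x _; exact: ex_derive.
  + by apply: cvg_at_right_filter; exact: cF.
  + by apply: cvg_at_left_filter; exact: cF.
- by move=> x _; rewrite derive1E; exact: derive_val.
Qed.

Lemma is_derive_mulr (xi x : R) : is_derive x (1 : R) (fun y : R => y * xi) xi.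
Proof.
have h := @is_deriveM R R^o id (cst xi) x 1 1 0 (is_derive_id _ _) (is_derive_cst _ _ _).
by apply: (is_derive_eq h); rewrite /GRing.scale /= mulr0 add0r mulr1.
Qed.

Lemma is_derive_sinM (xi x : R) :
  is_derive x (1 : R) (fun y : R => sin (y * xi)) (cos (x * xi) * xi).
Proof. exact: (is_derive1_comp (is_derive_sin _) (is_derive_mulr xi x)). Qed.

Lemma is_derive_cosM (xi x : R) :
  is_derive x (1 : R) (fun y : R => cos (y * xi)) (- sin (x * xi) * xi).
Proof. exact: (is_derive1_comp (is_derive_cos _) (is_derive_mulr xi x)). Qed.

Lemma continuous_sinM (xi : R) : continuous (fun y : R => sin (y * xi)).
Proof.
move=> x; apply: differentiable_continuous; apply/derivable1_diffP.
exact: (@ex_derive _ _ _ _ _ _ _ (is_derive_sinM xi x)).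
Qed.

Lemma continuous_cosM (xi : R) : continuous (fun y : R => cos (y * xi)).
Proof.
move=> x; apply: differentiable_continuous; apply/derivable1_diffP.
exact: (@ex_derive _ _ _ _ _ _ _ (is_derive_cosM xi x)).
Qed.

Lemma fourier1_cindic a b xi : a < b -> xi != 0 ->
  fourier1 (cindic a b) xi = ehat a b xi.
Proof.
move=> ab xi0; apply: complex_ext => /=.
  under eq_Rintegral do rewrite mulr0 subr0.
  have dF (x : R) : is_derive x (1 : R) (fun x => xi^-1 * sin (x * xi)) (cos (x * xi)).
    have h := @is_deriveZ R R R^o _ xi^-1 x 1 _ (is_derive_sinM xi x).
    by apply: (is_derive_eq h); rewrite /GRing.scale /=; field.
  by rewrite (Rintegral_itvoc ab (@continuous_cosM xi) dF); field.
under eq_Rintegral do rewrite mulr0 add0r.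
have dF (x : R) : is_derive x (1 : R) (fun x => xi^-1 * cos (x * xi)) (- sin (x * xi)).
  have h := @is_deriveZ R R R^o _ xi^-1 x 1 _ (is_derive_cosM xi x).
  by apply: (is_derive_eq h); rewrite /GRing.scale /=; field.
have cF : continuous (fun x : R => - sin (x * xi)).
  by move=> x; apply: continuousN; exact: continuous_sinM.
by rewrite (Rintegral_itvoc ab cF dF); field.
Qed.

Lemma ehat_sqE a b xi : sq (ehat a b xi) = 2 * kfun (b - a) xi.
Proof.
rewrite sqE /= /kfun (mulrBl xi b a) cosB sqrrN !exprMn exprVn.
have := cos2Dsin2 (a * xi); have := cos2Dsin2 (b * xi).
set x := xi ^+ 2; move=> h1 h2.
rewrite -mulrDl mulrA; congr (_ / _); nra.
Qed.

(** The numerator is a combination of four cosines whose coefficients sum to 0, so 1 can be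
    subtracted from each of them; this makes every term integrable by itself. *)
Lemma Re_ehatM a b c d xi : Re (ehat a b xi * (ehat c d xi)^*) =
  kfun (b - c) xi + kfun (a - d) xi - kfun (b - d) xi - kfun (a - c) xi.
Proof.
rewrite /= /kfun (mulrBl xi b c) (mulrBl xi a d) (mulrBl xi b d) (mulrBl xi a c) !cosB.
rewrite -!exprVn; ring.
Qed.

Lemma Im_ehatM_odd a b c d xi : Im (ehat a b (- xi) * (ehat c d (- xi))^*) =
  - Im (ehat a b xi * (ehat c d xi)^*).
Proof. by rewrite /= !mulrN !sinN !cosN invrN; ring. Qed.

Lemma normr_Im_ehatM a b c d xi : `|Im (ehat a b xi * (ehat c d xi)^*)| <=
  2 * kfun (b - a) xi + 2 * kfun (d - c) xi.
Proof.
rewrite -!ehat_sqE; set z := ehat a b xi; set w := ehat c d xi.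
have -> : Im (z * w^*) = - rdot (z * 'i) w.
  by rewrite /rdot; case: z w => [? ?] [? ?] /=; ring.
rewrite normrN; apply: le_trans (normr_rdot_le _ _) _; rewrite sqM (_ : sq 'i = 1) ?mulr1//.
by rewrite sqE /= expr0n expr1n add0r.
Qed.

Lemma measurable_ehat a b : cmeas (ehat a b : T1 -> R[i]).
Proof.
split => /=.
  apply: measurable_funM; last exact: measurable_invr.
  by apply: measurable_funB; exact: measurable_sinM.
apply: measurable_funN; apply: measurable_funM; last exact: measurable_invr.
by apply: measurable_funB; exact: measurable_cosM.
Qed.

Lemma cmeasJ d (T : measurableType d) (f : T -> R[i]) : cmeas f ->
  cmeas (fun x => (f x)^*).
Proof.
move=> [f1 f2]; split.
  by rewrite (_ : (fun x => _) = fun x => Re (f x))//; apply/funext => x; case: (f x).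
rewrite (_ : (fun x => _) = fun x => - Im (f x)); first exact: measurable_funN.
by apply/funext => x; case: (f x).
Qed.

(** The real part reduces to integrals of [kfun]; the imaginary part is integrable by domination and
    contributes 0 because it is odd. *)
Lemma cint_ehat a b c d :
  cintegrable mu (fun xi => ehat a b xi * (ehat c d xi)^*) /\
  cint mu (fun xi => ehat a b xi * (ehat c d xi)^*) =
    (kconst * (`|b - c| + `|a - d| - `|b - d| - `|a - c|))%:C.
Proof.
have mG : cmeas (fun xi : T1 => ehat a b xi * (ehat c d xi)^*).
  by apply: cmeasM; [|apply: cmeasJ]; exact: measurable_ehat.
have i1 : mu.-integrable setT (EFin \o (fun x => kfun (b - c) x + kfun (a - d) x)).
  by apply: integrableRD; exact: integrable_kfun.
have i2 : mu.-integrable setT (EFin \o (fun x => kfun (b - c) x + kfun (a - d) x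
   - kfun (b - d) x)).
  by apply: integrableRB => //; exact: integrable_kfun.
have i3 := integrableRB i2 (integrable_kfun (a - c)).
split.
  split; first by under [X in EFin \o X]eq_fun do rewrite Re_ehatM.
  apply: (le_integrable measurableT _ _ (integrableRD (integrableRZl 2 (integrable_kfun (b - a)))
    (integrableRZl 2 (integrable_kfun (d - c))))).
    by apply/measurable_EFinP; case: mG.
  move=> x _; rewrite lee_fin; apply: le_trans (normr_Im_ehatM _ _ _ _ _) _.
  exact: ler_norm.
apply: complex_ext.
  rewrite /cint; under eq_Rintegral do rewrite Re_ehatM.
  rewrite /=.
  rewrite RintegralB ?RintegralB ?RintegralD ?Rintegral_kfun//; try exact: integrable_kfun.
  by ring.
by apply: Rintegral_odd; [case: mG|move=> x; rewrite Im_ehatM_odd].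
Qed.

(* The left-hand side is what the Gram integral in [cint_ehat] produces. *)
Lemma overlapE (a b c d : R) : a < b -> c < d ->
  `|b - c| + `|a - d| - `|b - d| - `|a - c| =
  2 * fine (mu (`]a, b]%classic `&` `]c, d]%classic)).
Proof.
move=> ab cd.
have -> : `]a, b]%classic `&` `]c, d]%classic = `]Num.max a c, Num.min b d]%classic.
  apply/seteqP; split => x /=; rewrite !in_itv/= gt_max le_min.
    by move=> [/andP[-> ->] /andP[-> ->]].
  by move=> /andP[/andP[-> ->] /andP[-> ->]].
rewrite lebesgue_measure_itv /= lte_fin.
case: (leP a c) => ac; case: (leP b d) => bd; case: ltP => h;
  rewrite -?EFinB /=; case: (ger0P (b - c)) => ?; case: (ger0P (a - d)) => ?;
  case: (ger0P (b - d)) => ?; case: (ger0P (a - c)) => ?; lra.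
Qed.

End gram.

(** * Density of step functions *)

Section boxes.
Context {R : realType} (n : nat).
Local Notation V := 'rV[R]_n.
Local Notation mu := (lebesgue_rV R n).
Local Notation T1 := (measurableTypeR R).

Definition box (a b : 'I_n -> R) : set V :=
  [set v | forall i, v ord0 i \in `]a i, b i]].

Definition boxes : set (set V) := [set B | exists a b, B = box a b].

Definition cube (k : nat) : set V := box (fun=> - k%:R) (fun=> k%:R).

Lemma box_setI (a b c d : 'I_n -> R) : box a b `&` box c d =
  box (fun i => Num.max (a i) (c i)) (fun i => Num.min (b i) (d i)).
Proof.
apply/seteqP; split => v /=.
  move=> [vab vcd] i; have := vab i; have := vcd i; rewrite !in_itv/=.
  by rewrite gt_max le_min => /andP[-> ->] /andP[-> ->].
move=> h; split => i; have := h i; rewrite !in_itv/= gt_max le_min.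
  by move=> /andP[/andP[-> _] /andP[-> _]].
by move=> /andP[/andP[_ ->] /andP[_ ->]].
Qed.

Lemma measurable_box a b : measurable (box a b).
Proof.
rewrite (_ : box a b = \bigcap_(i in [set: 'I_n])
    ((fun v : V => v ord0 i) @^-1` `]a i, b i])); last first.
  by apply/seteqP; split => [v vA i _|v vA i]; [exact: vA|exact: (vA i)].
apply: fin_bigcap_measurable => // i _.
by rewrite -[X in measurable X]setTI; apply: measurable_coord => //; exact: measurable_itv.
Qed.

Lemma box_finite a b : (mu (box a b) < +oo)%E.
Proof.
have -> : box a b = [set v : V | forall i, (`]a i, b i]%classic : set T1) (v ord0 i)] by [].
rewrite (@lebesgue_rV_box R n (fun i => `]a i, b i]%classic)); last first.
  by move=> i; exact: measurable_itv.
rewrite -ge0_fin_numE; last first.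
  by apply: prode_ge0 => i _; exact: measure_ge0.
apply: prode_fin_num => i _; rewrite ge0_fin_numE//.
by rewrite lebesgue_measure_itv/=; case: ifP => _; rewrite ?ltry.
Qed.

Lemma subset_cube k l : (k <= l)%N -> cube k `<=` cube l.
Proof.
move=> kl v vk i; have := vk i; rewrite !in_itv/= => /andP[h1 h2].
have kl' : k%:R <= l%:R :> R by rewrite ler_nat.
by rewrite (le_lt_trans _ h1) ?lerN2// (le_trans h2).
Qed.

Lemma in_cube (v : V) : exists k, cube k v.
Proof.
exists (Num.truncn (\sum_i `|v ord0 i|)).+2 => i; rewrite in_itv/=.
have h : `|v ord0 i| < (Num.truncn (\sum_i `|v ord0 i|)).+1%:R.
  apply: le_lt_trans (truncnS_gt _).
  by rewrite (bigD1 i)//= lerDl sumr_ge0.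
have h2 : (Num.truncn (\sum_i `|v ord0 i|)).+1%:R < (Num.truncn (\sum_i `|v ord0 i|)).+2%:R :> R.
  by rewrite ltr_nat.
by have := lt_trans h h2; rewrite ltr_norml => /andP[-> /ltW ->].
Qed.

Lemma cube_eventually (v : V) : \forall k \near \oo, cube k v.
Proof.
have [k kv] := in_cube v; exists k => // l /= kl.
exact: (subset_cube kl).
Qed.

Lemma measurable_boxes : @measurable _ V = <<s boxes >>.
Proof.
apply/seteqP; split; last first.
  apply: smallest_sub.
    split; first exact: measurable0.
    - by move=> A mA; rewrite setTD; exact: measurableC.
    - by move=> F mF; exact: bigcup_measurable.
  by move=> _ [a [b ->]]; exact: measurable_box.
apply: smallest_sub; first exact: smallest_sigma_algebra.
rewrite -bigcup_seq => A [i _] [B mB <-] /=; rewrite setTI.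
move: B mB; apply: smallest_sub.
  split.
  - by rewrite /= preimage_set0; exact: sigma_algebra0.
  - by move=> A' mA /=; rewrite setTD preimage_setC; exact: sigma_algebraC.
  - by move=> F mF /=; rewrite preimage_bigcup; exact: sigma_algebra_bigcup.
move=> _ [[u v] _ <-] /=.
(* A condition on one coordinate is exhausted by boxes whose other sides grow to the whole line. *)
pose lo k := fun j : 'I_n => if j == i then u else - k%:R.
pose hi k := fun j : 'I_n => if j == i then v else k%:R.
rewrite (_ : _ @^-1` _ = \bigcup_k box (lo k) (hi k)).
  apply: sigma_algebra_bigcup => k; apply: sub_sigma_algebra.
  by exists (lo k), (hi k).
apply/seteqP; split => w /=.
  move=> wi; have [k wk] := in_cube w; exists k => // j.
  by rewrite /lo /hi; have [->|_] := eqVneq j i; [exact: wi|exact: wk].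
by move=> [k _ /(_ i)]; rewrite /lo /hi eqxx.
Qed.

Lemma boxes_setI : setI_closed boxes.
Proof. by move=> _ _ [a [b ->]] [c [d ->]]; rewrite box_setI; eexists; eexists. Qed.

Lemma nsq_real (g : V -> R) :
  nsq mu (fun x => (g x)%:C) = (\int[mu]_x (g x ^+ 2)%:E)%E.
Proof. by apply: eq_integral => x _; rewrite sq_real. Qed.

Lemma sqint_box a b : sqint mu (fun x => (\1_(box a b) x : R)%:C).
Proof.
split.
  by apply: cmeas_real; apply: measurable_indic; exact: measurable_box.
rewrite nsq_real; under eq_integral.
  move=> x _; rewrite (_ : _ ^+ 2 = \1_(box a b) x); first over.
  by rewrite indicE; case: (_ \in _); rewrite ?expr1n ?expr0n.
by rewrite integral_indic ?setIT ?box_finite//; exact: measurable_box.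
Qed.

End boxes.

Import HBNNSimple.

(** * A monotone class principle for square-integrable functions *)

Section density.
Context {R : realType} (n : nat).
Local Notation V := 'rV[R]_n.
Local Notation mu := (lebesgue_rV R n).
Variable P : (V -> R) -> Prop.
Hypothesis PD : forall f g, P f -> P g -> P (fun x => f x + g x).
Hypothesis PZ : forall a f, P f -> P (fun x => a * f x).
(** The majorant is required in L^2, so that closures in L^2 have this property by dominated
    convergence. *)
Hypothesis Plim : forall (f_ : nat -> V -> R) (f g : V -> R),
  (forall k, P (f_ k)) -> (forall k, measurable_fun setT (f_ k)) ->
  measurable_fun setT f -> sqint mu (fun x => (g x)%:C) ->
  (forall k x, `|f_ k x| <= g x) ->
  (forall x, f_ ^~ x @ \oo --> f x) -> P f.
Hypothesis Pbox : forall a b, P (\1_(box a b)).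

Let eqP_ f g : P f -> f =1 g -> P g.
Proof. by move=> Pf /funext <-. Qed.

Let P0 : P (fun=> 0).
Proof.
apply: (eqP_ (PZ 0 (Pbox (fun=> 0) (fun=> 0)))) => x.
by rewrite mul0r.
Qed.

(** Dynkin's pi-lambda theorem for the boxes. Intersecting with a cube keeps all indicators below
    one square-integrable function, as the limit over increasing unions requires. *)
Let Pindic k (A : set V) : measurable A -> P (\1_(A `&` cube k)).
Proof.
rewrite measurable_boxes; move: A.
apply: (@dynkin_induction _ _ (@boxes R n) [set A | P (\1_(A `&` cube k))]).
- exact: measurable_boxes.
- exact: boxes_setI.
- by rewrite /= setTI; exact: Pbox.
- by move=> _ [a [b ->]] /=; rewrite box_setI; exact: Pbox.
- move=> S mS PS /=.
  apply: (eqP_ (PD (Pbox (fun=> - k%:R) (fun=> k%:R)) (PZ (-1) PS))) => x.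
  rewrite !indicE !in_setI in_setC -/(cube k).
  by case: (x \in S); case: (x \in cube k); rewrite /= ?mulr1 ?mulr0 ?addr0 ?subrr.
- move=> F mF tF PF /=.
  pose S (l : nat) : set V := (\bigcup_(i in [set i | (i < l)%N]) F i) `&` cube k.
  have mS l : measurable (S l).
    by apply: measurableI; [apply: bigcup_measurable => i _|exact: measurable_box].
  have PS l : P (\1_(S l)).
    elim: l => [|l IH].
      apply: (eqP_ P0) => x; rewrite indicE memNset// => -[] [j].
      by rewrite /= ltn0.
    (* By disjointness the indicator of the next partial union is a sum of two indicators. *)
    apply: (eqP_ (PD IH (PF l))) => x; rewrite !indicE.
    have [xQ|xQ] := pselect (cube k x); last first.
      by rewrite !memNset ?addr0// => -[].
    have [xF|xF] := pselect (F l x).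
      rewrite [x \in F l `&` _]mem_set// [x \in S l.+1]mem_set; last first.
        by split => //; exists l => //=.
      rewrite memNset ?add0r// => -[[i /= il Fi] _].
      have /trivIsetP /(_ i l I I) := tF.
      rewrite (ltn_eqF il) => /(_ isT) /seteqP[+ _] => /(_ x) h.
      exact: h.
    rewrite [x \in F l `&` _]memNset ?addr0; last by case.
    congr (nat_of_bool _)%:R; apply/idP/idP; rewrite !inE => -[[i /= il Fi] _].
      by split => //; exists i => //=; rewrite (ltn_trans il).
    split => //; exists i => //=; rewrite ltn_neqAle -ltnS il andbT.
    by apply/eqP => ie; apply: xF; rewrite -ie.
  apply: (Plim PS (g := \1_(cube k))).
  + by move=> l; exact: measurable_indic.
  + apply: measurable_indic; apply: measurableI; last exact: measurable_box.
    exact: bigcup_measurable.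
  + exact: sqint_box.
  + move=> l x; rewrite !indicE /S in_setI.
    by case: (x \in cube k); case: (x \in bigcup _ _); rewrite /= ?normr1 ?normr0.
  + move=> x; have [[[i _ Fi] Qx]|xN] := pselect ((\bigcup_i F i `&` cube k) x).
      apply: cvg_near_cst; exists i.+1 => // l /= il.
      rewrite !indicE !mem_set//; first by split => //; exists i.
      by split => //; exists i.
    apply: cvg_near_cst; apply: nearW => l.
    rewrite !indicE !memNset// => -[[i _ Fi] Qx]; apply: xN; split => //.
    by exists i.
Qed.

Let Psum (I : Type) (s : seq I) (f : I -> V -> R) :
  (forall i, P (f i)) -> P (fun x => \sum_(i <- s) f i x).
Proof.
move=> Pf; elim: s => [|i s IH].
  by apply: (eqP_ P0) => x; rewrite big_nil.
by apply: (eqP_ (PD (Pf i) IH)) => x; rewrite big_cons.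
Qed.

Let Pnnsfun k (h : {nnsfun V >-> R}) : P (fun x => h x * \1_(cube k) x).
Proof.
have H := @Psum R (finmap.enum_fset (fset_set (range h)))
  (fun y x => y * \1_(h @^-1` [set y] `&` cube k) x).
apply: (eqP_ (H _)).
  by move=> y; apply: PZ; apply: Pindic; rewrite -[X in measurable X]setTI;
    exact: (measurable_funP h).
move=> x; rewrite [h x]fimfunE fsbig_finite//= big_distrl /=.
by apply: eq_bigr => y _; rewrite indicI /= mulrA.
Qed.

(** Simple functions increasing to f, cut off to growing cubes, converge pointwise, and f itself is
    the majorant. *)
Let Pge0 (f : V -> R) : measurable_fun setT f -> (forall x, 0 <= f x) ->
  sqint mu (fun x => (f x)%:C) -> P f.
Proof.
move=> mf f0 f2.
have mF : measurable_fun setT (EFin \o f) by exact/measurable_EFinP.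
pose h k := nnsfun_approx measurableT mF k.
have Ph k := @Pnnsfun k (h k).
apply: (@Plim (fun k x => h k x * \1_(cube k) x) f f) => //.
- move=> k; apply: measurable_funM => //.
  by apply: measurable_indic; exact: measurable_box.
- move=> k x; have hf : h k x <= f x.
    rewrite /h nnsfun_approxE -lee_fin.
    by apply: (le_approx (f := EFin \o f)) => //= t _; rewrite lee_fin.
  rewrite indicE; case: (_ \in _); rewrite ?mulr1 ?mulr0 ?normr0//.
  by rewrite ger0_norm.
- move=> x.
  have : (fun k => (h k x)) @ \oo --> f x.
    have F0 (t : V) : [set: V] t -> (0 <= (EFin \o f) t)%E by rewrite /= lee_fin.
    exact: (fine_cvg (@cvg_nnsfun_approx _ _ _ _ measurableT _ mF F0 x I)).
  move=> hx; apply: cvg_trans hx; apply: near_eq_cvg.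
  have := cube_eventually x; apply: filterS => k kx.
  by rewrite indicE mem_set// mulr1.
Qed.

Lemma density (f : V -> R) : sqint mu (fun x => (f x)%:C) -> P f.
Proof.
move=> f2; have mf : measurable_fun setT f by case: f2 => -[].
have H (g : V -> R) : measurable_fun setT g -> (forall x, `|g x| <= `|f x|) ->
    sqint mu (fun x => (g x)%:C).
  move=> mg gf; apply: (@sqint_le _ _ _ mu 1 _ (fun x => (f x)%:C)) => //.
  move=> x; rewrite mul1r !sq_real -[leLHS]real_normK ?num_real//.
  by rewrite -[leRHS]real_normK ?num_real// lerXn2r ?nnegrE.
have m1 : measurable_fun setT (fun x => Num.max (f x) 0).
  exact: measurable_maxr.
have m2 : measurable_fun setT (fun x => Num.max (- f x) 0).
  by apply: measurable_maxr => //; exact: measurable_funN.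
apply: (eqP_ (PD (@Pge0 (fun x => Num.max (f x) 0) _ _ _)
  (PZ (-1) (@Pge0 (fun x => Num.max (- f x) 0) _ _ _)))) => //.
- by move=> x; rewrite le_max lexx orbT.
- apply: H => // x; case: (leP (f x) 0) => [_|/ltW fx]; rewrite ?normr0//.
- by move=> x; rewrite le_max lexx orbT.
- apply: H => // x; case: (leP (- f x) 0) => [_|fx]; rewrite ?normr0// normrN//.
- move=> x; rewrite mulN1r; case: (leP (f x) 0) => fx; case: (leP (- f x) 0) => fx2; lra.
Qed.

End density.

Section square_approximation.
Context {R : realType} (n : nat).
Local Notation V := 'rV[R]_n.
Local Notation mu := (lebesgue_rV R n).

Lemma nsq_dominated (f_ : nat -> V -> R[i]) (f : V -> R[i]) (g : V -> R[i]) :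
  (forall k, cmeas (f_ k)) -> cmeas f -> sqint mu g ->
  (forall k x, sq (f_ k x) <= sq (g x)) ->
  (forall x, (fun k => sq (f_ k x - f x)) @ \oo --> (0 : R)) ->
  (fun k => nsq mu (fun x => f_ k x - f x)) @ \oo --> 0%E.
Proof.
move=> mf_ mf g2 fg fc.
(* The majorant for f follows in the limit, with the factor 2 of [sqB_le]. *)
have sqf x : sq (f x) <= 2 * sq (g x).
  have h k : sq (f x) <= 2 * sq (f_ k x - f x) + 2 * sq (g x).
    have := sqB_le (f_ k x - f x) (f_ k x).
    rewrite (_ : _ - _ = - f x) ?sqN; last by ring.
    by have := fg k x; lra.
  have : 2 * sq (f_ k x - f x) + 2 * sq (g x) @[k --> \oo] --> 2 * 0 + 2 * sq (g x).
    by apply: cvgD; [apply: cvgMr; exact: fc|exact: cvg_cst].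
  rewrite mulr0 add0r => hc.
  by apply: (ler_cvg_to (cvg_cst (sq (f x))) hc); exact: nearW.
(* 6 = 2 + 2 * 2: [sqB_le] applied to [f_ k x] and [f x], with the bound just proved for the
   latter. *)
have ig : mu.-integrable setT (EFin \o (fun x => 6 * sq (g x))).
  by apply: integrableRZl; exact: integrable_rdot.
have [] := @dominated_convergence _ _ _ mu setT measurableT
  (fun k x => (sq (f_ k x - f x))%:E) (fun=> 0%E) (EFin \o (fun x => 6 * sq (g x))) _ _ _ ig _.
- by move=> k; apply: measurable_sqE; exact: cmeasB.
- exact: measurable_cst.
- by apply: aeW => x _; apply: cvg_EFin; [exact: nearW|exact: fc].
- apply: aeW => x k _; rewrite lee_fin ger0_norm ?sq_ge0//.
  by have := sqB_le (f_ k x) (f x); have := fg k x; have := sqf x; lra.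
by move=> _ _; rewrite integral0.
Qed.

End square_approximation.

(** * The Plancherel theorem *)

Section fourier_transform.
Context {R : realType} (n : nat).
Local Notation V := 'rV[R]_n.
Local Notation mu := (lebesgue_rV R n).
Local Notation T1 := (measurableTypeR R).
Implicit Types f g : V -> R[i].

Lemma ckerD (s t : R) : cker (s + t) = cker s * cker t.
Proof. by apply: complex_ext; rewrite ?cReM ?cImM /= ?cosD ?sinD; ring. Qed.

Lemma cker0 : cker (0 : R) = 1.
Proof. by rewrite /cker cos0 sin0 oppr0. Qed.

Lemma sq_cker (t : R) : sq (cker t) = 1.
Proof. by rewrite sqE /= sqrrN cos2Dsin2. Qed.

Lemma cker_sum (I : Type) (s : seq I) (t : I -> R) :
  cker (\sum_(i <- s) t i) = \prod_(i <- s) cker (t i).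
Proof.
elim: s => [|i s IH]; first by rewrite !big_nil cker0.
by rewrite !big_cons ckerD IH.
Qed.

Definition FT f (xi : V) : R[i] := cint mu (fun x => cker (dot x xi) * f x).

Definition supported (k : nat) f := forall x, ~ cube k x -> f x = 0.

Lemma fourier_integralE (D : set V) f xi :
  fourier_integral D f xi = FT (fun x => (\1_D x : R)%:C * f x) xi.
Proof.
apply: complex_ext; rewrite /= [LHS]Rintegral_mkcond; apply: eq_Rintegral => x _;
  rewrite patchE indicE; case: (x \in D); rewrite ?mul1r ?mul0r ?mulr0//.
Qed.

Lemma measurable_dot : measurable_fun setT (fun p : V * V => dot p.2 p.1 : T1).
Proof.
rewrite /dot; apply: measurable_sum => i.
apply: measurable_funM.
  by apply: (measurableT_comp (@measurable_coord R n i)); exact: measurable_snd.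
by apply: (measurableT_comp (@measurable_coord R n i)); exact: measurable_fst.
Qed.

Lemma cmeas_cker d (T : measurableType d) (h : T -> T1) : measurable_fun setT h ->
  cmeas (fun x => cker (h x)).
Proof.
move=> mh; split => /=.
  by apply: (measurableT_comp (continuous_measurable_fun (@continuous_cos R))).
apply: measurable_funN.
by apply: (measurableT_comp (continuous_measurable_fun (@continuous_sin R))).
Qed.

Lemma measurable_dotr (xi : V) : measurable_fun setT (fun x : V => dot x xi : T1).
Proof. exact: (measurableT_comp measurable_dot (measurable_pair1 xi)). Qed.

Lemma cmeas_cker_dot f xi : cmeas f -> cmeas (fun x => cker (dot x xi) * f x).
Proof.
by move=> mf; apply: cmeasM => //; apply: cmeas_cker; exact: measurable_dotr.
Qed.

(** Tonelli gives measurability for the positive and the negative part separately, and [fine] turns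
    their extended difference measurably into a real number. *)
Lemma measurable_Rintegral_param (K : V * V -> R) : measurable_fun setT (K : _ -> T1) ->
  measurable_fun setT (fun xi : V => \int[mu]_x K (xi, x) : T1).
Proof.
move=> mK.
pose Kp := ((EFin \o K)^\+)%E; pose Km := ((EFin \o K)^\-)%E.
have mp : measurable_fun setT (fubini_F mu Kp).
  have mKp : measurable_fun setT Kp by exact/measurable_funepos/measurable_EFinP.
  exact: (measurable_fun_fubini_tonelli_F (m2 := mu) Kp mKp (funepos_ge0 _)).
have mm : measurable_fun setT (fubini_F mu Km).
  have mKm : measurable_fun setT Km by exact/measurable_funeneg/measurable_EFinP.
  exact: (measurable_fun_fubini_tonelli_F (m2 := mu) Km mKm (funeneg_ge0 _)).
have mI : measurable_fun setT (fun xi : V => \int[mu]_x (K (xi, x))%:E)%E.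
  rewrite (_ : (fun xi : V => _) = (fun xi => fubini_F mu Kp xi - fubini_F mu Km xi)%E).
    by apply: emeasurable_funB.
  apply/funext => xi; rewrite integralE /fubini_F /Kp /Km.
  by congr (_ - _)%E; apply: eq_integral => x _; rewrite ?funeposE ?funenegE.
exact: (measurableT_comp (fine_measurable measurableT) mI).
Qed.

Lemma cmeas_FT f : cmeas f -> cmeas (FT f).
Proof.
move=> mf.
have [m1 m2] : cmeas (fun p : V * V => cker (dot p.2 p.1) * f p.2).
  apply: cmeasM; first by apply: cmeas_cker; exact: measurable_dot.
  by apply: cmeas_comp mf; exact: measurable_snd.
by split; [exact: (measurable_Rintegral_param m1)|exact: (measurable_Rintegral_param m2)].
Qed.

Lemma integrable_sq f : sqint mu f -> mu.-integrable setT (EFin \o (fun x => sq (f x))).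
Proof. by move=> f2; exact: integrable_rdot. Qed.

Lemma cube_bound f k : sqint mu f -> supported k f ->
  mu.-integrable setT (EFin \o (fun x => \1_(cube k) x + sq (f x))) /\
  forall xi x, `|Re (cker (dot x xi) * f x)| <= \1_(cube k) x + sq (f x) /\
    `|Im (cker (dot x xi) * f x)| <= \1_(cube k) x + sq (f x).
Proof.
move=> f2 fk; split.
  apply: integrableRD; last exact: integrable_sq.
  apply/integrableP; split.
    by apply/measurable_EFinP; apply: measurable_indic; exact: measurable_box.
  under eq_integral do rewrite /= ger0_norm//.
  by rewrite integral_indic ?setIT ?box_finite//; exact: measurable_box.
move=> xi x; rewrite indicE; have [xk|xk] := pselect (cube k x).
  have <- : sq (cker (dot x xi) * f x) = sq (f x) by rewrite sqM sq_cker mul1r.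
  rewrite mem_set//.
  by split; [exact: normr_Re_le|exact: normr_Im_le].
by rewrite memNset// fk// mulr0 /= normr0 add0r sq_ge0.
Qed.

Lemma cintegrable_cker f k xi : sqint mu f -> supported k f ->
  cintegrable mu (fun x => cker (dot x xi) * f x).
Proof.
move=> f2 fk; have [ib fb] := cube_bound f2 fk.
have [m1 m2] : cmeas (fun x => cker (dot x xi) * f x).
  by apply: cmeas_cker_dot; case: f2.
split; apply: (le_integrable measurableT _ _ ib); try exact/measurable_EFinP;
  move=> x _; rewrite lee_fin; apply: le_trans (ler_norm _).
  by have [] := fb xi x.
by have [] := fb xi x.
Qed.

Lemma supportedD f g k l : supported k f -> supported l g ->
  supported (maxn k l) (fun x => f x + g x).
Proof.
move=> fk gl x xkl; rewrite fk ?gl ?addr0//.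
  by apply: contra_not xkl; apply: subset_cube; exact: leq_maxr.
by apply: contra_not xkl; apply: subset_cube; exact: leq_maxl.
Qed.

Lemma supportedZ c f k : supported k f -> supported k (fun x => c * f x).
Proof. by move=> fk x xk; rewrite fk ?mulr0. Qed.

Lemma FTD f g k l : sqint mu f -> sqint mu g -> supported k f -> supported l g ->
  forall xi, FT (fun x => f x + g x) xi = FT f xi + FT g xi.
Proof.
move=> f2 g2 fk gl xi; rewrite /FT -cintD; last 2 first.
- exact: cintegrable_cker fk.
- exact: cintegrable_cker gl.
by apply: eq_cint => x; rewrite mulrDr.
Qed.

Lemma FTZ c f k : sqint mu f -> supported k f ->
  forall xi, FT (fun x => c * f x) xi = c * FT f xi.
Proof.
move=> f2 fk xi; rewrite /FT -cintZ; last exact: cintegrable_cker fk.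
by apply: eq_cint => x; rewrite mulrCA.
Qed.

Lemma FT_prod (f : 'I_n -> T1 -> R[i]) (xi : V) :
  (forall i, cintegrable lebesgue_measure (fun x => cker (x * xi ord0 i) * f i x)) ->
  FT (fun v => \prod_(i < n) f i (v ord0 i)) xi =
  \prod_(i < n) fourier1 (f i) (xi ord0 i).
Proof.
move=> intf; have [_ <-] := cint_prod_coord intf.
by apply: eq_cint => v; rewrite /dot cker_sum -big_split.
Qed.

Lemma cintegrable_indic1 (a b : R) (t : R) :
  cintegrable lebesgue_measure (fun x : T1 => cker (x * t) * cindic a b x).
Proof.
have ii : lebesgue_measure.-integrable setT
    (EFin \o (\1_(`]a, b]%classic : set T1) : T1 -> R)) by exact: integrable_indic_itv.
have mk : cmeas (fun x : T1 => cker (x * t) * cindic a b x).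
  apply: cmeasM; first by apply: cmeas_cker; exact: measurable_funM.
  by apply: cmeas_real; apply: measurable_indic; exact: measurable_itv.
have [m1 m2] := mk.
split; apply: (le_integrable measurableT _ _ ii); try exact/measurable_EFinP;
    move=> x _; rewrite lee_fin [X in _ <= X]ger0_norm// ?cReM ?cImM /=;
    rewrite mulr0 ?subr0 ?add0r normrM [X in _ * X]ger0_norm// ler_piMl//.
  exact: cos_max.
by rewrite normrN sin_max.
Qed.

Lemma indic_boxE (a b : 'I_n -> R) (v : V) :
  (\1_(box a b) v : R)%:C = \prod_(i < n) cindic (a i) (b i) (v ord0 i).
Proof.
rewrite indicE; have [vb|vb] := pselect (box a b v).
  rewrite mem_set// big1// => i _; rewrite /cindic indicE mem_set//.
  exact: vb.
rewrite memNset//.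
have [i vi] : exists i, ~ (v ord0 i \in `]a i, b i]) by exact/existsNP.
by rewrite (bigD1 i)//= /cindic indicE [_ \in _]memNset// mul0r.
Qed.

Lemma FT_indic (a b : 'I_n -> R) xi :
  FT (fun v => (\1_(box a b) v : R)%:C) xi =
  \prod_(i < n) fourier1 (cindic (a i) (b i)) (xi ord0 i).
Proof.
rewrite -FT_prod => [|i]; last exact: cintegrable_indic1.
by congr (FT _ _); apply/funext => v; rewrite indic_boxE.
Qed.

(* The Plancherel constant, (2 pi)^n. *)
Definition kappa : R := (2 * kconst) ^+ n.

Lemma kappa_gt0 : 0 < kappa.
Proof. by rewrite exprn_gt0// mulr_gt0// kconst_gt0. Qed.

(** Both integrals factor over the coordinates. By [cint_ehat] and [overlapE] each coordinate
    contributes 2 [kconst] times the length of the overlap, and the n factors 2 [kconst] multiply to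
    [kappa]. *)
Lemma gram_box (a b c d : 'I_n -> R) : (forall i, a i < b i) ->
  (forall i, c i < d i) ->
  let F := fun xi => FT (fun v => (\1_(box a b) v : R)%:C) xi *
    (FT (fun v => (\1_(box c d) v : R)%:C) xi)^* in
  let G := fun v : V => (\1_(box a b) v * \1_(box c d) v : R)%:C in
  [/\ cintegrable mu F, cintegrable mu G & cint mu F = kappa%:C * cint mu G].
Proof.
move=> ab cd F G.
pose f i (t : T1) := fourier1 (cindic (a i) (b i)) t * (fourier1 (cindic (c i) (d i)) t)^*.
pose g i (t : T1) := cindic (a i) (b i) t * cindic (c i) (d i) t.
have FE : F = fun xi => \prod_(i < n) f i (xi ord0 i).
  by apply/funext => xi; rewrite /F !FT_indic rmorph_prod -big_split.
have GE : G = fun xi => \prod_(i < n) g i (xi ord0 i).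
  by apply/funext => xi; rewrite /G rmorphM /= !indic_boxE -big_split.
have fi i : cintegrable lebesgue_measure (f i) /\ cint lebesgue_measure (f i) =
    (kconst * (`|b i - c i| + `|a i - d i| - `|b i - d i| - `|a i - c i|))%:C.
  have [i1 <-] := cint_ehat (a i) (b i) (c i) (d i).
  by apply: cint_off0 => // x x0; rewrite /f !fourier1_cindic.
have gi i : cintegrable lebesgue_measure (g i) /\ cint lebesgue_measure (g i) =
    (fine (lebesgue_measure (`]a i, b i]%classic `&` `]c i, d i]%classic)))%:C.
  have -> : g i = fun t => (\1_((`]a i, b i]%classic `&` `]c i, d i]%classic) : set T1) t : R)%:C.
    by apply/funext => t; rewrite indicI /= rmorphM.
  have mI : measurable ((`]a i, b i]%classic `&` `]c i, d i]%classic) : set T1).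
    by apply: measurableI; exact: measurable_itv.
  split.
    split => /=; last exact: (integrable0 lebesgue_measure).
    apply: (le_integrable measurableT _ _ (integrable_indic_itv (a i) (b i) false false)).
      by apply/measurable_EFinP; exact: measurable_indic.
    move=> x _; rewrite indicI /= lee_fin normrM ler_piMr//.
    by rewrite indicE ger0_norm// lern1 leq_b1.
  apply: complex_ext => /=; rewrite /Rintegral; last by rewrite integral0.
  by rewrite integral_indic// setIT.
have [F1 F2] := cint_prod_coord (fun i => (fi i).1).
have [G1 G2] := cint_prod_coord (fun i => (gi i).1).
rewrite FE GE; split => //; rewrite F2 G2 /kappa.
under eq_bigr do rewrite (fi _).2 overlapE// mulrCA mulrA rmorphM /= -(gi _).2.
by rewrite big_split /= prodr_const card_ord rmorphXn.
Qed.

End fourier_transform.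

Section norm_convergence.
Context d (T : measurableType d) {R : realType}.
Variable mu : {measure set T -> \bar R}.
Implicit Types f g : T -> R[i].

Lemma ip_sqD f g : sqint mu f -> sqint mu g ->
  ip mu (fun x => f x + g x) (fun x => f x + g x) = ip mu f f + ip mu g f *+ 2 + ip mu g g.
Proof.
move=> f2 g2; have fg2 := sqintD f2 g2.
by rewrite ipDl// !ipDr// (ipC mu f g); ring.
Qed.

Lemma cvg_ip (f_ : nat -> T -> R[i]) f : (forall k, sqint mu (f_ k)) -> sqint mu f ->
  (fun k => nsq mu (fun x => f_ k x - f x)) @ \oo --> 0%E ->
  (fun k => ip mu (f_ k) (f_ k)) @ \oo --> ip mu f f.
Proof.
move=> f_2 f2 fc.
pose D k := fun x => f_ k x - f x.
have D2 k : sqint mu (D k) by exact: sqintB.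
have Dc : (fun k => ip mu (D k) (D k)) @ \oo --> (0 : R).
  rewrite (_ : (fun k => _) = fine \o (fun k => nsq mu (D k))); first exact: fine_cvg fc.
  by apply/funext => k /=; rewrite nsq_ip.
have E k : ip mu (f_ k) (f_ k) - ip mu f f = ip mu (D k) (D k) + ip mu f (D k) *+ 2.
  have -> : ip mu (f_ k) (f_ k) = ip mu (fun x => D k x + f x) (fun x => D k x + f x).
    by congr ip; apply/funext => x; rewrite /D subrK.
  by rewrite ip_sqD//; ring.
have nf : 0 <= ip mu f f.
  by apply: Rintegral_ge0 => x _; exact: sq_ge0.
apply/cvgrPdist_le => e e0.
(* In Young's inequality for f and D, eta makes the share of f at most e / 2; del then bounds
   everything that involves D by e / 2. *)
pose eta : R := e / 2 / (1 + ip mu f f).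
have eta0 : 0 < eta by rewrite !divr_gt0// ltr_wpDr.
pose del := e / 2 / (1 + eta^-1).
have etai : 0 < eta^-1 by rewrite invr_gt0.
have del0 : 0 < del by rewrite !divr_gt0// ltr_wpDr// ltW.
have /cvgrPdist_le /(_ del del0) := Dc.
apply: filterS => k; rewrite distrC subr0 => Dk.
have nD : 0 <= ip mu (D k) (D k) by apply: Rintegral_ge0 => x _; exact: sq_ge0.
rewrite ger0_norm// in Dk.
have h1 := ip_le_eta f2 (D2 k) eta0.
have h2 : - (ip mu f (D k) *+ 2) <= eta * ip mu f f + eta^-1 * ip mu (D k) (D k).
  have := ip_le_eta f2 (sqintN (D2 k)) eta0.
  have mN g h : sqint mu g -> sqint mu h -> ip mu g (fun x => - h x) = - ip mu g h.
    move=> g2 h2; rewrite -mulN1r -(ipZr (-1) h2 g2); congr ip.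
    by apply/funext => x; rewrite rmorphN1 mulN1r.
  rewrite (mN _ _ f2 (D2 k)) (mN _ _ (sqintN (D2 k)) (D2 k)).
  by rewrite (ipC mu (fun x => - D k x) (D k)) (mN _ _ (D2 k) (D2 k)) opprK mulNrn.
have h3 : eta * ip mu f f <= e / 2.
  rewrite /eta mulrAC ler_pdivrMr ?ltr_wpDr// ler_pM2l ?divr_gt0//.
  by rewrite lerDr.
have h4 : ip mu (D k) (D k) + eta^-1 * ip mu (D k) (D k) <= e / 2.
  rewrite -[X in X + _]mul1r -mulrDl.
  apply: (@le_trans _ _ ((1 + eta^-1) * del)); first by rewrite ler_wpM2l// addr_ge0// ltW.
  by rewrite /del mulrC divfK// gt_eqF// ltr_wpDr// ltW.
rewrite -normrN opprB E ler_norml; apply/andP; split; lra.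
Qed.

End norm_convergence.

(** * Parseval's identity for step functions *)

Section plancherel.
Context {R : realType} (n : nat).
Local Notation V := 'rV[R]_n.
Local Notation mu := (lebesgue_rV R n).
Local Notation T1 := (measurableTypeR R).
Local Notation kappa := (@kappa R n).
Implicit Types f g : V -> R[i].

Definition cbox (c : R[i]) (a b : 'I_n -> R) : V -> R[i] :=
  fun x => c * (\1_(box a b) x : R)%:C.

(** Sides are nondegenerate because the Gram computation assumes a < b. Degenerate boxes are empty
    and contribute 0 ([span_cbox]). *)
Inductive bspan : (V -> R[i]) -> Prop :=
| bspan0 : bspan (fun=> 0)
| bspanS c a b f : (forall i, a i < b i) -> bspan f ->
    bspan (fun x => cbox c a b x + f x).

Lemma box_supported a b : exists k, forall c, supported k (cbox c a b).
Proof.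
pose M := \sum_i (`|a i| + `|b i|).
exists (Num.truncn M).+1 => c x xk; rewrite /cbox indicE memNset ?mulr0//.
apply: contra_not xk => xab i; have := xab i; rewrite !in_itv/= => /andP[h1 h2].
have hM : `|a i| + `|b i| <= M.
  by rewrite /M (bigD1 i)//= lerDl sumr_ge0// => j _; rewrite addr_ge0.
have hT := truncnS_gt M.
have := ler_norm (b i); have := ler_norm (- a i); rewrite normrN => ha hb.
have := normr_ge0 (a i); have := normr_ge0 (b i) => hb0 ha0.
by apply/andP; split; [|apply: ltW]; lra.
Qed.

Lemma sqint_cbox c a b : sqint mu (cbox c a b).
Proof. by apply: sqintZ; exact: sqint_box. Qed.

Lemma rdotE (z w : R[i]) : rdot z w = Re (z * w^*).
Proof. by rewrite cReM /=; case: w => ? ? /=; rewrite /rdot /=; ring. Qed.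

Lemma sqint_FT_cbox c a b : (forall i, a i < b i) -> sqint mu (FT (cbox c a b)).
Proof.
move=> ab.
have [k hk] := box_supported a b.
have h1 : sqint mu (FT (fun x => (\1_(box a b) x : R)%:C)).
  have m1 : cmeas (FT (fun x => (\1_(box a b) x : R)%:C)).
    by apply: cmeas_FT; case: (sqint_box a b).
  split => //; have [[iF _] _ _] := gram_box ab ab.
  have := integrable_lty measurableT iF; congr (_ < _)%E; apply: eq_integral => x _.
  by rewrite /sq rdotE.
have -> : FT (cbox c a b) = fun xi => c * FT (fun x => (\1_(box a b) x : R)%:C) xi.
  apply/funext => xi; apply: (@FTZ _ _ _ _ k); first exact: sqint_box.
  by move=> x /(hk 1 x); rewrite /cbox mul1r.
exact: sqintZ.
Qed.

Lemma ip_cint f g : ip mu f g = Re (cint mu (fun x => f x * (g x)^*)).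
Proof. by apply: eq_Rintegral => x _; rewrite rdotE. Qed.

Lemma ip_FT_cbox c a b c' a' b' : (forall i, a i < b i) -> (forall i, a' i < b' i) ->
  ip mu (FT (cbox c a b)) (FT (cbox c' a' b')) =
  kappa * ip mu (cbox c a b) (cbox c' a' b').
Proof.
move=> ab ab'.
have [k hk] := box_supported a b; have [k' hk'] := box_supported a' b'.
have [iF iG FG] := gram_box ab ab'.
rewrite !ip_cint.
have -> : (fun xi => FT (cbox c a b) xi * (FT (cbox c' a' b') xi)^*) =
  fun xi => (c * c'^*) * (FT (fun x => (\1_(box a b) x : R)%:C) xi *
    (FT (fun x => (\1_(box a' b') x : R)%:C) xi)^*).
  apply/funext => xi.
  rewrite (@FTZ _ _ _ _ k); [|exact: sqint_box|]; last first.
    by move=> x /(hk 1 x); rewrite /cbox mul1r.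
  rewrite (@FTZ _ _ _ _ k'); [|exact: sqint_box|]; last first.
    by move=> x /(hk' 1 x); rewrite /cbox mul1r.
  by rewrite rmorphM; ring.
have -> : (fun x => cbox c a b x * (cbox c' a' b' x)^*) =
  fun x => (c * c'^*) * (\1_(box a b) x * \1_(box a' b') x : R)%:C.
  by apply/funext => x; rewrite /cbox; move: (\1_(box a b) x : R) (\1_(box a' b') x : R) => u v;
    case: (c) => ? ?; case: (c') => ? ?; apply: complex_ext => /=; ring.
rewrite cintZ// cintZ// FG !cReM !cImM /=; ring.
Qed.

Lemma span_supported f : bspan f -> exists k, supported k f.
Proof.
elim=> [|c a b g _ _ [l hl]]; first by exists 0%N.
have [k hk] := box_supported a b; exists (maxn k l).
exact: supportedD.
Qed.

Lemma sqint_span f : bspan f -> sqint mu f.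
Proof.
by elim=> [|c a b g _ _ ?]; [exact: sqint0|apply: sqintD => //; exact: sqint_cbox].
Qed.

Lemma FT0 : FT (fun _ : V => (0 : R[i])) = fun=> 0.
Proof.
apply/funext => xi; rewrite /FT; under [X in cint _ X]eq_fun do rewrite mulr0.
by apply: complex_ext; rewrite /= /Rintegral integral0.
Qed.

Lemma ip0l f : ip mu (fun=> 0) f = 0.
Proof.
rewrite /ip /Rintegral integral0_eq// => x _.
by rewrite /rdot /= !mul0r addr0.
Qed.

(** The pairing with a single box is included because the induction needs it for the cross terms. *)
Lemma span_parseval f : bspan f -> [/\ sqint mu (FT f),
  (forall c a b, (forall i, a i < b i) ->
     ip mu (FT f) (FT (cbox c a b)) = kappa * ip mu f (cbox c a b)) &
  ip mu (FT f) (FT f) = kappa * ip mu f f].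
Proof.
elim=> [|c a b g ab sg [g1 g2 g3]].
  by rewrite FT0; split; [exact: sqint0|move=> *|]; rewrite !ip0l mulr0.
have [k hk] := box_supported a b; have [l hl] := span_supported sg.
have -> : FT (fun x => cbox c a b x + g x) = fun xi => FT (cbox c a b) xi + FT g xi.
  by apply/funext => xi; apply: FTD (hk c) hl _;
    [exact: sqint_cbox|exact: sqint_span].
have s1 := sqint_FT_cbox c ab; have s2 := sqint_cbox c a b; have s3 := sqint_span sg.
split; first exact: sqintD.
  move=> c' a' b' ab'; have s1' := sqint_FT_cbox c' ab'; have s2' := sqint_cbox c' a' b'.
  by rewrite !ipDl// ip_FT_cbox// g2// mulrDr.
have s4 := sqintD s1 g1; have s5 := sqintD s2 s3.
rewrite !ipDl// !ipDr// g3 ip_FT_cbox// (ipC mu (FT (cbox c a b))) g2//.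
by rewrite (ipC mu (cbox c a b) g); ring.
Qed.

Lemma bspanD f g : bspan f -> bspan g -> bspan (fun x => f x + g x).
Proof.
move=> sf sg; elim: sf => [|c a b h ab _ IH].
  by under eq_fun do rewrite add0r.
by under eq_fun do rewrite -addrA; exact: bspanS.
Qed.

Lemma bspanZ c f : bspan f -> bspan (fun x => c * f x).
Proof.
elim=> [|c' a b h ab _ IH].
  by under eq_fun do rewrite mulr0; exact: bspan0.
under eq_fun do rewrite mulrDr /cbox mulrA; exact: (bspanS (c * c') ab IH).
Qed.

Lemma box_degenerate (a b : 'I_n -> R) : ~ (forall i, a i < b i) -> box a b = set0.
Proof.
move=> /existsNP[i /negP]; rewrite -leNgt => ba; apply/seteqP; split => // x /(_ i).
by rewrite in_itv/= => /andP[h1 h2]; have := lt_le_trans (lt_le_trans h1 h2) ba; rewrite ltxx.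
Qed.

Lemma span_cbox c a b : bspan (cbox c a b).
Proof.
have [ab|ab] := pselect (forall i, a i < b i).
  have := bspanS c ab bspan0; congr bspan; apply/funext => x; exact: addr0.
have -> : cbox c a b = fun=> 0; last exact: bspan0.
by apply/funext => x; rewrite /cbox box_degenerate// indic0 mulr0.
Qed.

Lemma span_cube k f : bspan f -> bspan (fun x => (\1_(cube k) x : R)%:C * f x).
Proof.
elim=> [|c a b h ab _ IH].
  by under eq_fun do rewrite mulr0; exact: bspan0.
under eq_fun do rewrite mulrDr; apply: bspanD => //.
have := span_cbox c (fun i => Num.max (a i) (- k%:R)) (fun i => Num.min (b i) k%:R).
congr bspan; apply/funext => x; rewrite /cbox -box_setI indicI /= rmorphM.
by rewrite -/(cube k) /=; ring.
Qed.

Lemma cvg_sq_real (c : R[i]) (u : nat -> R) (l : R) : u @ \oo --> l ->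
  (fun k => sq (c * (u k)%:C - c * l%:C)) @ \oo --> (0 : R).
Proof.
move=> ul.
have -> : (fun k => sq (c * (u k)%:C - c * l%:C)) = fun k => sq c * ((u k - l) * (u k - l)).
  by apply/funext => k; rewrite -mulrBr sqM -rmorphB sq_real expr2.
have : (fun k => u k - l) @ \oo --> l - l by apply: cvgB => //; exact: cvg_cst.
rewrite subrr => h; rewrite -[X in _ --> X](mulr0 (sq c)) -[X in _ * X](mulr0 0).
by apply: cvgMr; exact: cvgM.
Qed.

(** The L^2 closure of P, restricted to real functions, satisfies the hypotheses of [density].
    Measurability is built into Q because the norm inequalities require it. *)
Lemma approximable (P : (V -> R[i]) -> Prop) :
  (forall f g, P f -> P g -> P (fun x => f x + g x)) ->
  (forall a f, P f -> P (fun x => a%:C * f x)) ->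
  (forall f, P f -> cmeas f) ->
  (forall a b, (forall e, 0 < e -> exists2 s, P s &
     (nsq mu (fun x => (\1_(box a b) x : R)%:C - s x)%R <= e%:E)%E)) ->
  forall g : V -> R, sqint mu (fun x => (g x)%:C) -> forall e, 0 < e ->
  exists2 s, P s & (nsq mu (fun x => (g x)%:C - s x)%R <= e%:E)%E.
Proof.
move=> PD PZ Pm Pb.
pose Q (g : V -> R) := measurable_fun setT g /\ forall e, 0 < e -> exists2 s, P s &
  (nsq mu (fun x => (g x)%:C - s x)%R <= e%:E)%E.
suff H (g : V -> R) : sqint mu (fun x => (g x)%:C) -> Q g by move=> g /H[].
apply: (@density R n Q) => {g}.
- move=> f g [mf Qf] [mg Qg]; split; first exact: measurable_funD.
  (* Two errors of e / 4, each doubled by [nsqD_le], add up to e. *)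
  move=> e e0; have e4 : 0 < e / 4 by rewrite divr_gt0.
  have [s Ps fs] := Qf _ e4; have [t Pt gt] := Qg _ e4.
  exists (fun x => s x + t x); first exact: PD.
  rewrite (eq_nsq _ (g := fun x => ((f x)%:C - s x) + ((g x)%:C - t x))); last first.
    by move=> x; rewrite rmorphD /=; ring.
  apply: le_trans (nsqD_le _ _ _) _.
  + by apply: cmeasB; [exact: cmeas_real|exact: Pm].
  + by apply: cmeasB; [exact: cmeas_real|exact: Pm].
  apply: (@le_trans _ _ (2%:E * (e / 4)%:E + 2%:E * (e / 4)%:E)%E).
    by apply: leeD; rewrite lee_pmul2l.
  by rewrite -!EFinM -EFinD lee_fin; lra.
- move=> a f [mf Qf]; split; first exact: measurable_funM.
  (* The added 1 covers the case a = 0. *)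
  move=> e e0; pose e' := e / (1 + a ^+ 2).
  have a0 : 0 < 1 + a ^+ 2 by rewrite ltr_wpDr ?sqr_ge0.
  have [s Ps fs] := Qf e' (divr_gt0 e0 a0).
  exists (fun x => a%:C * s x); first exact: PZ.
  rewrite (eq_nsq _ (g := fun x => a%:C * ((f x)%:C - s x))); last first.
    by move=> x; rewrite rmorphM mulrBr.
  rewrite nsqZ; last by apply: cmeasB; [exact: cmeas_real|exact: Pm].
  rewrite sq_real; apply: (@le_trans _ _ ((a ^+ 2)%:E * e'%:E)%E).
    by apply: lee_pmul => //; rewrite ?lee_fin ?sqr_ge0// nsq_ge0.
  rewrite -EFinM lee_fin /e' mulrA ler_pdivrMr// mulrC ler_pM2l//; lra.
- move=> f_ f g Qf _ mf g2 fg fc; split => // e e0.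
  have mf_ k : cmeas (fun x => (f_ k x)%:C) by apply: cmeas_real; case: (Qf k).
  have H1 k x : sq (f_ k x)%:C <= sq (g x)%:C.
    rewrite !sq_real -[leLHS]real_normK ?num_real//.
    by rewrite lerXn2r ?nnegrE// (le_trans _ (fg k x)).
  have H2 x : (fun k => sq ((f_ k x)%:C - (f x)%:C)) @ \oo --> (0 : R).
    by have := cvg_sq_real 1 (fc x); under eq_fun do rewrite !mul1r.
  have := nsq_dominated mf_ (cmeas_real mf) g2 H1 H2.
  have e4 : (0 < (e / 4)%:E)%E by rewrite lte_fin divr_gt0.
  move=> /(_ [set y | (y < (e / 4)%:E)%E]) [].
    exact: lt_nbhsl.
  move=> N _ /(_ N (leqnn N)) /= hN.
  have e4' : 0 < e / 4 by rewrite divr_gt0.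
  have [mN /(_ _ e4') [s Ps fs]] := Qf N.
  exists s => //.
  rewrite (eq_nsq _ (g := fun x => ((f_ N x)%:C - s x) - ((f_ N x)%:C - (f x)%:C))); last first.
    by move=> x; ring.
  apply: le_trans (nsqB_le _ _ _) _.
  + by apply: cmeasB => //; exact: Pm.
  + by apply: cmeasB => //; exact: cmeas_real.
  apply: (@le_trans _ _ (2%:E * (e / 4)%:E + 2%:E * (e / 4)%:E)%E).
    by apply: leeD; rewrite lee_pmul2l// ltW.
  by rewrite -!EFinM -EFinD lee_fin; lra.
- move=> a b; split; last exact: Pb.
  by apply: measurable_indic; exact: measurable_box.
Qed.

Lemma approximable_complex (P : (V -> R[i]) -> Prop) :
  (forall f g, P f -> P g -> P (fun x => f x + g x)) ->
  (forall a f, P f -> P (fun x => a * f x)) ->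
  (forall f, P f -> cmeas f) ->
  (forall a b, (forall e, 0 < e -> exists2 s, P s &
     (nsq mu (fun x => (\1_(box a b) x : R)%:C - s x)%R <= e%:E)%E)) ->
  forall f, sqint mu f -> forall e, 0 < e ->
  exists2 s, P s & (nsq mu (fun x => f x - s x)%R <= e%:E)%E.
Proof.
move=> PD PZ Pm Pb f f2 e e0.
have [m1 m2] : cmeas f by case: f2.
have e4 : 0 < e / 4 by rewrite divr_gt0.
have r2 : sqint mu (fun x => (Re (f x))%:C).
  apply: (@sqint_le _ _ _ mu 1 _ f) => //.
  by move=> x; rewrite sq_real sqE mul1r lerDl sqr_ge0.
have i2 : sqint mu (fun x => (Im (f x))%:C).
  apply: (@sqint_le _ _ _ mu 1 _ f) => //.
  by move=> x; rewrite sq_real sqE mul1r lerDr sqr_ge0.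
have PZ' (a : R) g : P g -> P (fun x => a%:C * g x) by exact: PZ.
have [s Ps fs] := approximable PD PZ' Pm Pb r2 e4.
have [t Pt ft] := approximable PD PZ' Pm Pb i2 e4.
exists (fun x => s x + 'i * t x); first by apply: PD => //; exact: PZ.
rewrite (eq_nsq _ (g := fun x => ((Re (f x))%:C - s x) + 'i * ((Im (f x))%:C - t x))); last first.
  by move=> x; case: (f x) (s x) (t x) => [? ?] [? ?] [? ?]; apply: complex_ext => /=; ring.
have mb : cmeas (fun x => (Im (f x))%:C - t x).
  by apply: cmeasB; [exact: cmeas_real|exact: Pm].
apply: le_trans (nsqD_le _ _ _) _.
- by apply: cmeasB; [exact: cmeas_real|exact: Pm].
- by apply: cmeasM => //; exact: cmeas_cst.
rewrite nsqZ// (_ : sq 'i = 1) ?mul1e; last by rewrite sqE /= expr0n expr1n add0r.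
apply: (@le_trans _ _ (2%:E * (e / 4)%:E + 2%:E * (e / 4)%:E)%E).
  by apply: leeD; rewrite lee_pmul2l.
by rewrite -!EFinM -EFinD lee_fin; lra.
Qed.

Lemma span_dense f : sqint mu f -> forall e, 0 < e ->
  exists2 s, bspan s & (nsq mu (fun x => f x - s x)%R <= e%:E)%E.
Proof.
apply: approximable_complex.
- exact: bspanD.
- exact: bspanZ.
- by move=> g /sqint_span[].
- move=> a b e e0; exists (cbox 1 a b); first exact: span_cbox.
  rewrite (eq_nsq _ (g := fun=> 0)); last by move=> x; rewrite /cbox mul1r subrr.
  by rewrite nsq_ip ?ip0l ?lee_fin ?ltW//; exact: sqint0.
Qed.

End plancherel.

Section fatou_bound.
Context d (T : measurableType d) {R : realType}.
Variable mu : {measure set T -> \bar R}.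

Lemma nsq_fatou (f_ : nat -> T -> R[i]) (f : T -> R[i]) (B : \bar R) :
  (forall k, cmeas (f_ k)) ->
  (forall x, (fun k => Re (f_ k x)) @ \oo --> Re (f x)) ->
  (forall x, (fun k => Im (f_ k x)) @ \oo --> Im (f x)) ->
  (forall k, (nsq mu (f_ k) <= B)%E) -> (nsq mu f <= B)%E.
Proof.
move=> mf_ cr ci fB.
have E x : limn_einf (fun k => (sq (f_ k x))%:E) = (sq (f x))%:E.
  have c : (fun k => (sq (f_ k x))%:E) @ \oo --> (sq (f x))%:E.
    apply: cvg_EFin; first exact: nearW.
    by apply: cvgD; apply: cvgM.
  rewrite is_cvg_limn_einfE; first exact/cvg_lim.
  by apply/cvg_ex; eexists; exact: c.
have := @fatou _ _ _ mu setT measurableT (fun k x => (sq (f_ k x))%:E).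
under eq_integral do rewrite E.
move=> h; apply: le_trans (h _ _) _.
- by move=> k; exact: measurable_sqE.
- by move=> k x _; rewrite lee_fin sq_ge0.
rewrite limn_einf_lim; apply: lime_le; first exact: is_cvg_einfs.
apply: nearW => k; apply: le_trans (fB k); apply: ereal_inf_lbound.
by exists k => //=.
Qed.

End fatou_bound.

(** * Parseval's identity for functions supported in a cube *)

Section parseval.
Context {R : realType} (n : nat).
Local Notation V := 'rV[R]_n.
Local Notation mu := (lebesgue_rV R n).
Local Notation T1 := (measurableTypeR R).
Local Notation kappa := (@kappa R n).
Implicit Types f g : V -> R[i].

(** On the cube |f| <= e + e^-1 |f|^2, and the integral of this bounds the transform at every point
    by the L^2 norm. *)
Lemma FT_bound f k (e : R) xi : 0 < e -> sqint mu f -> supported k f ->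
  `|Re (FT f xi)| <= e * fine (mu (cube k)) + e^-1 * ip mu f f /\
  `|Im (FT f xi)| <= e * fine (mu (cube k)) + e^-1 * ip mu f f.
Proof.
move=> e0 f2 fk.
have [i1 i2] := cintegrable_cker xi f2 fk.
have mc : measurable (@cube R n k) by exact: measurable_box.
have ii : mu.-integrable setT (EFin \o (\1_(cube k) : V -> R)).
  apply/integrableP; split; first by apply/measurable_EFinP; exact: measurable_indic.
  under eq_integral do rewrite /= ger0_norm//.
  by rewrite integral_indic ?setIT ?box_finite.
have ie : mu.-integrable setT (EFin \o (fun x => e * \1_(cube k) x + e^-1 * sq (f x))).
  by apply: integrableRD; apply: integrableRZl => //; exact: integrable_sq.
have E : \int[mu]_x (e * \1_(cube k) x + e^-1 * sq (f x)) =
    e * fine (mu (cube k)) + e^-1 * ip mu f f.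
  rewrite RintegralD//; [|exact: integrableRZl|by apply: integrableRZl; exact: integrable_sq].
  rewrite RintegralZl// RintegralZl//; last exact: integrable_sq.
  by congr (_ * _ + _); rewrite /Rintegral integral_indic// setIT.
have bnd x (t : R) : (`|t| ^+ 2 <= sq (f x)) -> (~ cube k x -> t = 0) ->
    `|t| <= e * \1_(cube k) x + e^-1 * sq (f x).
  move=> t2 tk; rewrite indicE; have [xk|xk] := pselect (cube k x); last first.
    by rewrite memNset// tk// normr0 mulr0 add0r mulr_ge0 ?sq_ge0// invr_ge0 ltW.
  rewrite mem_set// mulr1; apply: (@le_trans _ _ (e + e^-1 * `|t| ^+ 2)); last first.
    by rewrite lerD2l ler_pM2l ?invr_gt0.
  rewrite -subr_ge0 (_ : _ - _ = e^-1 * ((`|t| - e / 2) ^+ 2 + 3 / 4 * e ^+ 2)).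
    by rewrite mulr_ge0 ?invr_ge0 ?(ltW e0)// addr_ge0 ?sqr_ge0// mulr_ge0 ?sqr_ge0.
  by field; rewrite gt_eqF.
have sqE' x : sq (cker (dot x xi) * f x) = sq (f x) by rewrite sqM sq_cker mul1r.
split; (apply: le_trans (le_normr_Rintegral _ _) _ => //; rewrite -E;
  apply: le_Rintegral => //; [exact: integrable_norm|]; move=> x _; apply: bnd).
- by rewrite real_normK ?num_real// -sqE' [leRHS]sqE lerDl sqr_ge0.
- by move=> xk; rewrite fk// mulr0.
- by rewrite real_normK ?num_real// -sqE' [leRHS]sqE lerDr sqr_ge0.
- by move=> xk; rewrite fk// mulr0.
Qed.

Lemma cvg_invS : (fun j : nat => (j.+1%:R : R)^-1) @ \oo --> (0 : R).
Proof. exact: cvg_harmonic. Qed.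

(** With e = 1 / (j+1) in [FT_bound], a squared norm of at most e^2 leaves two terms of order e. *)
Lemma FT_cvg0 (f_ : nat -> V -> R[i]) k xi : (forall j, sqint mu (f_ j)) ->
  (forall j, supported k (f_ j)) ->
  (forall j, (nsq mu (f_ j) <= (j.+1%:R^-1 ^+ 2)%:E)%E) ->
  (fun j => Re (FT (f_ j) xi)) @ \oo --> (0 : R) /\
  (fun j => Im (FT (f_ j) xi)) @ \oo --> (0 : R).
Proof.
move=> f2 fk fe.
have H j : (j.+1%:R^-1)^-1 * ip mu (f_ j) (f_ j) <= j.+1%:R^-1 :> R.
  have := fe j; rewrite nsq_ip// lee_fin => h.
  by rewrite invrK mulrC -ler_pdivlMr ?ltr0n// -expr2.
pose M := fine (mu (@cube R n k)) + 1.
have hc : (fun j : nat => (j.+1%:R : R)^-1 * M) @ \oo --> (0 : R).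
  by rewrite -[X in _ --> X](mul0r M); apply: cvgMl; exact: cvg_invS.
have hcN : (fun j : nat => - ((j.+1%:R : R)^-1 * M)) @ \oo --> (0 : R).
  by rewrite -[X in _ --> X]oppr0; exact: cvgN.
have B j : `|Re (FT (f_ j) xi)| <= j.+1%:R^-1 * M /\ `|Im (FT (f_ j) xi)| <= j.+1%:R^-1 * M.
  have e0 : 0 < j.+1%:R^-1 :> R by rewrite invr_gt0.
  have [h1 h2] := FT_bound xi e0 (f2 j) (fk j).
  by rewrite /M mulrDr mulr1; split; [apply: le_trans h1 _|apply: le_trans h2 _];
    rewrite lerD2l; exact: H.
split; apply: (squeeze_cvgr _ hcN hc); apply: nearW => j; have [h1 h2] := B j.
  by rewrite -ler_norml.
by rewrite -ler_norml.
Qed.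

Lemma span_supported_approx f k : sqint mu f -> supported k f -> forall e, 0 < e ->
  exists2 s, bspan s & supported k s /\ (nsq mu (fun x => f x - s x)%R <= e%:E)%E.
Proof.
move=> f2 fk e e0; have [s ss fs] := span_dense f2 e0.
exists (fun x => (\1_(cube k) x : R)%:C * s x); first exact: span_cube.
split; first by move=> x xk; rewrite indicE memNset// mul0r.
have ss2 := sqint_span ss; have [mf _] := f2; have [ms _] := ss2.
apply: le_trans fs; apply: le_nsq1.
- apply: cmeasB => //; apply: cmeasM => //.
  by apply: cmeas_real; apply: measurable_indic; exact: measurable_box.
- exact: cmeasB.
move=> x; rewrite indicE; have [xk|xk] := pselect (cube k x).
  by rewrite mem_set// mul1r.
by rewrite memNset// mul0r subr0 fk// sqE /= expr0n addr0 sq_ge0.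
Qed.

Lemma FTB f g k : sqint mu f -> sqint mu g -> supported k f -> supported k g ->
  FT (fun x => f x - g x) = fun xi => FT f xi - FT g xi.
Proof.
move=> f2 g2 fk gk; apply/funext => xi.
have -> : (fun x => f x - g x) = fun x => f x + (-1) * g x.
  by apply/funext => x; rewrite mulN1r.
rewrite (@FTD _ _ _ _ k k)//; last 2 first.
- exact: sqintZ.
- exact: supportedZ.
by rewrite (@FTZ _ _ _ _ k)// mulN1r.
Qed.

(** The transforms of step functions approximating f converge pointwise to that of f, so Fatou's
    lemma turns the identity for step functions into a bound. This is what first shows the transform
    of f to be square-integrable; the additive constant comes from the approximation error, at most
    1. *)
Lemma FT_nsq_le f k : sqint mu f -> supported k f ->
  (nsq mu (FT f) <= (2 * kappa)%:E * nsq mu f + (2 * kappa)%:E)%E.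
Proof.
move=> f2 fk.
have [s_ sP] : {s_ : nat -> V -> R[i] & forall j, [/\ bspan (s_ j), supported k (s_ j) &
    (nsq mu (fun x => f x - s_ j x)%R <= (j.+1%:R^-1 ^+ 2)%:E)%E]}.
  apply: (@choice _ _ (fun j s => [/\ bspan s, supported k s &
    (nsq mu (fun x => f x - s x)%R <= (j.+1%:R^-1 ^+ 2)%:E)%E])) => j.
  have e0 : 0 < j.+1%:R^-1 ^+ 2 :> R by rewrite exprn_gt0// invr_gt0.
  by have [s ss [sk fs]] := span_supported_approx f2 fk e0; exists s.
have s2 j : sqint mu (s_ j) by apply: sqint_span; case: (sP j).
have sk j : supported k (s_ j) by case: (sP j).
have fs j : sqint mu (fun x => f x - s_ j x) by exact: sqintB.
have fsk j : supported k (fun x => f x - s_ j x).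
  by move=> x xk; rewrite fk// sk// subr0.
have c xi := FT_cvg0 xi fs fsk (fun j => let: And3 _ _ h := sP j in h).
apply: (@nsq_fatou _ _ _ mu (fun j => FT (s_ j))).
- by move=> j; apply: cmeas_FT; case: (s2 j).
- move=> xi; have [c1 _] := c xi.
  have : (fun j => Re (FT f xi) - Re (FT (fun x => f x - s_ j x) xi)) @ \oo --> Re (FT f xi) - 0.
    by apply: cvgB => //; exact: cvg_cst.
  rewrite subr0; apply: cvg_trans; apply: near_eq_cvg; apply: nearW => j.
  by rewrite (FTB (k := k))// cReD cReN; ring.
- move=> xi; have [_ c1] := c xi.
  have : (fun j => Im (FT f xi) - Im (FT (fun x => f x - s_ j x) xi)) @ \oo --> Im (FT f xi) - 0.
    by apply: cvgB => //; exact: cvg_cst.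
  rewrite subr0; apply: cvg_trans; apply: near_eq_cvg; apply: nearW => j.
  by rewrite (FTB (k := k))// cImD cImN; ring.
move=> j; have [ss _ sn] := sP j; have [F2 _ PF] := span_parseval ss.
rewrite (nsq_ip F2) PF.
have : (nsq mu (s_ j) <= 2%:E * nsq mu f + 2%:E)%E.
  rewrite (eq_nsq mu (g := fun x => f x - (f x - s_ j x))); last by move=> x; ring.
  have [mf _] := f2; have [mfs _] := fs j.
  apply: le_trans (nsqB_le mu mf mfs) _; rewrite leeD2l//.
  rewrite -[leRHS]mule1 lee_pmul2l//; apply: le_trans sn _.
  by rewrite lee_fin expr_le1 ?invr_ge0// invf_le1// ler1n.
rewrite !nsq_ip// -!EFinM -!EFinD !lee_fin => h.
have := @kappa_gt0 R n => k0; rewrite -[X in _ + X]mulr1 -mulrDr -mulrA mulrCA ler_pM2l//.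
by rewrite mulrDr mulr1.
Qed.

Lemma sqint_FT f k : sqint mu f -> supported k f -> sqint mu (FT f).
Proof.
move=> f2 fk; split; first by apply: cmeas_FT; case: f2.
apply: le_lt_trans (FT_nsq_le f2 fk) _.
by rewrite nsq_ip// -EFinM -EFinD ltry.
Qed.

Lemma FT_nsq_le2 f k : sqint mu f -> supported k f ->
  ip mu (FT f) (FT f) <= 2 * kappa * ip mu f f.
Proof.
move=> f2 fk; have F2 := sqint_FT f2 fk.
(* scaling f by a large real removes the additive constant *)
have H (a : R) : 0 < a -> ip mu (FT f) (FT f) <= 2 * kappa * ip mu f f + a^-2 * (2 * kappa).
  move=> a0; have af2 : sqint mu (fun x => a%:C * f x) by exact: sqintZ.
  have := FT_nsq_le af2 (supportedZ a%:C fk).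
  have -> : FT (fun x => a%:C * f x) = fun xi => a%:C * FT f xi.
    by apply/funext => xi; exact: FTZ fk _.
  have aF2 : sqint mu (fun xi => a%:C * FT f xi) by exact: sqintZ.
  rewrite !nsq_ip// -EFinM -EFinD lee_fin !ipZl// !ipZr// => h.
  have a2 : 0 < a ^+ 2 by rewrite exprn_gt0.
  rewrite -(ler_pM2l a2) mulrDr mulrA; apply: le_trans (le_trans _ h) _.
    by rewrite expr2 -!mulrA.
  by rewrite le_eqVlt; apply/orP; left; apply/eqP; field; rewrite gt_eqF.
have k0 := @kappa_gt0 R n.
apply/ler_addgt0Pr => e e0.
pose a2 := (2 * kappa) / e.
have a20 : 0 < a2 by rewrite divr_gt0// mulr_gt0.
have := H (Num.sqrt a2); rewrite sqrtr_gt0 => /(_ a20); rewrite sqr_sqrtr ?(ltW a20)//.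
rewrite /a2 invf_div divfK//; first by rewrite gt_eqF// mulr_gt0.
Qed.

(** [FT_nsq_le2] makes the transform continuous for the L^2 norm, so the identity for step functions
    passes to the limit. *)
Theorem parseval_supported f k : sqint mu f -> supported k f ->
  ip mu (FT f) (FT f) = kappa * ip mu f f.
Proof.
move=> f2 fk; have F2 := sqint_FT f2 fk; have k0 := @kappa_gt0 R n.
have [s_ sP] : {s_ : nat -> V -> R[i] & forall j, [/\ bspan (s_ j), supported k (s_ j) &
    (nsq mu (fun x => f x - s_ j x)%R <= (j.+1%:R^-1)%:E)%E]}.
  apply: (@choice _ _ (fun j s => [/\ bspan s, supported k s &
    (nsq mu (fun x => f x - s x)%R <= (j.+1%:R^-1)%:E)%E])) => j.
  have e0 : 0 < j.+1%:R^-1 :> R by rewrite invr_gt0.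
  by have [s ss [sk fs]] := span_supported_approx f2 fk e0; exists s.
have s2 j : sqint mu (s_ j) by apply: sqint_span; case: (sP j).
have sk j : supported k (s_ j) by case: (sP j).
have fs2 j : sqint mu (fun x => s_ j x - f x) by exact: sqintB.
have fsk j : supported k (fun x => s_ j x - f x).
  by move=> x xk; rewrite fk// sk// subr0.
have sF2 j : sqint mu (FT (s_ j)) by exact: sqint_FT (sk j).
have bnd j : ip mu (fun x => s_ j x - f x) (fun x => s_ j x - f x) <= j.+1%:R^-1.
  have [_ _] := sP j; rewrite -nsqN (eq_nsq mu (g := fun x => s_ j x - f x)).
    by rewrite nsq_ip// lee_fin.
  by move=> x; ring.
have c0 : (fun j : nat => (0 : R)%:E) @ \oo --> (0 : R)%:E by exact: cvg_cst.
have c1 : (fun j => nsq mu (fun x => s_ j x - f x)) @ \oo --> 0%E.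
  apply: (squeeze_cvge (f := fun=> 0%E) (h := fun j => (j.+1%:R^-1)%:E)) => //.
    by apply: nearW => j; rewrite nsq_ge0 nsq_ip// lee_fin bnd.
  by apply: cvg_EFin; [exact: nearW|exact: cvg_invS].
have c2 : (fun j => nsq mu (fun xi => FT (s_ j) xi - FT f xi)) @ \oo --> 0%E.
  apply: (squeeze_cvge (f := fun=> 0%E) (h := fun j => (2 * kappa * j.+1%:R^-1)%:E)) => //.
    apply: nearW => j; rewrite nsq_ge0/=.
    rewrite (_ : (fun xi => _) = FT (fun x => s_ j x - f x)); last by rewrite (FTB (k := k)).
    have h := sqint_FT (fs2 j) (fsk j); rewrite (nsq_ip h) lee_fin.
    apply: le_trans (FT_nsq_le2 (fs2 j) (fsk j)) _.
    by rewrite ler_pM2l ?mulr_gt0.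
  apply: cvg_EFin; first exact: nearW.
  by rewrite -[X in _ --> X](mulr0 (2 * kappa)); apply: cvgMr; exact: cvg_invS.
have d1 := cvg_ip s2 f2 c1; have d2 := cvg_ip sF2 F2 c2.
have d3 : (fun j => ip mu (FT (s_ j)) (FT (s_ j))) @ \oo --> kappa * ip mu f f.
  rewrite (_ : (fun j => _) = fun j => kappa * ip mu (s_ j) (s_ j)); first exact: cvgMr.
  by apply/funext => j; have [ss _ _] := sP j; have [_ _] := span_parseval ss.
exact: (cvg_unique _ d2 d3).
Qed.

End parseval.

(** * The Fourier transform on L^2 *)

Section fourier_pairs.
Context {R : realType} (n : nat).
Local Notation V := 'rV[R]_n.
Local Notation mu := (lebesgue_rV R n).
Local Notation T1 := (measurableTypeR R).
Local Notation kappa := (@kappa R n).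
Implicit Types f g F G : V -> R[i].

Lemma L2normE f : L2norm f = ((nsq mu f) `^ (2^-1))%E.
Proof.
rewrite /L2norm unlock; congr (_ `^ _)%E; apply: eq_integral => x _ /=.
rewrite powR_mulrn ?normr_ge0// real_normK ?num_real//.
by rewrite normc_sq.
Qed.

Lemma L2P f : L2 f <-> sqint mu f.
Proof.
rewrite /L2 L2normE; split => [[m1 m2 h]|[[m1 m2] h]].
  split => //; move: h; case: (nsq mu f) => [r _|h|//]; first exact: ltry.
  by move: h; rewrite poweRyr.
by split; [exact: m1|exact: m2|exact: poweR_lty].
Qed.

Lemma L2norm_lt f (e : R) : 0 < e -> (L2norm f < e%:E)%E = (nsq mu f < (e ^+ 2)%:E)%E.
Proof.
move=> e0; rewrite L2normE; have := nsq_ge0 mu f.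
case: (nsq mu f) => [r|_|//]; last first.
  by rewrite poweRyr// !ltNge !leey.
rewrite lee_fin => r0; rewrite poweR_EFin powR12_sqrt// !lte_fin.
by rewrite -[X in _ < X]ger0_norm ?(ltW e0)// -sqrtr_sqr ltr_sqrt ?exprn_gt0.
Qed.

Lemma L2norm_le f g (K : R) : 0 <= K -> sqint mu g ->
  (nsq mu f <= (K ^+ 2)%:E * nsq mu g)%E -> (L2norm f <= K%:E * L2norm g)%E.
Proof.
move=> K0 g2; rewrite !L2normE (nsq_ip g2); have := nsq_ge0 mu f.
have g0 : 0 <= ip mu g g by apply: Rintegral_ge0 => x _; exact: sq_ge0.
case: (nsq mu f) => [r| |]//=; rewrite -?EFinM lee_fin => r0; rewrite lee_fin => h.
rewrite !powR12_sqrt// -[X in X * _]ger0_norm// -sqrtr_sqr -sqrtrM ?sqr_ge0//.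
by rewrite lee_fin ler_sqrt// mulr_ge0// sqr_ge0.
Qed.

Lemma L2norm_cvg0 (f_ : nat -> V -> R[i]) : (forall k, sqint mu (f_ k)) ->
  (fun k => L2norm (f_ k)) @ \oo --> 0%E <->
  (fun k => ip mu (f_ k) (f_ k)) @ \oo --> (0 : R).
Proof.
move=> f2; have i0 k : 0 <= ip mu (f_ k) (f_ k).
  by apply: Rintegral_ge0 => x _; exact: sq_ge0.
have E k (e : R) : 0 < e -> (L2norm (f_ k) < e%:E)%E = (ip mu (f_ k) (f_ k) < e ^+ 2).
  by move=> e0; rewrite L2norm_lt// nsq_ip// lte_fin.
split => [c|/cvgrPdist_lt c].
  apply/cvgrPdist_lt => e e0.
  have s0 : 0 < Num.sqrt e by rewrite sqrtr_gt0.
  have : \forall k \near \oo, (L2norm (f_ k) < (Num.sqrt e)%:E)%E.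
    have s0' : (0 < (Num.sqrt e)%:E)%E by rewrite lte_fin.
    by apply: (c [set y | (y < (Num.sqrt e)%:E)%E]); exact: lt_nbhsl.
  apply: filterS => k; rewrite E// sqr_sqrtr ?(ltW e0)// => h.
  by rewrite sub0r normrN ger0_norm.
apply/fine_cvgP; split.
  apply: nearW => k; rewrite ge0_fin_numE ?Lnorm_ge0//.
  by have /L2P[] := f2 k.
apply/cvgrPdist_lt => e e0; have := c _ (exprn_gt0 2 e0); apply: filterS => k.
rewrite !sub0r !normrN (ger0_norm (i0 k)) -E// => h.
have l0 : (0 <= L2norm (f_ k))%E by exact: Lnorm_ge0.
move: l0 h; rewrite /=; case: (L2norm (f_ k)) => [r| |]//=.
by rewrite lee_fin lte_fin => r0; rewrite ger0_norm.
Qed.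

Lemma normr_coord_le (x : V) i : `|x ord0 i| <= enorm x.
Proof.
rewrite /enorm -sqrtr_sqr ler_sqrt ?sqr_ge0// /dot.
  by rewrite (bigD1 i)//= -expr2 lerDl sumr_ge0// => j _; rewrite -expr2 sqr_ge0.
by rewrite sumr_ge0// => j _; rewrite -expr2 sqr_ge0.
Qed.

Lemma measurable_enorm : measurable_fun setT (@enorm R n : V -> T1).
Proof.
apply: (measurableT_comp (continuous_measurable_fun (@sqrt_continuous R))).
rewrite /dot; apply: measurable_sum => i.
by apply: measurable_funM; exact: measurable_coord.
Qed.

Lemma eball0E (r : R) : eball (0 : V) r = [set y | enorm y < r].
Proof. by apply/seteqP; split => y; rewrite /eball /= subr0. Qed.

Lemma measurable_eball0 (r : R) : measurable (eball (0 : V) r).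
Proof.
rewrite eball0E (_ : [set y | _] = @enorm R n @^-1` `]-oo, r[%classic).
  rewrite -[X in measurable X]setTI.
  exact: (measurable_enorm measurableT (measurable_itv `]-oo, r[)).
by apply/seteqP; split => y; rewrite /= in_itv.
Qed.

Lemma eball_cube k : eball (0 : V) k%:R `<=` cube k.
Proof.
move=> x; rewrite eball0E /= => xk i; rewrite in_itv/=.
have := le_lt_trans (normr_coord_le x i) xk.
by rewrite ltr_norml => /andP[-> /ltW ->].
Qed.

(** The truncation by which [fourier] is defined. A cut function is supported in a cube, so its
    transform is an absolutely convergent integral. *)
Definition cut (k : nat) f : V -> R[i] :=
  fun x => (\1_(eball (0 : V) k%:R) x : R)%:C * f x.

Lemma cut_in k f x : eball (0 : V) k%:R x -> cut k f x = f x.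
Proof. by move=> xk; rewrite /cut indicE mem_set// mul1r. Qed.

Lemma cut_out k f x : ~ eball (0 : V) k%:R x -> cut k f x = 0.
Proof. by move=> xk; rewrite /cut indicE memNset// mul0r. Qed.

Lemma sq_cut k f x : sq (cut k f x) <= sq (f x).
Proof.
have [xk|xk] := pselect (eball (0 : V) k%:R x); first by rewrite cut_in.
by rewrite cut_out// sqE /= expr0n addr0 sq_ge0.
Qed.

Lemma cmeas_cut k f : cmeas f -> cmeas (cut k f).
Proof.
move=> mf; apply: cmeasM => //; apply: cmeas_real; apply: measurable_indic.
exact: measurable_eball0.
Qed.

Lemma sqint_cut k f : sqint mu f -> sqint mu (cut k f).
Proof.
move=> f2; apply: (@sqint_le _ _ _ mu 1 _ f) => //.
  by apply: cmeas_cut; case: f2.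
by move=> x; rewrite mul1r sq_cut.
Qed.

Lemma supported_cut k f : supported k (cut k f).
Proof. by move=> x xk; rewrite cut_out//; apply: contra_not xk; exact: eball_cube. Qed.

Lemma cut_cvg f : sqint mu f -> (fun k => nsq mu (fun x => cut k f x - f x)) @ \oo --> 0%E.
Proof.
move=> f2; have [mf _] := f2.
apply: (nsq_dominated (g := f)) => //.
- by move=> k; exact: cmeas_cut.
- by move=> k x; exact: sq_cut.
move=> x; apply: cvg_near_cst; exists (Num.truncn (enorm x)).+1 => // k /= xk.
rewrite cut_in ?subrr ?sqE /= ?expr0n ?addr0// eball0E /=.
by apply: lt_le_trans (truncnS_gt _) _; rewrite ler_nat.
Qed.

Definition fourier_error f F (k : nat) : V -> R[i] := fun xi => FT (cut k f) xi - F xi.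

Lemma sqint_fourier_error f F k : sqint mu f -> sqint mu F ->
  sqint mu (fourier_error f F k).
Proof.
move=> f2 F2; apply: sqintB => //; apply: sqint_FT; first exact: sqint_cut.
exact: supported_cut.
Qed.

Lemma fourierP f F : fourier f F <-> [/\ sqint mu f, sqint mu F &
  (fun k => ip mu (fourier_error f F k) (fourier_error f F k)) @ \oo --> (0 : R)].
Proof.
have E k : (fun xi => fourier_integral (eball 0 k%:R) f xi - F xi) = fourier_error f F k.
  by apply/funext => xi; rewrite fourier_integralE.
rewrite /fourier; under eq_fun do rewrite E.
split => [[/L2P f2 /L2P F2 c]|[f2 F2 c]]; split => //; try exact/L2P.
  by move/L2norm_cvg0 : c; apply => k; exact: sqint_fourier_error.
by apply/L2norm_cvg0 => // k; exact: sqint_fourier_error.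
Qed.

(** Parseval's identity for the truncations of f, in the limit: they converge to f, and their
    transforms to F by definition of [fourier]. *)
Theorem plancherel f F : fourier f F -> ip mu F F = kappa * ip mu f f.
Proof.
move=> /fourierP[f2 F2 c].
have cf2 k : sqint mu (cut k f) by exact: sqint_cut.
have cF2 k : sqint mu (FT (cut k f)) by apply: sqint_FT (cf2 k) _; exact: supported_cut.
have c1 := cvg_ip cf2 f2 (cut_cvg f2).
have c2 : (fun k => ip mu (FT (cut k f)) (FT (cut k f))) @ \oo --> ip mu F F.
  apply: cvg_ip => //.
  rewrite (_ : (fun k => _) = fun k => (ip mu (fourier_error f F k) (fourier_error f F k))%:E).
    by apply: cvg_EFin => //; exact: nearW.
  by apply/funext => k; rewrite -nsq_ip//; exact: sqint_fourier_error.
have c3 : (fun k => ip mu (FT (cut k f)) (FT (cut k f))) @ \oo --> kappa * ip mu f f.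
  rewrite (_ : (fun k => _) = fun k => kappa * ip mu (cut k f) (cut k f)).
    exact: cvgMr.
  apply/funext => k; apply: (parseval_supported (k := k)) => //.
  exact: supported_cut.
exact: (cvg_unique _ c2 c3).
Qed.

Lemma ip_ge0 f : 0 <= ip mu f f.
Proof. by apply: Rintegral_ge0 => x _; exact: sq_ge0. Qed.

Lemma ipD_le f g : sqint mu f -> sqint mu g ->
  ip mu (fun x => f x + g x) (fun x => f x + g x) <= 2 * ip mu f f + 2 * ip mu g g.
Proof.
move=> f2 g2; have [mf _] := f2; have [mg _] := g2.
have := nsqD_le mu mf mg; have fg := sqintD f2 g2.
by rewrite (nsq_ip fg) (nsq_ip f2) (nsq_ip g2).
Qed.

Lemma ipZ_sq c f : sqint mu f ->
  ip mu (fun x => c * f x) (fun x => c * f x) = sq c * ip mu f f.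
Proof.
move=> f2; have [mf _] := f2; have cf := sqintZ c f2.
by have := nsqZ mu c mf; rewrite (nsq_ip cf) (nsq_ip f2) => -[].
Qed.

Lemma fourierD f g F G : fourier f F -> fourier g G ->
  fourier (fun x => f x + g x) (fun xi => F xi + G xi).
Proof.
move=> /fourierP[f2 F2 cf] /fourierP[g2 G2 cg]; apply/fourierP; split.
- exact: sqintD.
- exact: sqintD.
have E k : fourier_error (fun x => f x + g x) (fun xi => F xi + G xi) k =
    fun xi => fourier_error f F k xi + fourier_error g G k xi.
  apply/funext => xi; rewrite /fourier_error.
  have -> : cut k (fun x => f x + g x) = fun x => cut k f x + cut k g x.
    by apply/funext => x; rewrite /cut mulrDr.
  rewrite (@FTD _ _ _ _ k k); first by ring.
  - exact: sqint_cut.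
  - exact: sqint_cut.
  - exact: supported_cut.
  - exact: supported_cut.
apply: (squeeze_cvgr (f := fun=> 0)
  (h := fun k => 2 * ip mu (fourier_error f F k) (fourier_error f F k) +
                 2 * ip mu (fourier_error g G k) (fourier_error g G k))).
- apply: nearW => k; rewrite ip_ge0 E ipD_le//; exact: sqint_fourier_error.
- exact: cvg_cst.
- rewrite -[X in _ --> X]addr0 -[X in _ --> X + _](mulr0 2) -[X in _ --> _ + X](mulr0 2).
  by apply: cvgD; exact: cvgMr.
Qed.

Lemma fourierZ c f F : fourier f F ->
  fourier (fun x => c * f x) (fun xi => c * F xi).
Proof.
move=> /fourierP[f2 F2 cf]; apply/fourierP; split.
- exact: sqintZ.
- exact: sqintZ.
rewrite (_ : (fun k => _) =
    fun k => sq c * ip mu (fourier_error f F k) (fourier_error f F k)).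
  by rewrite -[X in _ --> X](mulr0 (sq c)); exact: cvgMr.
apply/funext => k; rewrite -ipZ_sq; last exact: sqint_fourier_error.
rewrite (_ : fourier_error _ _ k = fun xi => c * fourier_error f F k xi)//.
apply/funext => xi; rewrite /fourier_error.
have -> : cut k (fun x => c * f x) = fun x => c * cut k f x.
  by apply/funext => x; rewrite /cut mulrCA.
rewrite (@FTZ _ _ _ _ k); first by rewrite mulrBr.
- exact: sqint_cut.
- exact: supported_cut.
Qed.

Lemma dotBr (x y z : V) : dot x (y - z) = dot x y - dot x z.
Proof.
by rewrite /dot -sumrB; apply: eq_bigr => i _; rewrite !mxE mulrBr.
Qed.

Lemma sqint_modulation (t : V) f : sqint mu f ->
  sqint mu (fun x => cker (- dot x t) * f x).
Proof.
move=> f2; apply: (@sqint_le _ _ _ mu 1 _ f) => //; last first.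
  by move=> x; rewrite sqM sq_cker.
apply: cmeasM; last by case: f2.
by apply: cmeas_cker; apply: measurable_funN; exact: measurable_dotr.
Qed.

Lemma cmeas_translation (t : V) f : cmeas f -> cmeas (fun x : V => f (x - t)).
Proof. by apply: cmeas_comp; exact: measurable_translation. Qed.

Lemma sqint_translation (t : V) f : sqint mu f -> sqint mu (fun x => f (x - t)).
Proof.
move=> [mf f2]; split; first exact: cmeas_translation.
by rewrite nsq_translation.
Qed.

Lemma ip_translation (t : V) f : sqint mu f ->
  ip mu (fun x => f (x - t)) (fun x => f (x - t)) = ip mu f f.
Proof.
move=> f2; have [mf _] := f2; have := nsq_translation (- t) mf.
by rewrite (nsq_ip (sqint_translation t f2)) (nsq_ip f2) => -[].
Qed.

(** Multiplication by a character commutes with truncation, so each error is exactly a translate of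
    the original one and has the same norm. *)
Lemma fourier_modulation (t : V) f F : fourier f F ->
  fourier (fun x => cker (- dot x t) * f x) (fun xi => F (xi - t)).
Proof.
move=> /fourierP[f2 F2 cf]; apply/fourierP; split.
- exact: sqint_modulation.
- exact: sqint_translation.
rewrite (_ : (fun k => _) =
    fun k => ip mu (fourier_error f F k) (fourier_error f F k)); first exact: cf.
apply/funext => k; rewrite -[RHS](ip_translation t); last exact: sqint_fourier_error.
rewrite (_ : fourier_error _ _ k = fun xi => fourier_error f F k (xi - t))//.
apply/funext => xi; rewrite /fourier_error; congr (_ - _).
apply: eq_cint => x; rewrite dotBr ckerD /cut; ring.
Qed.

Lemma fourier_FT f k : sqint mu f ->
  (forall x, ~ eball (0 : V) k%:R x -> f x = 0) -> fourier f (FT f).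
Proof.
move=> f2 fk.
have fs : supported k f.
  by move=> x xk; apply: fk; apply: contra_not xk; exact: eball_cube.
have F2 := sqint_FT f2 fs.
apply/fourierP; split => //.
apply: cvg_near_cst; exists k => // l /= kl.
have -> : fourier_error f (FT f) l = fun=> 0.
  apply/funext => xi; rewrite /fourier_error (_ : cut l f = f) ?subrr//.
  apply/funext => x; have [xl|xl] := pselect (eball (0 : V) l%:R x); first by rewrite cut_in.
  rewrite cut_out// fk//; apply: contra_not xl; rewrite !eball0E /= => xk.
  by apply: lt_le_trans xk _; rewrite ler_nat.
exact: ip0l.
Qed.

(** Polarisation; as [ip] is real and symmetric, the norm of the sum suffices. *)
Lemma plancherel_ip f g F G : fourier f F -> fourier g G ->
  ip mu F G = kappa * ip mu f g.
Proof.
move=> fF gG; have [f2 F2 _] := (fourierP f F).1 fF; have [g2 G2 _] := (fourierP g G).1 gG.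
have := plancherel (fourierD fF gG); rewrite !ip_sqD// (plancherel fF) (plancherel gG).
by rewrite (ipC mu G F) (ipC mu g f); lra.
Qed.

End fourier_pairs.

(** * Weak derivatives on the Fourier side *)

Section bumps.
Context {R : realType}.
Implicit Types (b f g : R -> R) (x t K : R).

(** A criterion for functions defined by cases such as [possq], whose two branches meet at 0. *)
Lemma is_derive_quadratic f x d (C : R) :
  (forall h, `|f (h + x) - f x - d * h| <= C * h ^+ 2) -> is_derive x (1 : R) f d.
Proof.
move=> fC.
have c : (fun h : R => h^-1 *: ((f \o shift x) (h *: (1 : R)) - f x)) @ (0 : R)^' --> d.
  apply/cvgrPdist_le => e e0.
  have C0 : 0 <= `|C| by [].
  near=> h.
  have h0 : h != 0 by near: h; exact: nbhs_dnbhs_neq.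
  have he : `|h| <= e / (1 + `|C|).
    near: h; apply: dnbhs0_le; rewrite divr_gt0// ltr_wpDr//.
  rewrite /= /shift /= [h *: 1]mulr1.
  have -> : d - h^-1 *: (f (h + x) - f x) = - (h^-1 * (f (h + x) - f x - d * h)).
    by rewrite /GRing.scale /=; field.
  rewrite normrN normrM normfV ler_pdivrMl ?normr_gt0//.
  apply: le_trans (fC h) _.
  apply: (@le_trans _ _ (`|C| * `|h| ^+ 2)).
    by rewrite real_normK ?num_real// ler_wpM2r ?sqr_ge0// ler_norm.
  rewrite expr2 mulrA mulrC ler_wpM2l//.
  apply: (@le_trans _ _ (`|C| * (e / (1 + `|C|)))); first by rewrite ler_wpM2l.
  rewrite mulrCA ler_piMr ?(ltW e0)// ler_pdivrMr ?ltr_wpDr// mul1r lerDr.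
  exact: ler01.
apply: DeriveDef; first by apply/cvg_ex; exists d.
exact: cvg_lim c.
Unshelve. all: by end_near. Qed.

Definition possq x : R := (Num.max x 0) ^+ 2.

Lemma is_derive_possq x : is_derive x (1 : R) possq (2 * Num.max x 0).
Proof.
apply: (@is_derive_quadratic _ _ _ 1) => h; rewrite mul1r /possq.
rewrite ler_norml; case: (leP x 0) => x0; case: (leP (h + x) 0) => hx; apply/andP; split; nra.
Qed.

Lemma continuous_is_derive f g : (forall x, is_derive x (1 : R) f (g x)) -> continuous f.
Proof.
move=> df x; apply: differentiable_continuous; apply/derivable1_diffP.
exact: (@ex_derive _ _ _ _ _ _ _ (df x)).
Qed.

Lemma continuous_max0 : continuous (fun x => Num.max x 0).
Proof. by move=> x; apply: continuous_max; [exact: cvg_id|exact: cvg_cst]. Qed.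

(** C^1 is the regularity demanded by [test_function]. The interval is open so that b and b' also
    vanish at K and -K, as integration by parts will need. *)
Definition is_bump b b' K := [/\ forall x, is_derive x (1 : R) b (b' x), continuous b' &
  forall x, x \notin `]-K, K[ -> b x = 0 /\ b' x = 0].

Lemma bump_continuous b b' K : is_bump b b' K -> continuous b.
Proof. by move=> [db _ _]; exact: continuous_is_derive db. Qed.

(* For M -> oo the plateau functions tend to the indicator of ]a, c[. *)
Definition plat (a c M x : R) : R :=
  1 - (1 + M * (possq (x - a) * possq (c - x)))^-1.

Definition plat' (a c M x : R) : R :=
  M * (2 * Num.max (x - a) 0 * possq (c - x) - possq (x - a) * (2 * Num.max (c - x) 0)) *
  (1 + M * (possq (x - a) * possq (c - x))) ^- 2.

Lemma plat_den_gt0 a c M x : 0 <= M -> 0 < 1 + M * (possq (x - a) * possq (c - x)).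
Proof. by move=> M0; rewrite ltr_wpDr// mulr_ge0// mulr_ge0// sqr_ge0. Qed.

Lemma plat_ge0 a c M x : 0 <= M -> 0 <= plat a c M x.
Proof.
move=> M0; rewrite subr_ge0 invf_le1 ?plat_den_gt0// lerDl.
by rewrite mulr_ge0// mulr_ge0// sqr_ge0.
Qed.

Lemma plat_le1 a c M x : 0 <= M -> plat a c M x <= 1.
Proof. by move=> M0; rewrite gerBl invr_ge0 ltW// plat_den_gt0. Qed.

Lemma plat_out a c M x : x <= a \/ c <= x -> plat a c M x = 0 /\ plat' a c M x = 0.
Proof.
rewrite /plat /plat' /possq => -[xa|xc].
  have -> : Num.max (x - a) 0 = 0 by apply/max_idPr; rewrite subr_le0.
  by rewrite expr0n !(mul0r, mulr0) addr0 invr1 !subrr ?mul0r ?mulr0 ?mul0r.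
have -> : Num.max (c - x) 0 = 0 by apply/max_idPr; rewrite subr_le0.
by rewrite expr0n !(mul0r, mulr0) addr0 invr1 !subrr ?mul0r ?mulr0 ?mul0r.
Qed.

Lemma is_derive_plat a c M x : 0 <= M -> is_derive x (1 : R) (plat a c M) (plat' a c M x).
Proof.
move=> M0.
have d1 : is_derive x (1 : R) (fun y => possq (y - a)) (2 * Num.max (x - a) 0).
  have h : is_derive x (1 : R) (fun y : R => y - a) 1.
    have h := is_deriveB (is_derive_id x (1 : R)) (is_derive_cst a x (1 : R)).
    by apply: (is_derive_eq h); rewrite subr0.
  by apply: (is_derive_eq (is_derive1_comp (is_derive_possq _) h)); rewrite mulr1.
have d2 : is_derive x (1 : R) (fun y => possq (c - y)) (- (2 * Num.max (c - x) 0)).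
  have h : is_derive x (1 : R) (fun y : R => c - y) (-1).
    have h := is_deriveB (is_derive_cst c x (1 : R)) (is_derive_id x (1 : R)).
    by apply: (is_derive_eq h); rewrite sub0r.
  by apply: (is_derive_eq (is_derive1_comp (is_derive_possq _) h)); rewrite mulrN1.
have d3 := is_deriveM d1 d2.
have d4 := is_deriveZ M d3.
have d5 := is_deriveD (is_derive_cst (1 : R) x (1 : R)) d4.
have n0 : (cst (1 : R) +
    M \*: ((fun y : R => possq (y - a)) * (fun y : R => possq (c - y)))) x != 0.
  exact: (lt0r_neq0 (plat_den_gt0 a c x M0)).
have d6 := is_deriveV n0 d5.
have d7 := is_deriveB (is_derive_cst (1 : R) x (1 : R)) d6.
apply: (is_derive_eq d7).
by rewrite /plat' /GRing.scale /= sub0r add0r; ring.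
Qed.

Lemma continuous_plat' a c M : 0 <= M -> continuous (plat' a c M).
Proof.
move=> M0 x; rewrite /plat'.
have cm1 : continuous (fun y => Num.max (y - a) 0).
  move=> y; apply: (continuous_comp (f := fun y => y - a) (g := fun z => Num.max z 0)).
    by apply: cvgB; [exact: cvg_id|exact: cvg_cst].
  exact: continuous_max0.
have cm2 : continuous (fun y => Num.max (c - y) 0).
  move=> y; apply: (continuous_comp (f := fun y => c - y) (g := fun z => Num.max z 0)).
    by apply: cvgB; [exact: cvg_cst|exact: cvg_id].
  exact: continuous_max0.
have cp1 : continuous (fun y => possq (y - a)).
  by move=> y; rewrite /possq; under eq_fun do rewrite expr2; apply: cvgM; exact: cm1.
have cp2 : continuous (fun y => possq (c - y)).
  by move=> y; rewrite /possq; under eq_fun do rewrite expr2; apply: cvgM; exact: cm2.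
have cd : continuous (fun y => 1 + M * (possq (y - a) * possq (c - y))).
  move=> y; apply: cvgD; first exact: cvg_cst.
  by apply: cvgM; [exact: cvg_cst|apply: cvgM; [exact: cp1|exact: cp2]].
apply: cvgM.
  apply: cvgM; first exact: cvg_cst.
  apply: cvgB; apply: cvgM; [| exact: cp2| exact: cp1|].
    by apply: cvgM; [exact: cvg_cst|exact: cm1].
  by apply: cvgM; [exact: cvg_cst|exact: cm2].
apply: cvgV.
  by rewrite expf_neq0// gt_eqF// plat_den_gt0.
by under eq_fun do rewrite expr2; apply: cvgM; exact: cd.
Qed.

Lemma plat_bump a c M K : 0 <= M -> - K <= a -> c <= K ->
  is_bump (plat a c M) (plat' a c M) K.
Proof.
move=> M0 Ka cK; split.
- by move=> x; exact: is_derive_plat.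
- exact: continuous_plat'.
move=> x; rewrite in_itv/= negb_and -!leNgt => /orP[xK|Kx]; apply: plat_out.
  by left; exact: le_trans xK Ka.
by right; exact: le_trans cK Kx.
Qed.

(** The right end is pushed out by 1 / (k+1) so that the limit is 1 at c as well. On ]a, c] the
    factor [possq] from the right is then at least (k+1)^-2, and the weight (k+1)^3 outgrows its
    inverse, leaving an error of order 1 / (k+1). *)
Lemma plat_cvg (a c x : R) : (fun k : nat => plat a (c + k.+1%:R^-1) (k.+1%:R ^+ 3) x) @ \oo -->
  (\1_(`]a, c]%classic : set R) x : R).
Proof.
rewrite indicE; have [xac|xac] := boolP (x \in `]a, c]); last first.
  rewrite memNset; last by apply/negP.
  move: xac; rewrite in_itv/= negb_and -leNgt -ltNge => /orP[xa|cx].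
    apply: cvg_near_cst; apply: nearW => k.
    by have [-> _] := @plat_out a (c + k.+1%:R^-1) (k.+1%:R ^+ 3) x (or_introl xa).
  apply: cvg_near_cst.
  have e0 : 0 < x - c by rewrite subr_gt0.
  have := near_infty_natSinv_lt (PosNum e0); apply: filterS => k /= hk.
  have hk' : k.+1%:R^-1 < x - c := hk.
  have xc : c + k.+1%:R^-1 <= x by rewrite -lerBrDl ltW.
  by have [-> _] := @plat_out a (c + k.+1%:R^-1) (k.+1%:R ^+ 3) x (or_intror xc).
rewrite mem_set//; move: xac; rewrite in_itv/= => /andP[ax xc].
pose p := possq (x - a).
have p0 : 0 < p by rewrite /p /possq exprn_gt0// lt_max subr_gt0 ax.
have B k : 1 - plat a (c + k.+1%:R^-1) (k.+1%:R ^+ 3) x <= p^-1 * k.+1%:R^-1.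
  rewrite /plat opprB addrCA subrr addr0 -invfM lef_pV2 ?posrE; last 2 first.
  - by apply: plat_den_gt0; rewrite exprn_ge0.
  - by rewrite mulr_gt0.
  have k0 : 0 < k.+1%:R :> R by [].
  have h : (k.+1%:R^-1) ^+ 2 <= possq (c + k.+1%:R^-1 - x).
    rewrite /possq lerXn2r ?nnegrE ?invr_ge0// le_max; last first.
    - by apply/orP; left; rewrite addrAC lerDr subr_ge0.
    - by rewrite lexx orbT.
  apply: (@le_trans _ _ (k.+1%:R ^+ 3 * (p * (k.+1%:R^-1) ^+ 2))).
    by rewrite le_eqVlt; apply/orP; left; apply/eqP; field; rewrite gt_eqF.
  apply: (@le_trans _ _ (k.+1%:R ^+ 3 * (p * possq (c + k.+1%:R^-1 - x)))); last by rewrite lerDr.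
  by rewrite ler_wpM2l ?exprn_ge0// ler_wpM2l// ltW.
have c0 : (fun k : nat => 1 - p^-1 * k.+1%:R^-1) @ \oo --> (1 : R).
  rewrite -[X in _ --> X]subr0 -[X in _ --> _ - X](mulr0 p^-1).
  by apply: cvgB; [exact: cvg_cst|apply: cvgMr; exact: cvg_harmonic].
have c1 : (fun _ : nat => (1 : R)) @ \oo --> (1 : R) by exact: cvg_cst.
apply: (squeeze_cvgr _ c0 c1); apply: nearW => k.
by rewrite plat_le1 ?exprn_ge0// andbT lerBlDr -lerBlDl.
Qed.

Lemma bumpM b b' K g g' : is_bump b b' K -> (forall x, is_derive x (1 : R) g (g' x)) ->
  continuous g' -> is_bump (fun x => b x * g x) (fun x => b' x * g x + b x * g' x) K.
Proof.
move=> bb dg cg'; have cb := bump_continuous bb; have [db cb' b0] := bb.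
have cg := continuous_is_derive dg.
split.
- move=> x; apply: (is_derive_eq (is_deriveM (db x) (dg x))).
  by rewrite /GRing.scale /=; ring.
- move=> x; apply: cvgD; apply: cvgM; [exact: cb'|exact: cg|exact: cb|exact: cg'].
- by move=> x /b0[-> ->]; rewrite !mul0r addr0.
Qed.

End bumps.

(** * Products of one-variable bumps *)

Section tensors.
Context {R : realType} (n : nat).
Local Notation V := 'rV[R]_n.
Local Notation mu := (lebesgue_rV R n).
Local Notation T1 := (measurableTypeR R).
Implicit Types (b : 'I_n -> R -> R) (g : R -> R) (K t : R) (v : V).

Definition tensor b (v : V) : R := \prod_(i < n) b i (v ord0 i).

Definition upd b (j : 'I_n) (g : R -> R) : 'I_n -> R -> R :=
  fun i => if i == j then g else b i.

Lemma tensor_upd b j g v : tensor (upd b j g) v =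
  g (v ord0 j) * \prod_(i < n | i != j) b i (v ord0 i).
Proof.
rewrite /tensor (bigD1 j)//= /upd eqxx; congr (_ * _).
by apply: eq_bigr => i /negbTE ->.
Qed.

(** Along the j-th axis the other factors are constant, so the difference quotient is that of a
    multiple of [b j]. *)
Lemma is_derive_tensor b j (g' : R) v : is_derive (v ord0 j) (1 : R) (b j) g' ->
  is_derive v (basis_vector j) (tensor b)
    (g' * \prod_(i < n | i != j) b i (v ord0 i)).
Proof.
move=> db; pose P := \prod_(i < n | i != j) b i (v ord0 i).
have E h : tensor b (h *: basis_vector j + v) = b j (h + v ord0 j) * P.
  rewrite /tensor (bigD1 j)//= !mxE !eqxx /= mulr1; congr (_ * _).
  by apply: eq_bigr => i ij; rewrite !mxE (negbTE ij) andbF /= mulr0 add0r.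
have E0 : tensor b v = b j (v ord0 j) * P by rewrite /tensor (bigD1 j).
have [D1 D2] := is_deriveZ P db.
have Q : (fun h : R => h^-1 *: ((tensor b \o shift v) (h *: basis_vector j) - tensor b v)) =
    (fun h : R => h^-1 *:
      (((P \*: b j) \o shift (v ord0 j)) (h *: (1 : R)) - (P \*: b j) (v ord0 j))).
  apply/funext => h; rewrite /= /shift /= E E0 [h *: 1]mulr1 /GRing.scale /=; ring.
apply: DeriveDef; first by rewrite /derivable Q; exact: D1.
by rewrite /derive Q [LHS]D2 mulrC.
Qed.

Lemma D_tensor b (b' : 'I_n -> R -> R) j : (forall x, is_derive x (1 : R) (b j) (b' j x)) ->
  'D_(basis_vector j) (tensor b) = tensor (upd b j (b' j)).
Proof.
move=> db; apply/funext => v; rewrite tensor_upd.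
exact: (@derive_val _ _ _ _ _ _ _ (is_derive_tensor (db (v ord0 j)))).
Qed.

Lemma continuous_tensor b : (forall i, continuous (b i)) -> continuous (tensor b).
Proof.
move=> cb; rewrite /tensor; elim: (index_enum _) => [|i s IH] v.
  rewrite (_ : (fun v0 : V => _) = cst 1); first exact: cst_continuous.
  by apply/funext => w; rewrite big_nil.
rewrite (_ : (fun v0 : V => _) =
  fun w : V => b i (w ord0 i) * \prod_(i0 <- s) b i0 (w ord0 i0)); last first.
  by apply/funext => w; rewrite big_cons.
have cc : {for v, continuous (fun w : V => b i (w ord0 i))}.
  apply: (@continuous_comp _ _ _ (fun w : V => w ord0 i) (b i)); last exact: cb.
  exact: coord_continuous.
exact: (continuousM cc (IH v)).
Qed.

Lemma continuous_upd b j g : (forall i, continuous (b i)) -> continuous g ->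
  forall i, continuous (upd b j g i).
Proof. by move=> cb cg i; rewrite /upd; case: ifP. Qed.

Lemma tensor_test b b' K : (forall i, is_bump (b i) (b' i) K) -> test_function (tensor b).
Proof.
move=> bb; split.
- pose A := [set v : V | forall i, `[-K, K]%classic (v ord0 i)].
  have cA : compact A.
    by apply: (@rV_compact _ n (fun=> `[-K, K]%classic)) => i; exact: segment_compact.
  apply: (@subclosed_compact _ (closure [set x | tensor b x != 0]) A) => //.
    exact: closed_closure.
  have clA : closed A by apply: compact_closed => //; exact: norm_hausdorff.
  rewrite [X in _ `<=` X](closure_id A).1//; apply: closureS => v /= vb i /=.
  apply: contrapT => vi; move/eqP : vb; apply.
  rewrite /tensor (bigD1 i)//=; have [_ _ b0] := bb i.
  have vK : v ord0 i \notin `]-K, K[.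
    by apply/negP => h; apply: vi; move: h; rewrite !in_itv/= => /andP[/ltW -> /ltW ->].
  by have [-> _] := b0 _ vK; rewrite mul0r.
- move=> j v; have [db _ _] := bb j.
  exact: (@ex_derive _ _ _ _ _ _ _ (is_derive_tensor (db (v ord0 j)))).
- move=> j; have [db cb' _] := bb j; rewrite (D_tensor db).
  apply: continuous_tensor; apply: continuous_upd => // i.
  exact: bump_continuous (bb i).
Qed.

Lemma cmeas_ctensor b : (forall i, continuous (b i)) ->
  cmeas (fun v : V => (tensor b v)%:C).
Proof.
move=> cb; rewrite (_ : (fun v : V => _) = fun v : V => \prod_(i < n) (b i (v ord0 i))%:C).
  apply: (@cmeas_prod_coord R n (fun i x => (b i x)%:C)) => i; apply: cmeas_real.
  exact: continuous_measurable_fun.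
by apply/funext => v; rewrite /tensor rmorph_prod.
Qed.

Lemma bump_integrable g K (c : R -> R) : continuous g -> (forall x, x \notin `]-K, K[ -> g x = 0) ->
  continuous c ->
  lebesgue_measure.-integrable setT (EFin \o (fun x => c x * g x) : T1 -> \bar R) /\
  \int[lebesgue_measure]_x (c x * g x) = \int[lebesgue_measure]_(x in `[-K, K]) (c x * g x).
Proof.
move=> cg g0 cc.
have cgc : continuous (fun x => c x * g x) by move=> x; apply: cvgM; [exact: cc|exact: cg].
have i1 : lebesgue_measure.-integrable `[-K, K] (EFin \o (fun x => c x * g x)).
  apply: continuous_compact_integrable; first exact: segment_compact.
  exact: continuous_subspaceT.
have E : (fun x => c x * g x) = (fun x => c x * g x) \_ `[-K, K].
  apply/funext => x; rewrite patchE; case: ifPn => // /negP xK.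
  rewrite g0 ?mulr0//; apply/negP => xKo; apply: xK; rewrite inE /=.
  by move: xKo; rewrite !in_itv/= => /andP[/ltW -> /ltW ->].
split; last by rewrite {1}E -Rintegral_mkcond.
rewrite E -restrict_EFin; apply/integrable_restrict => //; rewrite ?setTI//.
Qed.

Lemma cintegrable_bump g K t : continuous g -> (forall x, x \notin `]-K, K[ -> g x = 0) ->
  cintegrable lebesgue_measure (fun x : T1 => cker (x * t) * (g x)%:C).
Proof.
move=> cg g0; have cs := @continuous_sinM R t; have cc := @continuous_cosM R t.
split.
  have [h _] := bump_integrable cg g0 cc.
  by under [X in EFin \o X]eq_fun do rewrite cReM /= mulr0 subr0.
have cs' : continuous (fun x : R => - sin (x * t)).
  by move=> x; apply: cvgN; exact: cs.
have [h _] := bump_integrable cg g0 cs'.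
by under [X in EFin \o X]eq_fun do rewrite cImM /= mulr0 add0r.
Qed.

Lemma fourier1_derive g g' K t : 0 < K -> is_bump g g' K ->
  fourier1 (fun x => (g' x)%:C) t = (0 +i* t) * fourier1 (fun x => (g x)%:C) t.
Proof.
move=> K0 bb; have cg := bump_continuous bb; have [dg cg' g0] := bb.
have cs := @continuous_sinM R t; have cc := @continuous_cosM R t.
have g0' x : x \notin `]-K, K[ -> g x = 0 by move=> /g0[].
have g0'' x : x \notin `]-K, K[ -> g' x = 0 by move=> /g0[].
have NKK : - K < K by lra.
(* These remove the boundary terms of the integration by parts: K and -K lie outside the open
   interval. *)
have gK : g K = 0 by apply: g0'; rewrite in_itv/= ltxx andbF.
have gNK : g (- K) = 0 by apply: g0'; rewrite in_itv/= ltxx.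
have ibp (F f : R -> R) : (forall x : R, is_derive x (1 : R) F (f x)) -> continuous f ->
    \int[lebesgue_measure]_x (F x * g' x) = - \int[lebesgue_measure]_x (f x * g x).
  move=> dF cf; have cF := continuous_is_derive dF.
  have [_ ->] := bump_integrable cg' g0'' cF; have [_ ->] := bump_integrable cg g0' cf.
  rewrite (@Rintegration_by_parts _ F g f g')//.
  - by rewrite gK gNK !mulr0 subrr sub0r.
  - exact: continuous_subspaceT.
  - split.
    + by move=> x _; exact: (@ex_derive _ _ _ _ _ _ _ (dF x)).
    + by apply: cvg_at_right_filter; exact: cF.
    + by apply: cvg_at_left_filter; exact: cF.
  - by move=> x _; rewrite derive1E; exact: (@derive_val _ _ _ _ _ _ _ (dF x)).
  - exact: continuous_subspaceT.
  - split.
    + by move=> x _; exact: (@ex_derive _ _ _ _ _ _ _ (dg x)).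
    + by apply: cvg_at_right_filter; exact: cg.
    + by apply: cvg_at_left_filter; exact: cg.
  - by move=> x _; rewrite derive1E; exact: (@derive_val _ _ _ _ _ _ _ (dg x)).
have h1 := ibp _ _ (is_derive_cosM t).
have h2 := ibp _ _ (is_derive_sinM t).
have cN (h : R -> R) : continuous h -> continuous (fun x => h x * t).
  by move=> ch x; apply: cvgM; [exact: ch|exact: cvg_cst].
have [is_ _] := bump_integrable cg g0' cs.
have [ic_ _] := bump_integrable cg g0' cc.
have [is'_ _] := bump_integrable cg' g0'' cs.
apply: complex_ext; rewrite ?cReM ?cImM /= ?mul0r ?add0r ?sub0r ?addr0.
- under eq_Rintegral do rewrite mulr0 subr0.
  rewrite h1; last by apply: cN => x; apply: cvgN; exact: cs.
  under [in RHS]eq_Rintegral do rewrite mulr0 add0r.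
  rewrite -RintegralZl//; last first.
    have [h _] := bump_integrable cg g0' (fun x => cvgN (cs x)); exact: h.
  by congr (- _); apply: eq_Rintegral => x _; ring.
- under eq_Rintegral do rewrite mulr0 add0r.
  under [in RHS]eq_Rintegral do rewrite mulr0 subr0.
  rewrite -RintegralZl//.
  have -> : \int[lebesgue_measure]_x (- sin (x * t) * g' x) =
      - \int[lebesgue_measure]_x (sin (x * t) * g' x).
    rewrite -[RHS]mulN1r -RintegralZl//.
    by apply: eq_Rintegral => x _; ring.
  rewrite h2; last exact: cN.
  by rewrite opprK; apply: eq_Rintegral => x _; ring.
Qed.

Lemma FT_tensor b K : (forall i, continuous (b i)) ->
  (forall i x, x \notin `]-K, K[ -> b i x = 0) -> forall xi,
  FT (fun v => (tensor b v)%:C) xi =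
    \prod_(i < n) fourier1 (fun x => (b i x)%:C) (xi ord0 i).
Proof.
move=> cb b0 xi; rewrite -(FT_prod (f := fun i x => (b i x)%:C)).
  by congr (FT _ _); apply/funext => v; rewrite /tensor rmorph_prod.
by move=> i; apply: cintegrable_bump => //; exact: b0.
Qed.

Lemma FT_D_tensor b b' K j xi : 0 < K -> (forall i, is_bump (b i) (b' i) K) ->
  FT (fun v => (tensor (upd b j (b' j)) v)%:C) xi =
  (0 +i* xi ord0 j) * FT (fun v => (tensor b v)%:C) xi.
Proof.
move=> K0 bb.
have cb i : continuous (b i) by exact: bump_continuous (bb i).
have b0 i x : x \notin `]-K, K[ -> b i x = 0 by have [_ _ h] := bb i; move=> /h[].
have [_ cb' b0'] := bb j.
rewrite !(FT_tensor (K := K))//; last 2 first.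
- exact: continuous_upd.
- by move=> i x xK; rewrite /upd; case: ifP => _; [have [] := b0' x xK|exact: b0].
rewrite (bigD1 j)//= [in RHS](bigD1 j)//= mulrA; congr (_ * _).
  by rewrite /upd eqxx; exact: fourier1_derive K0 (bb j).
by apply: eq_bigr => i /negbTE ij; rewrite /upd ij.
Qed.

Lemma tensor_out b K v : (forall i x, x \notin `]-K, K[ -> b i x = 0) ->
  ~ (forall i, v ord0 i \in `]-K, K[) -> tensor b v = 0.
Proof.
move=> b0 /existsNP[i /negP vi]; by rewrite /tensor (bigD1 i)//= b0// mul0r.
Qed.

Lemma tensor_supported b K : (forall i x, x \notin `]-K, K[ -> b i x = 0) ->
  exists k : nat, forall v, ~ eball (0 : V) k%:R v -> tensor b v = 0.
Proof.
move=> b0; exists (Num.truncn (Num.sqrt (n%:R * K ^+ 2))).+1 => v vk.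
apply: (tensor_out b0); apply: contra_not vk => vK; rewrite eball0E /=.
apply: le_lt_trans (truncnS_gt _); rewrite /enorm ler_sqrt; last first.
  by rewrite mulr_ge0// sqr_ge0.
rewrite /dot; apply: (@le_trans _ _ (\sum_(i < n) K ^+ 2)); last first.
  by rewrite sumr_const card_ord mulr_natl.
apply: ler_sum => i _; have := vK i; rewrite in_itv/=; move: (v ord0 i) => t /andP[h1 h2].
have h3 : 0 <= (K - t) * (t + K) by rewrite mulr_ge0//; lra.
by rewrite -subr_ge0 (_ : _ - _ = (K - t) * (t + K))//; ring.
Qed.

Lemma sqint_tensor b K : (forall i, continuous (b i)) ->
  (forall i x, x \notin `]-K, K[ -> b i x = 0) -> sqint mu (fun v => (tensor b v)%:C).
Proof.
move=> cb b0; split; first exact: cmeas_ctensor.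
have intf i : cintegrable lebesgue_measure (fun x : T1 => (b i x * b i x)%:C).
  have [h _] := bump_integrable (cb i) (b0 i) (cb i).
  by split => //=; exact: (integrable0 lebesgue_measure).
have [[i1 _] _] := cint_prod_coord intf.
have := integrable_lty measurableT i1; congr (_ < _)%E; apply: eq_integral => v _.
rewrite sq_real /= /tensor -rmorph_prod /= expr2; congr EFin.
by rewrite -big_split.
Qed.

End tensors.

(** * Weak derivatives bounded by duality *)

Section weak_derivatives.
Context {R : realType} (n : nat).
Local Notation V := 'rV[R]_n.
Local Notation mu := (lebesgue_rV R n).
Local Notation T1 := (measurableTypeR R).
Local Notation kappa := (@kappa R n).
Implicit Types (b : 'I_n -> R -> R) (u g v h : V -> R[i]) (K : R).

(* [weak_partial] tested only against the products of bumps
   x |-> \prod_i b_i(x_i); these already determine the weak derivative. *)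
Definition weakT (j : 'I_n) u g := forall b b' K, 0 < K ->
  (forall i, is_bump (b i) (b' i) K) ->
  cint mu (fun x => (tensor (upd b j (b' j)) x)%:C * u x) =
  - cint mu (fun x => (tensor b x)%:C * g x).

Lemma weak_partialT j u g : weak_partial j u g -> weakT j u g.
Proof.
move=> wug b b' K K0 bb.
have D : 'D_(basis_vector j) (tensor b) = tensor (upd b j (b' j)).
  by apply: D_tensor => x; have [+ _ _] := bb j; exact.
transitivity (cint mu (fun x => ('D_(basis_vector j) (tensor b) x)%:C * u x)).
  by apply: eq_cint => x; rewrite -D.
exact: wug _ (tensor_test bb).
Qed.

Lemma sqJ (z : R[i]) : sq z^* = sq z.
Proof. by case: z => a c; rewrite !sqE /= sqrrN. Qed.

Lemma sqintJ u : sqint mu u -> sqint mu (fun x => (u x)^*).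
Proof.
move=> [mu2 u2]; split; first exact: cmeasJ.
by move: u2; congr (_ < _)%E; apply: eq_integral => x _; rewrite sqJ.
Qed.

Lemma cintegrable_mul u v : sqint mu u -> sqint mu v ->
  cintegrable mu (fun x => u x * v x).
Proof.
move=> u2 v2; have vJ := sqintJ v2; have ivJ := sqintZ 'i vJ.
split.
  rewrite (_ : (fun x => Re _) = fun x => rdot (u x) (v x)^*); first exact: integrable_rdot.
  by apply/funext => x; rewrite /rdot; case: (u x) (v x) => ? ? [? ?] /=; ring.
rewrite (_ : (fun x => Im _) = fun x => rdot (u x) ('i * (v x)^*)); first exact: integrable_rdot.
by apply/funext => x; rewrite /rdot; case: (u x) (v x) => ? ? [? ?] /=; ring.
Qed.

Lemma cintN (f : V -> R[i]) : cintegrable mu f -> cint mu (fun x => - f x) = - cint mu f.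
Proof.
by move=> fi; rewrite -mulN1r -cintZ//; apply: eq_cint => x; rewrite mulN1r.
Qed.

Section bump_family.
Variables (b b' : 'I_n -> R -> R) (K : R) (j : 'I_n).
Hypothesis K0 : 0 < K.
Hypothesis bb : forall i, is_bump (b i) (b' i) K.

Lemma bump_sqint : sqint mu (fun x => (tensor b x)%:C).
Proof.
apply: (sqint_tensor (K := K)) => [i|i x xK]; first exact: bump_continuous (bb i).
by have [_ _ h] := bb i; have [] := h _ xK.
Qed.

Lemma upd_continuous i : continuous (upd b j (b' j) i).
Proof.
apply: continuous_upd => [k|]; first exact: bump_continuous (bb k).
by have [] := bb j.
Qed.

Lemma upd_out i x : x \notin `]-K, K[ -> upd b j (b' j) i x = 0.
Proof.
move=> xK; rewrite /upd; case: ifP => _.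
  by have [_ _ h] := bb j; have [] := h _ xK.
by have [_ _ h] := bb i; have [] := h _ xK.
Qed.

Lemma upd_sqint : sqint mu (fun x => (tensor (upd b j (b' j)) x)%:C).
Proof. by apply: (sqint_tensor (K := K)); [exact: upd_continuous|exact: upd_out]. Qed.

Lemma fourier_tensor : fourier (fun x => (tensor b x)%:C) (FT (fun x => (tensor b x)%:C)).
Proof.
have b0 i x : x \notin `]-K, K[ -> b i x = 0.
  by have [_ _ h] := bb i; move=> /h[].
have [k bk] := tensor_supported b0.
apply: (fourier_FT (k := k)); first exact: bump_sqint.
by move=> x /bk ->.
Qed.

Lemma fourier_D_tensor : fourier (fun x => (tensor (upd b j (b' j)) x)%:C)
  (fun xi => (0 +i* xi ord0 j) * FT (fun x => (tensor b x)%:C) xi).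
Proof.
have [k bk] := tensor_supported upd_out.
rewrite (_ : (fun xi : V => (0 +i* xi ord0 j) * _) = FT (fun x => (tensor (upd b j (b' j)) x)%:C)).
  apply: (fourier_FT (k := k)); first exact: upd_sqint.
  by move=> x /bk ->.
by apply/funext => xi; rewrite (FT_D_tensor j xi K0 bb).
Qed.

End bump_family.

Lemma weakTB j u g v h : sqint mu u -> sqint mu g -> sqint mu v -> sqint mu h ->
  weakT j u g -> weakT j v h -> weakT j (fun x => u x - v x) (fun x => g x - h x).
Proof.
move=> u2 g2 v2 h2 wu wv b b' K K0 bb.
have t2 := bump_sqint bb; have t2' := upd_sqint j bb.
have E (p q r : V -> R[i]) : sqint mu p -> sqint mu q -> sqint mu r ->
    cint mu (fun x => p x * (q x - r x)) =
    cint mu (fun x => p x * q x) - cint mu (fun x => p x * r x).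
  move=> p2 q2 r2; rewrite -cintN; last exact: cintegrable_mul.
  rewrite -cintD; last 2 first.
  - exact: cintegrable_mul.
  - have := cintegrableZ (-1) (cintegrable_mul p2 r2).
    by apply: eq_cintegrable => x; rewrite mulN1r.
  by apply: eq_cint => x; rewrite mulrBr.
by rewrite !E// (wu _ _ _ K0 bb) (wv _ _ _ K0 bb); ring.
Qed.

(* A bounded function of t that tends to t as s -> 0; multiplication by it is
   a difference of two shifts on the Fourier side. *)
Definition sinc (s t : R) : R := s^-1 * sin (t * s).

Lemma is_derive_sinc (s t : R) : s != 0 -> is_derive t (1 : R) (sinc s) (cos (t * s)).
Proof.
move=> s0; have h := @is_deriveZ R R R^o _ s^-1 t 1 _ (is_derive_sinM s t).
by apply: (is_derive_eq h); rewrite /GRing.scale /=; field.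
Qed.

Lemma normr_sinc_le (s t : R) : 0 < s -> `|sinc s t| <= `|t|.
Proof.
move=> s0; rewrite /sinc normrM ger0_norm ?invr_ge0 ?(ltW s0)// ler_pdivrMl//.
by apply: le_trans (normr_sin_le _) _; rewrite normrM (gtr0_norm s0) mulrC.
Qed.

Lemma measurable_sinc (s : R) i : measurable_fun setT (fun x : V => sinc s (x ord0 i) : T1).
Proof.
apply: (measurableT_comp (f := (sinc s : T1 -> T1))); last exact: measurable_coord.
apply: measurable_funM => //; apply: continuous_measurable_fun.
exact: continuous_sinM.
Qed.

Lemma measurable_cosc (s : R) i :
  measurable_fun setT (fun x : V => cos (x ord0 i * s) : T1).
Proof.
apply: (measurableT_comp (f := (fun t : R => cos (t * s)) : T1 -> T1)); last first.
  exact: measurable_coord.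
by apply: continuous_measurable_fun; exact: continuous_cosM.
Qed.

Lemma sqint_mulr (a : V -> R) (C : R) u : measurable_fun setT a -> (forall x, a x ^+ 2 <= C) ->
  sqint mu u -> sqint mu (fun x => (a x)%:C * u x).
Proof.
move=> ma aC u2; apply: (@sqint_le _ _ _ mu C _ u) => //.
- by apply: cmeasM; [exact: cmeas_real|case: u2].
- exact: le_trans (sqr_ge0 _) (aC 0).
- by move=> x; rewrite sqM sq_real ler_wpM2r// sq_ge0.
Qed.

Lemma sqr_sinc_le (s t : R) : sinc s t ^+ 2 <= s ^- 2.
Proof.
rewrite /sinc exprMn exprVn -[leRHS]mulr1 ler_wpM2l ?invr_ge0 ?sqr_ge0//.
Qed.

Lemma sqr_cos_le1 (t : R) : cos t ^+ 2 <= 1.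
Proof. by have := cos2Dsin2 t; have := sqr_ge0 (sin t); lra. Qed.

(** Leibniz rule: a product of bumps absorbs the factor [sinc] into its i0-th component and remains
    an admissible test function. For j = i0 the derivative of this factor leaves the cosine term. *)
Lemma weakT_sinc j (i0 : 'I_n) (s : R) u g : s != 0 -> sqint mu u -> sqint mu g ->
  weakT j u g ->
  weakT j (fun x => (sinc s (x ord0 i0))%:C * u x)
    (fun x => (sinc s (x ord0 i0))%:C * g x +
       ((j == i0)%:R * cos (x ord0 i0 * s))%:C * u x).
Proof.
move=> s0 u2 g2 wu b b' K K0 bb.
pose c := upd b i0 (fun t => b i0 t * sinc s t).
pose c' := upd b' i0 (fun t => b' i0 t * sinc s t + b i0 t * cos (t * s)).
have cc i : is_bump (c i) (c' i) K.
  rewrite /c /c' /upd; case: eqP => _; last exact: bb.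
  apply: bumpM => //; first by move=> x; exact: is_derive_sinc.
  exact: continuous_cosM.
have cE x : tensor c x = tensor b x * sinc s (x ord0 i0).
  by rewrite /c tensor_upd [in RHS]/tensor [in RHS](bigD1 i0)//=; ring.
have dcE x : tensor (upd c j (c' j)) x =
    tensor (upd b j (b' j)) x * sinc s (x ord0 i0) +
    (j == i0)%:R * (tensor b x * cos (x ord0 i0 * s)).
  rewrite !tensor_upd; have [->|ji] := eqVneq j i0.
    rewrite /c' /upd eqxx [tensor b x](bigD1 i0)//= mul1r.
    have -> : \prod_(i < n | i != i0)
        (if i == i0 then fun t => b i0 t * sinc s t else b i) (x ord0 i)
        = \prod_(i < n | i != i0) b i (x ord0 i).
      by apply: eq_bigr => i /negbTE ->.
    by ring.
  rewrite mul0r addr0 /c' /upd (negbTE ji) -mulrA; congr (_ * _).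
  have i0j : i0 != j by rewrite eq_sym.
  rewrite /c /upd [in LHS](bigD1 i0)//= eqxx [in RHS](bigD1 i0)//=.
  have -> : \prod_(i < n | (i != j) && (i != i0))
      (if i == i0 then fun t => b i0 t * sinc s t else b i) (x ord0 i)
        = \prod_(i < n | (i != j) && (i != i0)) b i (x ord0 i).
    by apply: eq_bigr => i /andP[_ /negbTE ->].
  by ring.
have t2 := bump_sqint bb; have t2' := upd_sqint j bb; have c2' := upd_sqint j cc.
have au : sqint mu (fun x => (sinc s (x ord0 i0))%:C * u x).
  apply: (@sqint_mulr (fun x => sinc s (x ord0 i0)) (s ^- 2)) => //.
    exact: measurable_sinc.
  by move=> x; exact: sqr_sinc_le.
have ag : sqint mu (fun x => (sinc s (x ord0 i0))%:C * g x).
  apply: (@sqint_mulr (fun x => sinc s (x ord0 i0)) (s ^- 2)) => //.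
    exact: measurable_sinc.
  by move=> x; exact: sqr_sinc_le.
have cu : sqint mu (fun x => ((j == i0)%:R * cos (x ord0 i0 * s))%:C * u x).
  apply: (@sqint_mulr (fun x => (j == i0)%:R * cos (x ord0 i0 * s)) 1) => //.
    by apply: measurable_funM => //; exact: measurable_cosc.
  move=> x; rewrite exprMn; case: eqP => _; rewrite ?expr1n ?mul1r ?sqr_cos_le1//.
  by rewrite expr0n mul0r.
have h := wu _ _ _ K0 cc.
have E1 : cint mu (fun x => (tensor (upd c j (c' j)) x)%:C * u x) =
    cint mu (fun x => (tensor (upd b j (b' j)) x)%:C * ((sinc s (x ord0 i0))%:C * u x)) +
    cint mu (fun x => (tensor b x)%:C * (((j == i0)%:R * cos (x ord0 i0 * s))%:C * u x)).
  rewrite -cintD; [|exact: cintegrable_mul|exact: cintegrable_mul].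
  by apply: eq_cint => x; rewrite dcE rmorphD !rmorphM /=; ring.
have E2 : cint mu (fun x => (tensor c x)%:C * g x) =
    cint mu (fun x => (tensor b x)%:C * ((sinc s (x ord0 i0))%:C * g x)).
  by apply: eq_cint => x; rewrite cE rmorphM /=; ring.
have E3 : cint mu (fun x => (tensor b x)%:C * ((sinc s (x ord0 i0))%:C * g x +
       ((j == i0)%:R * cos (x ord0 i0 * s))%:C * u x)) =
    cint mu (fun x => (tensor b x)%:C * ((sinc s (x ord0 i0))%:C * g x)) +
    cint mu (fun x => (tensor b x)%:C * (((j == i0)%:R * cos (x ord0 i0 * s))%:C * u x)).
  rewrite -cintD; [|exact: cintegrable_mul|exact: cintegrable_mul].
  by apply: eq_cint => x; rewrite mulrDr.
rewrite E3; rewrite E1 E2 in h; rewrite opprD -h; ring.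
Qed.

Lemma tensor_plat_cvg (a c : 'I_n -> R) (x : V) :
  (fun k : nat => tensor (fun i => plat (a i) (c i + k.+1%:R^-1) (k.+1%:R ^+ 3)) x) @ \oo -->
  (\1_(box a c) x : R).
Proof.
have -> : (\1_(box a c) x : R) =
    \prod_(i < n) (\1_(`]a i, c i]%classic : set R) (x ord0 i) : R).
  by apply: complexI; rewrite indic_boxE rmorph_prod.
rewrite /tensor; elim: (index_enum _) => [|i s IH].
  by under eq_fun do rewrite big_nil; rewrite big_nil; exact: cvg_cst.
under eq_fun do rewrite big_cons; rewrite big_cons.
by apply: cvgM; [exact: plat_cvg|exact: IH].
Qed.

Lemma tensor_approx (a c : 'I_n -> R) (e : R) : 0 < e -> exists b b' K,
  [/\ 0 < K, forall i, is_bump (b i) (b' i) K &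
  (nsq mu (fun x => (\1_(box a c) x : R)%:C - (tensor b x)%:C)%R <= e%:E)%E].
Proof.
move=> e0; pose M := \sum_i (`|a i| + `|c i|).
pose B (k : nat) i := plat (a i) (c i + k.+1%:R^-1) (k.+1%:R ^+ 3).
pose B' (k : nat) i := plat' (a i) (c i + k.+1%:R^-1) (k.+1%:R ^+ 3).
have k1 (k : nat) : k.+1%:R^-1 <= 1 :> R by rewrite invf_le1// ler1n.
have bB k i : is_bump (B k i) (B' k i) (M + 1).
  have hM : `|a i| + `|c i| <= M.
    by rewrite /M (bigD1 i)//= lerDl sumr_ge0// => l _; rewrite addr_ge0.
  have := ler_norm (c i); have := ler_norm (- a i); rewrite normrN => ha hc.
  have := normr_ge0 (a i); have := normr_ge0 (c i) => h1 h2.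
  apply: plat_bump.
  - by rewrite exprn_ge0.
  - lra.
  - by apply: lerD => //; lra.
have M0 : 0 < M + 1.
  by rewrite ltr_wpDl// sumr_ge0// => l _; rewrite addr_ge0.
have Bt k := bump_sqint (bB k).
(* Since 1 / (k+1) <= 1, the box with its right ends moved by 1 dominates all the plateaus. *)
have bd k x : sq (tensor (B k) x)%:C <= sq (\1_(box a (fun i => c i + 1)) x : R)%:C.
  rewrite !sq_real indicE; have [xb|xb] := pselect (box a (fun i => c i + 1) x).
    rewrite mem_set// expr1n expr_le1//; last first.
      by rewrite prodr_ge0// => i _; rewrite plat_ge0// exprn_ge0.
    rewrite /tensor; apply: prodr_ile1 => i _.
    by rewrite plat_ge0 ?plat_le1 ?exprn_ge0.
  rewrite memNset// expr0n /=; have [i /negP xi] : exists i, ~ (x ord0 i \in `]a i, c i + 1]).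
    exact/existsNP.
  rewrite /tensor (bigD1 i)//=.
  have [-> _] : B k i (x ord0 i) = 0 /\ B' k i (x ord0 i) = 0; last by rewrite mul0r expr0n.
  apply: plat_out; move: xi; rewrite in_itv/= negb_and -leNgt -ltNge => /orP[h|h]; [by left|right].
  by apply: le_trans (ltW h); rewrite lerD2l.
have c0 : (fun k => nsq mu (fun x => (tensor (B k) x)%:C - (\1_(box a c) x : R)%:C)) @ \oo --> 0%E.
  apply: (nsq_dominated (g := fun x => (\1_(box a (fun i => c i + 1)) x : R)%:C)).
  - by move=> k; have [] := Bt k.
  - by have [] := sqint_box (R := R) a c.
  - exact: sqint_box.
  - exact: bd.
  - move=> x; have := cvg_sq_real 1 (@tensor_plat_cvg a c x).
    by under eq_fun do rewrite !mul1r.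
have e0' : (0 < e%:E)%E by rewrite lte_fin.
have [N _ /(_ N (leqnn N)) /= hN] := c0 [set y | (y < e%:E)%E] (lt_nbhsl e0').
exists (B N), (B' N), (M + 1); split => //.
rewrite -nsqN (eq_nsq mu (g := fun x => (tensor (B N) x)%:C - (\1_(box a c) x : R)%:C)).
  exact: ltW.
by move=> x; rewrite opprB.
Qed.

(* The test functions Phi against which the Fourier pair (v, W) and the weak
   derivative h of v can be compared; they are dense in L^2. *)
Definition fourier_adjoint (j : 'I_n) h v (Phi : V -> R[i]) := exists dPhi hPhi,
  [/\ fourier Phi hPhi, fourier dPhi (fun xi => (0 +i* xi ord0 j) * hPhi xi) &
      cint mu (fun x => h x * (Phi x)^*) = - cint mu (fun x => v x * (dPhi x)^*)].

Lemma fourier_sqint (f F : V -> R[i]) : fourier f F -> sqint mu f /\ sqint mu F.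
Proof. by move=> /fourierP[]. Qed.

(** The conditions are linear in Phi up to conjugation, so only indicators of boxes need
    approximating. Products of bumps do that, and [weakT] is their third condition. *)
Lemma fourier_adjoint_dense j h v : sqint mu h -> sqint mu v -> weakT j v h ->
  forall e, 0 < e -> exists2 Phi, fourier_adjoint j h v Phi &
    (nsq mu (fun x => h x - Phi x)%R <= e%:E)%E.
Proof.
move=> h2 v2 wvh; apply: approximable_complex => //.
- move=> f g [df [hf [f1 f2 f3]]] [dg [hg [g1 g2 g3]]].
  exists (fun x => df x + dg x), (fun xi => hf xi + hg xi); split.
  + exact: fourierD.
  + rewrite (_ : (fun xi : V => (0 +i* xi ord0 j) * _) =
        fun xi : V => (0 +i* xi ord0 j) * hf xi + (0 +i* xi ord0 j) * hg xi).
      exact: fourierD.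
    by apply/funext => xi; rewrite mulrDr.
  have E (p q r : V -> R[i]) : sqint mu p -> sqint mu q -> sqint mu r ->
      cint mu (fun x => p x * (q x + r x)^*) =
      cint mu (fun x => p x * (q x)^*) + cint mu (fun x => p x * (r x)^*).
    move=> p2 q2 r2; rewrite -cintD; last 2 first.
    - by apply: cintegrable_mul => //; exact: sqintJ.
    - by apply: cintegrable_mul => //; exact: sqintJ.
    by apply: eq_cint => x; rewrite rmorphD mulrDr.
  have [sf _] := fourier_sqint f1; have [sg _] := fourier_sqint g1.
  have [sdf _] := fourier_sqint f2; have [sdg _] := fourier_sqint g2.
  by rewrite !E// f3 g3 opprD.
- move=> a f [df [hf [f1 f2 f3]]].
  exists (fun x => a * df x), (fun xi => a * hf xi); split.
  + exact: fourierZ.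
  + rewrite (_ : (fun xi : V => (0 +i* xi ord0 j) * _) =
        fun xi : V => a * ((0 +i* xi ord0 j) * hf xi)).
      exact: fourierZ.
    by apply/funext => xi; rewrite mulrCA.
  have E (p q : V -> R[i]) : sqint mu p -> sqint mu q ->
      cint mu (fun x => p x * (a * q x)^*) = a^* * cint mu (fun x => p x * (q x)^*).
    move=> p2 q2; rewrite -cintZ; last by apply: cintegrable_mul => //; exact: sqintJ.
    by apply: eq_cint => x; rewrite rmorphM mulrCA.
  have [sf _] := fourier_sqint f1; have [sdf _] := fourier_sqint f2.
  by rewrite !E// f3 mulrN.
- by move=> f [df [hf [/fourier_sqint[[]]]]].
- move=> a c e e0; have [b [b' [K [K0 bb be]]]] := tensor_approx a c e0.
  exists (fun x => (tensor b x)%:C) => //.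
  exists (fun x => (tensor (upd b j (b' j)) x)%:C), (FT (fun x => (tensor b x)%:C)); split.
  + exact: fourier_tensor bb.
  + exact: fourier_D_tensor K0 bb.
  + have := wvh _ _ _ K0 bb.
    have -> : cint mu (fun x => h x * ((tensor b x)%:C)^*) =
        cint mu (fun x => (tensor b x)%:C * h x).
      by apply: eq_cint => x; rewrite [RHS]mulrC; congr (_ * _); exact: conjc_real.
    have -> : cint mu (fun x => v x * ((tensor (upd b j (b' j)) x)%:C)^*) =
        cint mu (fun x => (tensor (upd b j (b' j)) x)%:C * v x).
      by apply: eq_cint => x; rewrite [RHS]mulrC; congr (_ * _); exact: conjc_real.
    by move=> ->; rewrite opprK.
Qed.

(** Duality: h is paired with a test function Phi close to h, the derivative is moved onto Phi, and
    Plancherel turns it into the factor i xi_j. The constant 4 is what Young's inequality leaves in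
    place of 1. *)
Theorem weakT_bound j h v W : sqint mu h -> fourier v W -> weakT j v h ->
  sqint mu (fun xi : V => (0 +i* xi ord0 j) * W xi) ->
  kappa * ip mu h h <= 4 * ip mu (fun xi : V => (0 +i* xi ord0 j) * W xi)
                           (fun xi : V => (0 +i* xi ord0 j) * W xi).
Proof.
move=> h2 fvW wvh xW2; have [v2 W2] := fourier_sqint fvW.
set A := fun xi : V => (0 +i* xi ord0 j) * W xi.
have k0 := @kappa_gt0 R n.
apply/ler_addgt0Pr => e e0.
(* The errors sum to 5/2 kappa D, with D the squared distance from h to Phi; the 3 covers this. *)
have e' : 0 < e / (3 * kappa) by rewrite divr_gt0// mulr_gt0.
have [Phi [dPhi [hPhi [f1 f2 f3]]] Pe] := fourier_adjoint_dense h2 v2 wvh e'.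
have [P2 hP2] := fourier_sqint f1; have [dP2 xP2] := fourier_sqint f2.
have d2 : sqint mu (fun x => h x - Phi x) by exact: sqintB.
rewrite (nsq_ip d2) lee_fin in Pe.
(* The minus sign of the weak derivative is undone by moving i xi_j across the real inner product,
   for which it is antisymmetric. *)
have s1 : kappa * ip mu h Phi = ip mu A hPhi.
  rewrite ip_cint f3 cReN -ip_cint mulrN -(plancherel_ip fvW f2).
  rewrite -mulN1r -RintegralZl//; last exact: integrable_rdot.
  apply: eq_Rintegral => xi _; rewrite /A /rdot.
  by case: (W xi) (hPhi xi) => ? ? [? ?] /=; ring.
(* The weights 4 here and 1/2 in [s4] leave kappa H on the right against 2 kappa H on the left, so
   it can be absorbed. *)
have s2 := ip_le_eta xW2 hP2 (ltr0n R 4).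
rewrite -/A -s1 (plancherel f1) in s2.
have s3 : ip mu h h = ip mu h Phi + ip mu h (fun x => h x - Phi x).
  rewrite -ipDr//; congr ip; apply/funext => x; ring.
have h12 : 0 < 2^-1 :> R by rewrite invr_gt0.
have {}s4 := ip_le_eta h2 d2 h12.
have s5 : ip mu Phi Phi <= 2 * ip mu h h + 2 * ip mu (fun x => h x - Phi x) (fun x => h x - Phi x).
  have := ipD_le h2 (sqintN d2).
  rewrite (_ : (fun x => h x + _) = Phi); last by apply/funext => x; ring.
  have -> : ip mu (fun x => - (h x - Phi x)) (fun x => - (h x - Phi x)) =
     ip mu (fun x => h x - Phi x) (fun x => h x - Phi x).
    by apply: eq_Rintegral => x _; rewrite /rdot !cReN !cImN; ring.
  by [].
set H := ip mu h h in s3 s4 s5 *; set D := ip mu (fun x => h x - Phi x) _ in Pe s4 s5.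
set X := ip mu h Phi in s2 s3; set Y := ip mu h (fun x => _) in s3 s4.
set F := ip mu Phi Phi in s2 s5; set AA := ip mu A A in s2 *.
rewrite ler_pdivlMr ?mulr_gt0// in Pe.
rewrite invrK in s4.
have t1 : kappa * F <= kappa * (2 * H + 2 * D) by rewrite ler_pM2l.
have t2 : kappa * (Y *+ 2) <= kappa * (2^-1 * H + 2 * D) by rewrite ler_pM2l.
have D0 : 0 <= D by apply: ip_ge0.
have t3 : kappa * H = kappa * X + kappa * Y by rewrite s3 mulrDr.
nra.
Qed.

End weak_derivatives.

(** * The commutator with a coordinate *)

Section commutator_estimate.
Context {R : realType} (n : nat).
Local Notation V := 'rV[R]_n.
Local Notation mu := (lebesgue_rV R n).
Local Notation T1 := (measurableTypeR R).
Local Notation kappa := (@kappa R n).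
Implicit Types (f g h u w q F G : V -> R[i]) (s : R) (i j : 'I_n).

Lemma le_ip (a : R) f g : cmeas f -> sqint mu g -> 0 <= a ->
  (forall x, sq (f x) <= a * sq (g x)) -> ip mu f f <= a * ip mu g g.
Proof.
move=> mf g2 a0 fg; have f2 : sqint mu f by apply: sqint_le fg.
have := @le_nsq _ _ _ mu a f g mf (proj1 g2) a0 fg.
by rewrite !nsq_ip// -EFinM lee_fin.
Qed.

Lemma fourierB f g F G : fourier f F -> fourier g G ->
  fourier (fun x => f x - g x) (fun xi => F xi - G xi).
Proof.
move=> fF /(fourierZ (-1)) gG; have := fourierD fF gG.
rewrite (_ : (fun x => f x + _) = fun x => f x - g x); last first.
  by apply/funext => x; rewrite mulN1r.
by rewrite (_ : (fun xi => F xi + _) = fun xi => F xi - G xi)//; apply/funext => xi; rewrite mulN1r.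
Qed.

Lemma dot_basis (x : V) i s : dot x (s *: basis_vector i) = x ord0 i * s.
Proof.
rewrite /dot (bigD1 i)//= !mxE !eqxx mulr1 big1 ?addr0// => k ki.
by rewrite !mxE (negbTE ki) andbF !mulr0.
Qed.

(** The Fourier side of sin(s x_i)/s = (e^(i s x_i) - e^(-i s x_i)) / (2 i s): each exponential is a
    translation, and the coefficient is 1 / (2 i s). *)
Definition shift_diff i s F (xi : V) : R[i] :=
  (0 +i* - (2 * s)^-1) *
  (F (xi - s *: basis_vector i) - F (xi - (- s) *: basis_vector i)).

Lemma fourier_sinc i s f F : s != 0 -> fourier f F ->
  fourier (fun x => (sinc s (x ord0 i))%:C * f x) (shift_diff i s F).
Proof.
move=> s0 fF; have f1 := fourier_modulation (s *: basis_vector i) fF.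
have f2 := fourier_modulation ((- s) *: basis_vector i) fF.
have := fourierZ (0 +i* - (2 * s)^-1) (fourierB f1 f2).
congr fourier; apply/funext => x; rewrite !dot_basis /cker !mulrN !opprK !cosN !sinN /sinc.
apply: complex_ext; rewrite !ReImE /= ?mul0r ?sub0r ?subr0 ?add0r; by field.
Qed.

Definition bessel (xi : V) : R := symbol_schrodinger xi `^ (- 2^-1).

Lemma dot_ge0 (x : V) : 0 <= dot x x.
Proof. by apply: sumr_ge0 => i _; rewrite -expr2 sqr_ge0. Qed.

Lemma besselE (xi : V) : bessel xi = (Num.sqrt (dot xi xi + 1))^-1.
Proof.
rewrite /bessel /symbol_schrodinger /enorm sqr_sqrtr ?dot_ge0//.
by rewrite powRN powR12_sqrt// addr_ge0 ?dot_ge0.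
Qed.

Lemma japanese_ge1 (xi : V) : 1 <= Num.sqrt (dot xi xi + 1).
Proof. by rewrite -[leLHS]sqrtr1 ler_wsqrtr// lerDr dot_ge0. Qed.

Lemma japanese_coord (xi : V) j : `|xi ord0 j| <= Num.sqrt (dot xi xi + 1).
Proof.
rewrite -sqrtr_sqr ler_wsqrtr// /dot (bigD1 j)//= -expr2 -addrA lerDl.
by rewrite addr_ge0// sumr_ge0// => i _; rewrite -expr2 sqr_ge0.
Qed.

Lemma dotC (x y : V) : dot x y = dot y x.
Proof. by apply: eq_bigr => i _; rewrite mulrC. Qed.

(** With A and B the two roots, A^2 - B^2 = s (xi_i + eta_i), and A + B dominates |xi_i + eta_i|;
    divide by A + B. *)
Lemma japanese_lip (xi : V) i s : `|Num.sqrt (dot xi xi + 1) -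
  Num.sqrt (dot (xi - s *: basis_vector i) (xi - s *: basis_vector i) + 1)| <= `|s|.
Proof.
set eta := xi - _; set A := Num.sqrt _; set B := Num.sqrt _.
have A1 : 1 <= A := japanese_ge1 xi; have B1 : 1 <= B := japanese_ge1 eta.
have AE : A ^+ 2 = dot xi xi + 1 by rewrite sqr_sqrtr// addr_ge0 ?dot_ge0.
have BE : B ^+ 2 = dot eta eta + 1 by rewrite sqr_sqrtr// addr_ge0 ?dot_ge0.
have Ai : `|xi ord0 i| <= A := japanese_coord xi i.
have Bi : `|eta ord0 i| <= B := japanese_coord eta i.
have E : (A - B) * (A + B) = s * (xi ord0 i + eta ord0 i).
  rewrite -subr_sqr AE BE {2}/eta dotBr dot_basis (dotC eta xi) /eta dotBr dot_basis.
  rewrite !mxE !eqxx mulr1.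
  ring.
have AB : 0 < A + B by lra.
rewrite -(ler_pM2r AB) -{1}(gtr0_norm AB) -normrM E normrM ler_wpM2l//.
by apply: le_trans (ler_normD _ _) _; exact: lerD.
Qed.

Lemma sqr_coord_bessel (xi : V) j : (xi ord0 j * bessel xi) ^+ 2 <= 1.
Proof.
rewrite besselE; have := japanese_ge1 xi; have := japanese_coord xi j.
set A := Num.sqrt _ => h A1; have A0 : 0 < A by lra.
rewrite -real_normK ?num_real// expr_le1//.
by rewrite normrM normfV (gtr0_norm A0) ler_pdivrMr// mul1r.
Qed.

Lemma bessel_sqr_le1 (xi : V) : bessel xi ^+ 2 <= 1.
Proof.
rewrite besselE; have := japanese_ge1 xi => A1; have A0 := lt_le_trans ltr01 A1.
by rewrite expr_le1 ?invr_ge0 ?(ltW A0)// invf_le1.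
Qed.

(** In xi_j (1/A - 1/B) = (xi_j / A) ((B - A) / B) the first factor is at most 1 in absolute value,
    B >= 1, and [japanese_lip] bounds B - A. *)
Lemma coord_besselB (xi : V) i j s :
  (xi ord0 j * (bessel xi - bessel (xi - s *: basis_vector i))) ^+ 2 <= s ^+ 2.
Proof.
rewrite !besselE; have := japanese_lip xi i s; set eta := xi - _.
have := japanese_ge1 xi; have := japanese_ge1 eta; have := japanese_coord xi j.
set A := Num.sqrt (dot xi xi + 1); set B := Num.sqrt _ => hA B1 A1 AB.
have A0 : 0 < A by lra. have B0 : 0 < B by lra.
rewrite -real_normK ?num_real// -[leRHS]real_normK ?num_real// ler_sqr ?nnegrE//.
have -> : xi ord0 j * (A^-1 - B^-1) = (xi ord0 j / A) * ((B - A) / B).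
  by field; rewrite !gt_eqF.
rewrite !normrM !normfV (gtr0_norm A0) (gtr0_norm B0) distrC.
apply: le_trans AB; rewrite -[leRHS]mul1r; apply: ler_pM => //.
- by rewrite divr_ge0// ltW.
- by rewrite divr_ge0// ltW.
- by rewrite ler_pdivrMr// mul1r.
- by rewrite ler_pdivrMr// ler_peMr.
Qed.

(** With c = 1 / (2 i s), the left side splits into i x m (G - c (F1 - F2)) and c times two terms
    with differences of the multiplier. The factor s^2 gained in these cancels |c|^2 = 1 / (4 s^2),
    so the bound is independent of s. *)
Lemma sq_symbol_le (x m m1 m2 s : R) (G F1 F2 : R[i]) : 0 < s ->
  (x * m) ^+ 2 <= 1 -> (x * (m - m1)) ^+ 2 <= s ^+ 2 -> (x * (m - m2)) ^+ 2 <= s ^+ 2 ->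
  sq ((0 +i* x) * (m%:C * G - (0 +i* - (2 * s)^-1) * (m1%:C * F1 - m2%:C * F2))) <=
  2 * sq (G - (0 +i* - (2 * s)^-1) * (F1 - F2)) + sq F1 + sq F2.
Proof.
move=> s0 hm h1 h2; set c := 0 +i* - (2 * s)^-1.
have -> : (0 +i* x) * (m%:C * G - c * (m1%:C * F1 - m2%:C * F2)) =
    (0 +i* (x * m)) * (G - c * (F1 - F2)) +
    c * ((0 +i* (x * (m - m1))) * F1 - (0 +i* (x * (m - m2))) * F2).
  by apply: complex_ext; rewrite !ReImE /=; ring.
apply: le_trans (sqD_le _ _) _; rewrite -addrA; apply: lerD.
  rewrite sqM ler_pM2l// ler_piMl ?sq_ge0// sqE /=; lra.
rewrite sqM; have -> : sq c = (4 * s ^+ 2)^-1.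
  by rewrite sqE /c /=; field; rewrite gt_eqF.
apply: (@le_trans _ _ (2 * ((4 * s ^+ 2)^-1 * (2 * (s ^+ 2 * sq F1) + 2 * (s ^+ 2 * sq F2))))).
  have c0 : 0 <= (4 * s ^+ 2)^-1 by rewrite invr_ge0 mulr_ge0// sqr_ge0.
  rewrite ler_pM2l// ler_wpM2l//.
  apply: le_trans (sqB_le _ _) _; rewrite !sqM.
  apply: lerD; rewrite ler_pM2l// ler_wpM2r ?sq_ge0// sqE /=; lra.
rewrite le_eqVlt; apply/orP; left; apply/eqP; field; rewrite gt_eqF//.
Qed.

Lemma ip_bessel u f F : fourier f F -> fourier u (fun xi => (bessel xi)%:C * F xi) ->
  ip mu u u <= ip mu f f.
Proof.
move=> fF uF; rewrite -(ler_pM2l (@kappa_gt0 R n)) -(plancherel fF) -(plancherel uF).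
have [_ F2] := fourier_sqint fF; have [_ mF2] := fourier_sqint uF.
rewrite -[leRHS]mul1r; apply: le_ip => //; first by case: mF2.
by move=> xi; rewrite sqM sq_real ler_wpM2r ?sq_ge0 ?bessel_sqr_le1.
Qed.

Lemma cmeas_iota j : cmeas (fun xi : V => 0 +i* xi ord0 j).
Proof. by split => /=; [exact: measurable_cst|exact: measurable_coord]. Qed.

(* Here g = T f and h = T q for q close to (sinc s x_i) f, so that h - (sinc s x_i) g
   is close to a commutator, with a bound uniform in s. *)
Lemma ip_sinc_commutator i j s f g u q h w F G : 0 < s ->
  fourier f F -> fourier u (fun xi => (bessel xi)%:C * F xi) ->
  fourier q G -> fourier w (fun xi => (bessel xi)%:C * G xi) ->
  sqint mu g -> sqint mu h -> weakT j u g -> weakT j w h ->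
  ip mu (fun x => h x - (sinc s (x ord0 i))%:C * g x)
        (fun x => h x - (sinc s (x ord0 i))%:C * g x) <=
  16 * ip mu (fun x => q x - (sinc s (x ord0 i))%:C * f x)
             (fun x => q x - (sinc s (x ord0 i))%:C * f x) + 18 * ip mu f f.
Proof.
move=> s0 fF uF qG wG g2 h2 wug wwh; have s_neq0 : s != 0 by rewrite gt_eqF.
have [f2 F2] := fourier_sqint fF; have [q2 G2] := fourier_sqint qG.
have [u2 _] := fourier_sqint uF; have [w2 _] := fourier_sqint wG.
have k0 := @kappa_gt0 R n.
have fDs := fourierB qG (fourier_sinc i s_neq0 fF).
have fW := fourierB wG (fourier_sinc i s_neq0 uF).
have [D2 DF2] := fourier_sqint fDs; have [v2 W2] := fourier_sqint fW.
pose W xi := (bessel xi)%:C * G xi - shift_diff i s (fun eta => (bessel eta)%:C * F eta) xi.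
pose DF xi := G xi - shift_diff i s F xi.
pose D x := q x - (sinc s (x ord0 i))%:C * f x.
rewrite -/W in fW W2; rewrite -/DF -/D in fDs D2 DF2.
pose t1 := s *: basis_vector i : V; pose t2 := (- s) *: basis_vector i : V.
have F12 := sqint_translation t1 F2; have F22 := sqint_translation t2 F2.
pose X (xi : V) : R[i] := (0 +i* xi ord0 j) * W xi.
have mX : cmeas X by apply: cmeasM; [exact: cmeas_iota|case: W2].
have XE xi : sq (X xi) <= 2 * sq (DF xi) + sq (F (xi - t1)) + sq (F (xi - t2)).
  apply: sq_symbol_le => //; [exact: sqr_coord_bessel|exact: coord_besselB|].
  by rewrite -[s ^+ 2]sqrrN; exact: coord_besselB.
have nX : (nsq mu X <= 2%:E * nsq mu DF + nsq mu (fun xi => F (xi - t1)%R) +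
    nsq mu (fun xi => F (xi - t2)%R))%E.
  have mDF := measurable_sqE (proj1 DF2).
  have m1 := measurable_sqE (proj1 F12); have m2 := measurable_sqE (proj1 F22).
  have p a : (0 <= (sq a)%:E :> \bar R)%E by rewrite lee_fin sq_ge0.
  rewrite /nsq -ge0_integralZl//= -!ge0_integralD//=.
  - apply: ge0_le_integral => //=.
    + exact: measurable_sqE.
    + apply: emeasurable_funD => //; apply: emeasurable_funD => //.
      exact: measurable_funeM.
    + by move=> xi _; rewrite -!EFinM -!EFinD lee_fin.
  - by move=> x _; rewrite adde_ge0// mule_ge0.
  - by apply: emeasurable_funD => //; exact: measurable_funeM.
  - by move=> x _; rewrite mule_ge0.
  - exact: measurable_funeM.
rewrite (nsq_ip DF2) (nsq_ip F12) (nsq_ip F22) -EFinM -!EFinD in nX.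
have X2 : sqint mu X by split => //; apply: le_lt_trans nX (ltry _).
rewrite (nsq_ip X2) lee_fin !ip_translation// (plancherel fDs) (plancherel fF) in nX.
(* The Leibniz term, present when j = i; it is bounded by u, hence by f. *)
pose du (x : V) : R[i] := ((j == i)%:R * cos (x ord0 i * s))%:C * u x.
pose ag (x : V) : R[i] := (sinc s (x ord0 i))%:C * g x.
have sqc (x : V) : ((j == i)%:R * cos (x ord0 i * s)) ^+ 2 <= 1 :> R.
  rewrite exprMn; case: eqP => _; rewrite ?expr1n ?mul1r ?sqr_cos_le1//.
  by rewrite expr0n mul0r.
have du2 : sqint mu du.
  apply: (@sqint_mulr _ _ (fun x => (j == i)%:R * cos (x ord0 i * s)) 1) => //.
  by apply: measurable_funM => //; exact: measurable_cosc.
have ag2 : sqint mu ag.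
  apply: (@sqint_mulr _ _ (fun x => sinc s (x ord0 i)) (s ^- 2)) => //.
    exact: measurable_sinc.
  by move=> x; exact: sqr_sinc_le.
have au2 : sqint mu (fun x => (sinc s (x ord0 i))%:C * u x).
  apply: (@sqint_mulr _ _ (fun x => sinc s (x ord0 i)) (s ^- 2)) => //.
    exact: measurable_sinc.
  by move=> x; exact: sqr_sinc_le.
(* A weak derivative of w - (sinc s x_i) u, whose transform is W. *)
have hw := weakTB w2 h2 au2 (sqintD ag2 du2) wwh (weakT_sinc i s_neq0 u2 g2 wug).
have h'2 : sqint mu (fun x => h x - (ag x + du x)) by exact/sqintB/sqintD.
have hb := weakT_bound h'2 fW hw X2.
have ub : ip mu du du <= 1 * ip mu u u.
  apply: le_ip => //; first by case: du2.
  by move=> x; rewrite /du sqM sq_real ler_wpM2r ?sq_ge0.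
have uf := ip_bessel fF uF.
have := ipD_le h'2 du2.
rewrite (_ : (fun x => h x - (ag x + du x) + du x) = fun x => h x - ag x); last first.
  by apply/funext => x; ring.
rewrite -/D -/ag => hh; apply: le_trans hh _.
(* In squared norms, 4 (2 D + 2 f) = 8 D + 8 f; doubling this and adding 2 f for [du] gives the
   constants 16 and 18. *)
have : ip mu (fun x => h x - (ag x + du x)) (fun x => h x - (ag x + du x)) <=
   8 * ip mu D D + 8 * ip mu f f.
  rewrite -(ler_pM2l k0); apply: le_trans hb _; rewrite -/X.
  apply: le_trans (_ : 4 * (2 * (kappa * ip mu D D) + kappa * ip mu f f + kappa * ip mu f f) <= _).
    by rewrite ler_pM2l.
  lra.
lra.
Qed.

End commutator_estimate.

(** * Passage to the limit s -> 0 *)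

Section commutator_coordinate.
Context {R : realType} (n : nat).
Local Notation V := 'rV[R]_n.
Local Notation mu := (lebesgue_rV R n).
Local Notation T1 := (measurableTypeR R).
Implicit Types (f g h : V -> R[i]) (i j : 'I_n).

(** The limit is the derivative of y |-> sin(y t) at y = 0, taken along y = 1 / (k+1). *)
Lemma sinc_cvg (t : R) : (fun k : nat => sinc k.+1%:R^-1 t) @ \oo --> t.
Proof.
have d0 : is_derive (0 : R) (1 : R) (fun y : R => sin (y * t)) t.
  by apply: (is_derive_eq (is_derive_sinM t 0)); rewrite mul0r cos0 mul1r.
have dv : derivable (fun y : R => sin (y * t)) 0 1 by [].
have := dv; rewrite /derivable; have := @derive_val _ _ _ _ _ _ _ d0.
rewrite /derive => + cv; have {}cv := cv => E.
have {}cv : (fun y : R => y^-1 *: (sin ((y *: 1 + 0) * t) - sin (0 * t))) @ 0^' --> t.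
  by rewrite -[X in _ --> X]E; exact: cv.
have u0 : (fun k : nat => k.+1%:R^-1 : R) @ \oo --> 0^'.
  move=> A hA; have : \forall k \near \oo, k.+1%:R^-1 != 0 :> R -> A k.+1%:R^-1.
    exact: (@cvg_invS R _ hA).
  by apply: filterS => k; apply; rewrite invr_eq0 pnatr_eq0.
have := cvg_comp _ _ u0 cv; apply: cvg_trans; apply: near_eq_cvg.
near=> k; rewrite /comp /sinc mul0r sin0 subr0 addr0 /GRing.scale /= mulr1.
by rewrite mulrC [t * _]mulrC mulrC.
Unshelve. all: by end_near. Qed.

Lemma sqint_sinc i (k : nat) f : sqint mu f ->
  sqint mu (fun x : V => (sinc k.+1%:R^-1 (x ord0 i))%:C * f x).
Proof.
move=> f2; apply: (@sqint_mulr _ _ (fun x => sinc k.+1%:R^-1 (x ord0 i)) (k.+1%:R^-1 ^- 2)) => //.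
  exact: measurable_sinc.
by move=> x; exact: sqr_sinc_le.
Qed.

(** As |sinc s t| <= |t|, the function x_i f, square-integrable by hypothesis, is a majorant. *)
Lemma cvg_sinc_coord i f : sqint mu f -> sqint mu (fun x : V => (x ord0 i)%:C * f x) ->
  (fun k : nat => nsq mu (fun x : V => (sinc k.+1%:R^-1 (x ord0 i))%:C * f x -
     (x ord0 i)%:C * f x)) @ \oo --> 0%E.
Proof.
move=> f2 bf2; apply: (nsq_dominated (g := fun x : V => (x ord0 i)%:C * f x)) => //.
- by move=> k; case: (sqint_sinc i k f2).
- by case: bf2.
- move=> k x; rewrite !sqM !sq_real ler_wpM2r ?sq_ge0//.
  rewrite -real_normK ?num_real// -[leRHS]real_normK ?num_real// ler_sqr ?nnegrE//.
  by rewrite normr_sinc_le.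
- move=> x; under eq_fun do rewrite -mulrBl -rmorphB sqM sq_real.
  rewrite -(mul0r (sq (f x))); apply: cvgMl.
  rewrite -(mulr0 (0 : R)); under eq_fun do rewrite expr2.
  have h : (fun k : nat => sinc k.+1%:R^-1 (x ord0 i) - x ord0 i) @ \oo --> (0 : R).
    by rewrite -(subrr (x ord0 i)); apply: cvgB; [exact: sinc_cvg|exact: cvg_cst].
  exact: cvgM.
Qed.

Theorem commutator_coord i j : commutator_bounded (fun x : V => x ord0 i) (T3 j).
Proof.
(* 5 is enough because 18 <= 5^2. *)
exists 5 => f g h _ _ [/L2P f2 /L2P g2 [u [F fF uF] wug]] [/L2P q2 /L2P h2 [w [G qG wG] wwh]].
have {}wug := weak_partialT wug; have {}wwh := weak_partialT wwh.
set q := pointwise_mul _ f in q2 qG *.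
pose c (k : nat) (x : V) : R := sinc k.+1%:R^-1 (x ord0 i).
have k0 (k : nat) : 0 < k.+1%:R^-1 :> R by rewrite invr_gt0.
have est k := ip_sinc_commutator i (k0 k) fF uF qG wG g2 h2 wug wwh.
apply: L2norm_le => //; rewrite -[X in (X <= _)%E]nsqN.
rewrite (eq_nsq mu (g := fun x => h x - (x ord0 i)%:C * g x)); last first.
  by move=> x; rewrite opprB.
have cq k : sqint mu (fun x => q x - (c k x)%:C * f x) by exact/sqintB/sqint_sinc.
have ch k : sqint mu (fun x => h x - (c k x)%:C * g x) by exact/sqintB/sqint_sinc.
apply: (@le_trans _ _ (18%:E * nsq mu f)%E); last first.
  by rewrite lee_wpmul2r ?nsq_ge0// lee_fin; lra.
rewrite (nsq_ip f2) -EFinM; apply/lee_addgt0Pr => e e0; rewrite -EFinD.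
have e16 : 0 < e / 16 by rewrite divr_gt0.
have e16' : (0 < (e / 16)%:E)%E by rewrite lte_fin.
have c0 := cvg_sinc_coord f2 q2.
(* From N on the error term of [est] is 16 times a quantity below e / 16; Fatou's lemma is applied
   to the sequence shifted by N. *)
have [N _ hN] := c0 [set y | (y < (e / 16)%:E)%E] (lt_nbhsl e16').
have cN (t a b : R) : (fun k : nat => a - sinc (k + N)%N.+1%:R^-1 t * b) @ \oo --> a - t * b.
  apply: cvgB; first exact: cvg_cst.
  apply: cvgMl; have := @sinc_cvg t; rewrite -(cvg_shiftn N); exact.
apply: (@nsq_fatou _ _ _ mu (fun k x => h x - (c (k + N)%N x)%:C * g x)).
- by move=> k; case: (ch (k + N)%N).
- move=> x; under eq_fun do rewrite !ReImE /= mul0r subr0.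
  by rewrite !ReImE /= mul0r subr0; exact: cN.
- move=> x; under eq_fun do rewrite !ReImE /= mul0r addr0.
  by rewrite !ReImE /= mul0r addr0; exact: cN.
move=> k; rewrite (nsq_ip (ch _)) lee_fin; apply: le_trans (est _) _.
have /= := hN (k + N)%N (leq_addl _ _).
rewrite -nsqN (eq_nsq mu (g := fun x => q x - (c (k + N)%N x)%:C * f x)); last first.
  by move=> x; rewrite opprB.
rewrite (nsq_ip (cq _)) lte_fin /c; lra.
Qed.

End commutator_coordinate.

(** * Coordinates are locally integrable but not in BMO *)

Section coordinate_function.
Context {R : realType} (n : nat).
Local Notation V := 'rV[R]_n.
Local Notation mu := (lebesgue_rV R n).
Local Notation T1 := (measurableTypeR R).
Implicit Types (i j : 'I_n).

Import HBNNSimple.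

(* Unlike [ge0_le_integral], this makes no measurability assumption on [D]. *)
Lemma ge0_integral_le_patch d (T : measurableType d) (m : {measure set T -> \bar R})
    (D : set T) (f h : T -> \bar R) : (forall x, D x -> 0 <= f x)%E ->
  measurable_fun setT h -> (forall x, 0 <= h x)%E -> (forall x, (f \_ D) x <= h x)%E ->
  (\int[m]_(x in D) f x <= \int[m]_x h x)%E.
Proof.
move=> f0 mh h0 fh; rewrite ge0_integralE//.
apply: ge_ereal_sup => _ [phi /= phif <-].
have -> : sintegral m phi = (\int[m]_x (phi x)%:E)%E by rewrite integral_nnsfun// patch_setT.
apply: ge0_le_integral => //=.
- by move=> x _; rewrite lee_fin.
- exact/measurable_EFinP.
- by move=> x _; apply: le_trans (phif x) (fh x).
Qed.

Lemma coord_le_norm (x : V) i : `|x ord0 i| <= `|x|.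
Proof.
rewrite [leRHS]mx_normrE.
exact: (@le_bigmax _ _ _ _ (fun ij => `|x ij.1 ij.2|) (ord0, i)).
Qed.

Lemma locally_integrable_coord i : locally_integrable_rV (fun x : V => x ord0 i).
Proof.
split; first exact: measurable_coord.
move=> K /compact_bounded[M [_ MK]].
pose k := (Num.truncn (`|M| + 1)).+1.
have Kk x : K x -> forall j, `|x ord0 j| < k%:R.
  move=> Kx j; apply: le_lt_trans (coord_le_norm x j) _.
  have Mx : `|x| <= `|M| + 1 by apply: MK => //; rewrite (le_lt_trans (ler_norm M))// ltrDl.
  by apply: le_lt_trans Mx _; rewrite /k truncnS_gt.
pose h (x : V) : \bar R := (k%:R * \1_(cube k) x)%:E.
have mh : measurable_fun setT h.
  apply/measurable_EFinP; apply: measurable_funM => //.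
  by apply: measurable_indic; exact: measurable_box.
apply: (@le_lt_trans _ _ (\int[mu]_x h x)%E).
  apply: ge0_integral_le_patch => // x; rewrite /h ?lee_fin ?mulr_ge0//.
  rewrite patchE; case: ifPn => [/set_mem Kx|_]; last by rewrite lee_fin mulr_ge0.
  rewrite lee_fin indicE mem_set ?mulr1; first exact/ltW/Kk.
  move=> j; have := Kk x Kx j; rewrite ltr_norml in_itv/= => /andP[-> /ltW ->].
  by [].
rewrite /h; under eq_integral do rewrite EFinM.
rewrite ge0_integralZl//; last first.
  by apply/measurable_EFinP/measurable_indic; exact: measurable_box.
rewrite integral_indic//; last exact: measurable_box.
by rewrite setIT lte_mul_pinfty//; exact: box_finite.
Qed.

Lemma box_measure (a b : 'I_n -> R) (l : R) : 0 < l -> (forall i, b i - a i = l) ->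
  mu (box a b) = (l ^+ n)%:E.
Proof.
move=> l0 abl; have := lebesgue_rV_box (A := fun i => `]a i, b i]%classic) _ => /= ->; last first.
  by move=> i; exact: measurable_itv.
rewrite (eq_bigr (fun=> l%:E)) => [|i _]; last first.
  by rewrite lebesgue_measure_itv/= lte_fin -subr_gt0 abl l0 -EFinB abl.
by rewrite prodEFin prodr_const card_ord.
Qed.

(** Whatever the mean m is, the ball contains a cube of side d on which x_i differs from m by at
    least d. Its volume is a fixed proportion of that of a cube around the ball, so the oscillation
    grows at least like d. *)
Lemma oscillation_coord i (d : R) : 0 < d ->
  (((d / (2 * n.+2%:R) ^+ n)%:E <=
   mean_oscillation (fun x : V => x ord0 i) (eball 0 (n.+2%:R * d)))%E).
Proof.
move=> d0; set r := n.+2%:R * d; set B := eball 0 r.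
have r0 : 0 < r by rewrite mulr_gt0.
pose m := mean (fun x : V => x ord0 i) B.
have mB : measurable B by exact: measurable_eball0.
pose A (c : R) := box (fun j => if j == i then c else 0) (fun j => (if j == i then c else 0) + d).
have mA c : measurable (A c) by exact: measurable_box.
have muA c : mu (A c) = (d ^+ n)%:E.
  by apply: box_measure => // j; rewrite addrAC subrr add0r.
have AB c : `|c| <= 2 * d -> `|c + d| <= 2 * d -> A c `<=` B.
  (* Coordinates of size at most 2 d give norm at most 2 sqrt(n) d; the radius is (n + 2) d because
     4 n < (n + 2)^2. *)
  move=> c1 c2 x Ax; rewrite /B eball0E /= /enorm.
  have xj j : x ord0 j * x ord0 j <= 4 * d ^+ 2.
    have : `|x ord0 j| <= 2 * d.
      have := Ax j; rewrite in_itv/=; case: ifP => _ /andP[h1 h2].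
        by move: c1 c2; rewrite !ler_norml; lra.
      by rewrite ler_norml; lra.
    rewrite -expr2 -[x ord0 j ^+ 2]real_normK ?num_real// => h.
    have -> : 4 * d ^+ 2 = (2 * d) ^+ 2 by ring.
    by rewrite ler_sqr ?nnegrE// mulr_ge0// ltW.
  rewrite -(gtr0_norm r0) -sqrtr_sqr ltr_sqrt ?exprn_gt0//.
  apply: (@le_lt_trans _ _ (\sum_(j < n) 4 * d ^+ 2)); first exact: ler_sum.
  rewrite sumr_const card_ord -mulr_natr /r -[n.+2]addn2 natrD.
  have := ler0n R n; set N : R := n%:R => N0.
  have : 0 < d ^+ 2 by rewrite exprn_gt0.
  nra.
have BC : B `<=` box (fun=> - r) (fun=> r).
  move=> x; rewrite /B eball0E /= => xr j.
  have := le_lt_trans (normr_coord_le x j) xr.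
  by rewrite ltr_norml in_itv/= => /andP[-> /ltW ->].
have muC : mu (box (fun=> - r) (fun=> r)) = ((2 * r) ^+ n)%:E.
  by apply: box_measure => [|j]; [rewrite mulr_gt0|ring].
have muB : (mu B <= ((2 * r) ^+ n)%:E)%E.
  by rewrite -muC; apply: le_measure => //; rewrite inE//; exact: measurable_box.
(* The cube is placed on the side of the hyperplane x_i = 0 opposite to m, which avoids computing
   m. *)
have [c [c1 c2 cA]] : exists c, [/\ `|c| <= 2 * d, `|c + d| <= 2 * d &
    forall x, A c x -> d <= `|x ord0 i - m|].
  have [m0|m0] := leP 0 m.
    exists (- (2 * d)); split; rewrite ?ler_norml; [lra|lra|].
    move=> x /(_ i); rewrite eqxx in_itv/= => /andP[h1 h2].
    by rewrite ler0_norm; lra.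
  exists d; split; rewrite ?ler_norml; [lra|lra|].
  move=> x /(_ i); rewrite eqxx in_itv/= => /andP[h1 h2].
  by rewrite ger0_norm; lra.
have {}AB := AB c c1 c2.
have muAB : ((d ^+ n)%:E <= mu B)%E.
  by rewrite -(muA c); apply: le_measure => //; rewrite inE.
have finB : mu B \is a fin_num.
  by rewrite ge0_fin_numE// (le_lt_trans muB)// ltry.
rewrite /mean_oscillation -/m.
have mf : measurable_fun setT (fun x : V => `|x ord0 i - m|%:E).
  apply/measurable_EFinP; apply: measurableT_comp => //.
  by apply: measurable_funB => //; exact: measurable_coord.
have I : ((d * d ^+ n)%:E <= \int[mu]_(y in B) `|y ord0 i - m|%:E)%E.
  apply: (@le_trans _ _ (\int[mu]_(y in A c) `|y ord0 i - m|%:E)%E); last first.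
    apply: ge0_subset_integral => //.
    by apply: measurable_funTS.
  apply: (@le_trans _ _ (\int[mu]_(y in A c) d%:E)%E).
    by rewrite integral_cst// EFinM -(muA c).
  apply: ge0_le_integral => //.
  - by move=> x _; rewrite lee_fin ltW.
  - by apply: measurable_funTS.
apply: (@le_trans _ _ ((fine (mu B))^-1%:E * (d * d ^+ n)%:E)%E); last first.
  by rewrite lee_wpmul2l// lee_fin invr_ge0 fine_ge0.
rewrite -(fineK finB) !lee_fin in muB muAB.
have dn : 0 < d ^+ n by rewrite exprn_gt0.
rewrite -EFinM lee_fin ler_pdivlMl; last exact: lt_le_trans dn muAB.
have C0 : 0 < (2 * n.+2%:R) ^+ n :> R by rewrite exprn_gt0// mulr_gt0.
apply: (@le_trans _ _ ((2 * r) ^+ n * (d / (2 * n.+2%:R) ^+ n))).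
  by rewrite ler_wpM2r// divr_ge0// ltW.
rewrite /r [2 * (_ * d)]mulrA exprMn.
by rewrite le_eqVlt; apply/orP; left; apply/eqP; field; rewrite gt_eqF.
Qed.

Lemma coord_notin_BMO i : ~ BMO (fun x : V => x ord0 i).
Proof.
move=> [_ [M hM]]; have C0 : 0 < (2 * n.+2%:R) ^+ n :> R by rewrite exprn_gt0// mulr_gt0.
(* Chosen so that the lower bound for the oscillation equals |M| + 1. *)
pose d := (2 * n.+2%:R) ^+ n * (`|M| + 1).
have d0 : 0 < d by rewrite mulr_gt0// ltr_wpDl.
have := hM 0 (n.+2%:R * d) _ => /(_ (mulr_gt0 (ltr0Sn R n.+1) d0)).
move=> /(le_trans (oscillation_coord i d0)).
rewrite lee_fin /d mulrAC mulfV ?gt_eqF// mul1r => h.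
by have := ler_norm M; lra.
Qed.

End coordinate_function.

Theorem theorem4p1 (R : realType) (n : nat) (hn : (3 <= n)%N) :
  exists b : 'rV[R]_n -> R,
    [/\ locally_integrable_rV b, ~ BMO b &
        forall j : 'I_n, commutator_bounded b (T3 j)].
Proof.
have i : 'I_n := Ordinal (ltn_trans (isT : 0 < 2)%N hn).
exists (fun x => x ord0 i); split.
- exact: locally_integrable_coord.
- exact: coord_notin_BMO.
- by move=> j; exact: commutator_coord.
Qed.
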